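(* Consider the following assumptions. (A) (Assumptions on $X_t$.) $\{\xi(t)\}_{t\in\mathbb{Z}}$ is a sequence of identically distributed, $m$-dependent, $d$-dimensional random variables with $\mathbb{E}[\xi(t)]=0$ and $\mathbb{E}[\|\xi(t)\|^2]<\infty$; $\{X_t\}_{t\in\mathbb{Z}}$ is a strictly stationary sequence of $d$-dimensional random variables defined as $X_t=g(\xi(t),\xi(t-1),\ldots)$ with $g$ a measurable function; $\mathbb{E}[\|X_t\|^2]<\infty$ for all $t\in\mathbb{Z}$; and, with $X_{tl}=g(\xi(t),\ldots,\xi(t-l))$, $$\sum_{l\ge 1}\left(\mathbb{E}\left[\|X_0-X_{0l}\|^2\right]\right)^{1/2}<\infty .$$ (B) (Assumptions on the weight functions.) $\{h_N\}$ is a sequence of positive integers and $\{K_N(\cdot)\}$ is a sequence of weight functions with $$h_N\to\infty\ \text{ and }\ h_N/\sqrt N\to 0\ \text{ as } N\to\infty,\qquad K_N(k)=K_N(-k),\quad K_N(k)\ge 0\ \text{ for all } k,$$ $$\sum_{|k|\le h_N}K_N(k)=1,\qquad \sum_{|k|\le h_N}K_N^2(k)\to 0\ \text{ as } N\to\infty .$$ Under the assumptions (A) on $X_t$ and (B) on the weight functions $K_N(k)$, or under $H_0:\ \mathbb{E}[X_1]=\cdots=\mathbb{E}[X_N]$, $$\hat f(\omega)=(2\pi)^{-1}\sum_{|k|\le h_N}K_N(k)\,I_N\big(g(N,\omega)+\omega_k\big)$$ is a consistent estimator of the spectral density $f(\omega)$ of $\{X_t\}$, for $-\pi\le\omega\le\pi$.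 Consequently, there exists a consistent estimator $\hat\Sigma_N$ for $\Sigma=\sum_{j\in\mathbb{Z}}\mathrm{Cov}(X_0,X_j)$.
   Context: A sequence $\{\xi(t)\}_{t\in\mathbb{Z}}$ is $m$-dependent if for any two index sets $I,J\subset\mathbb{Z}$ with $\min_{i\in I,j\in J}|i-j|>m$, the families $\{\xi(i):i\in I\}$ and $\{\xi(j):j\in J\}$ are independent. $\|\cdot\|$ is the norm on $\mathbb{R}^d$. The same symbol $g$ is written for the measurable function of the infinite past and for the measurable function of the finitely many arguments $\xi(t),\ldots,\xi(t-l)$; it is unrelated to $g(N,\omega)$ below. Consistent means converging in probability to the estimated quantity as $N\to\infty$. Spectral density: $\{X_t\}$ is a stationary time series with $\mathbb{E}[X_t]=\mu$ whose covariance matrices $\Gamma(h)=\mathbb{E}[X_{t+h}X_t^T]-\mu\mu^T$ have absolutely summable components, and $$f(\lambda)=\frac1{2\pi}\sum_{h=-\infty}^{\infty}\Gamma(h)e^{-ih\lambda},\qquad -\pi\le\lambda\le\pi .$$ Periodogram: for $\omega_j=2\pi j/N$, $-[(N-1)/2]\le j\le[N/2]$ ($[x]$ is the integer part of $x$), the discrete Fourier transform of $X_1,\ldots,X_N$ and the periodogram are $$W(\omega_j)=\frac1{\sqrt N}\sum_{n=1}^{N}X_n e^{in\omega_j},\qquad I_N(\omega_j)=W(\omega_j)W(\omega_j)^*,$$ where $^*$ is conjugate transpose. The definition is extended to $\omega\in[-\pi,\pi]$ by $$I_N(\omega)=\begin{cases} I_N(g(N,\omega)), & \omega\ge 0,\\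 I_N^*(g(N,-\omega)), & \omega<0,\end{cases}$$ where $g(N,\omega)$ is the multiple of $2\pi/N$ nearest to $\omega$. In $\hat f$, $\omega_k=2\pi k/N$; at multiples of $2\pi/N$ outside $[-\pi,\pi]$, $I_N$ is read $2\pi$-periodically.
   Formalization: Two corrections: W(ω) uses e^{-inω} instead of e^{inω} (with the displayed sign, f̂ estimates the transpose of f when d≥2), and at ω=0 the mean E[X_t] is assumed zero (otherwise K_N(0)I_N(0) can diverge). Existence of Σ̂_N is for arbitrary mean. *)

(* Defs.v *)
From HB Require Import structures.
From mathcomp Require Import all_boot all_order all_algebra.
From mathcomp Require Import complex.
From mathcomp Require Import all_classical all_reals all_analysis measurable_realfun.

Set Implicit Arguments.
Unset Strict Implicit.
Unset Printing Implicit Defensive.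

Import Order.TTheory GRing.Theory Num.Theory.
Import numFieldNormedType.Exports.

Local Open Scope classical_set_scope.
Local Open Scope ring_scope.

(* Euclidean norm of a vector, Frobenius norm of a matrix; the norm that the
   library puts on matrices is the sup norm. *)
Definition enorm (R : realType) (m n : nat) (A : 'M[R]_(m, n)) : R :=
  Num.sqrt (\sum_i \sum_j A i j ^+ 2).

Definition enormC (R : realType) (m n : nat) (A : 'M[R[i]]_(m, n)) : R :=
  enorm (\matrix_(i, j) ComplexField.Normc.normc (A i j)).

(* Sigma-algebra on S generated by the maps f i, i in D; R^(m x n) carries its
   Borel sigma-algebra, which is generated by the entries. *)
Definition sigma_gen (R : realType) (S I : Type) (m n : nat) (D : set I)
    (f : I -> S -> 'M[R]_(m, n)) : set (set S) :=
  <<s [set A | exists i j k (B : set R),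
         [/\ D i, measurable B & A = [set s | B (f i s j k)]]] >>.

Definition borel_vec (R : realType) (d : nat) : set (set 'cV[R]_d) :=
  sigma_gen [set: unit] (fun (_ : unit) (x : 'cV[R]_d) => x).

Definition borel_fam (R : realType) (d : nat) (I : Type) :
    set (set (I -> 'cV[R]_d)) :=
  sigma_gen [set: I] (fun (i : I) (x : I -> 'cV[R]_d) => x i).

Definition mx_measurable (R : realType) (S : Type) (m n : nat)
    (F : set (set S)) (Y : S -> 'M[R]_(m, n)) : Prop :=
  forall i j (B : set R), measurable B -> F [set s | B (Y s i j)].

Section processes.
Context {disp : measure_display} {T : measurableType disp} {R : realType}.
Variables (P : probability T R) (d : nat).
Implicit Types (X xi : int -> T -> 'cV[R]_d).

Definition indep_fields (F G : set (set T)) : Prop :=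
  forall A B, F A -> G B -> (P (A `&` B) = P A * P B)%E.

Definition m_dependent (m : nat) xi : Prop :=
  forall I J : set int,
    (forall i j, I i -> J j -> (m < `|i - j|)%N) ->
    indep_fields (sigma_gen I xi) (sigma_gen J xi).

Definition identically_distributed xi : Prop :=
  forall (s t : int) (A : set 'cV[R]_d), borel_vec A ->
    P [set w | A (xi s w)] = P [set w | A (xi t w)].

Definition strictly_stationary X : Prop :=
  forall (n : nat) (t : 'I_n -> int) (s : int) (A : set ('I_n -> 'cV[R]_d)),
    borel_fam A ->
    P [set w | A (fun i => X (t i) w)] = P [set w | A (fun i => X (t i + s) w)].

Definition sqmoment (Y : T -> 'cV[R]_d) : \bar R :=
  'E_P[fun w => enorm (Y w) ^+ 2].

Definition mean (Y : T -> 'cV[R]_d) : 'cV[R]_d :=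
  \col_a fine 'E_P[fun w => Y w a 0].

(* g is the function of the infinite past and gtr l the function of the l + 1
   arguments xi(t), ..., xi(t - l); nothing relates gtr to g beyond shift_sum. *)
Record mdep_shift (m : nat) xi (g : (nat -> 'cV[R]_d) -> 'cV[R]_d)
    (gtr : forall l : nat, ('I_l.+1 -> 'cV[R]_d) -> 'cV[R]_d) X : Prop := {
  shift_xi_measurable : forall t, mx_measurable measurable (xi t);
  shift_xi_id : identically_distributed xi;
  shift_xi_dep : m_dependent m xi;
  shift_xi_mean : forall t, mean (xi t) = 0;
  shift_xi_sq : forall t, (sqmoment (xi t) < +oo)%E;
  shift_g : mx_measurable (@borel_fam R d nat) g;
  shift_gtr : forall l, mx_measurable (@borel_fam R d 'I_l.+1) (gtr l);
  shift_X : forall t w, X t w = g (fun k => xi (t - k%:Z) w);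
  shift_stationary : strictly_stationary X;
  shift_sq : forall t, (sqmoment (X t) < +oo)%E;
  shift_sum :
    (\sum_(1 <= l <oo)
       sqrte (sqmoment (fun w => (X 0 w - gtr l (fun k => xi (- k%:Z) w))%R))
     < +oo)%E }.

(* By stationarity the base point t = 0 is immaterial. *)
Definition acov X (h : int) : 'M[R]_d :=
  (\matrix_(a, b) fine 'E_P[fun w => X h w a 0 * X 0 w b 0])
  - mean (X 0) *m (mean (X 0))^T.

End processes.

(* Sum over the integers, as the limit of the sums over |k| <= n. *)
Definition sumZ (R : realType) (u : int -> R) : R :=
  limn (fun n : nat => \sum_(i < n.*2.+1) u (i%:Z - n%:Z)).

Definition sumZC (R : realType) (u : int -> R[i]) : R[i] :=
  (sumZ (fun k => complex.Re (u k)) +i* sumZ (fun k => complex.Im (u k)))%C.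

Definition expi (R : realType) (x : R) : R[i] := (cos x +i* sin x)%C.

Definition spectral_density (disp : measure_display) (T : measurableType disp)
    (R : realType) (P : probability T R) (d : nat) (X : int -> T -> 'cV[R]_d)
    (lam : R) : 'M[R[i]]_d :=
  \matrix_(a, b) ((2 * pi)^-1%:C%C *
    sumZC (fun h => (acov P X h a b)%:C%C * expi (- (h%:~R * lam)))).

(* sum over j of Cov(X_0, X_j) *)
Definition long_run_cov (disp : measure_display) (T : measurableType disp)
    (R : realType) (P : probability T R) (d : nat) (X : int -> T -> 'cV[R]_d) :
    'M[R]_d :=
  \matrix_(a, b) sumZ (fun j =>
    fine (covariance P (fun w => X 0 w a 0) (fun w => X j w b 0))).

Definition fourier_freq (R : realType) (N : nat) (k : int) : R :=
  2 * pi * k%:~R / N%:R.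

(* A relation rather than a function: the nearest multiple of 2 pi / N is not
   unique at midpoints, e.g. at om = pi when N is odd. *)
Definition nearest_freq (R : realType) (N : nat) (om x : R) : Prop :=
  (exists j : int, x = fourier_freq R N j) /\
  forall k : int, `|om - x| <= `|om - fourier_freq R N k|.

(* The sample is x 0 = X_1, ..., x (N - 1) = X_N. The exponent is negative, so
   that the expectation of dft dft^* tends to 2 pi f(lam) for the spectral
   density above; with a positive exponent it tends to the transpose, which
   differs from it in general when d >= 2. *)
Definition dft (R : realType) (d N : nat) (x : 'I_N -> 'cV[R]_d) (lam : R) :
    'cV[R[i]]_d :=
  (Num.sqrt N%:R)^-1%:C%C *:
    \sum_(n < N) expi (- (n.+1%:R * lam)) *: map_mx (real_complex R) (x n).

(* Only evaluated at multiples of 2 pi / N; it is 2 pi - periodic. *)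
Definition periodogram (R : realType) (d N : nat) (x : 'I_N -> 'cV[R]_d)
    (lam : R) : 'M[R[i]]_d :=
  dft x lam *m (map_mx Num.conj (dft x lam))^T.

Definition sum_window (V : nmodType) (h : nat) (u : int -> V) : V :=
  \sum_(i < h.*2.+1) u (i%:Z - h%:Z).

(* om0 stands for g(N, omega). *)
Definition spec_est (R : realType) (d N : nat) (h : nat) (K : int -> R)
    (x : 'I_N -> 'cV[R]_d) (om0 : R) : 'M[R[i]]_d :=
  (2 * pi)^-1%:C%C *:
    sum_window h (fun k =>
      (K k)%:C%C *: periodogram x (om0 + fourier_freq R N k)).

Record weight_functions (R : realType) (h : nat -> nat) (K : nat -> int -> R) :
    Prop := {
  weight_h_gt0 : forall N, (0 < N)%N -> (0 < h N)%N;
  weight_h_infty : ((h N)%:R : R) @[N --> \oo] --> +oo;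
  weight_h_small : ((h N)%:R / Num.sqrt N%:R : R) @[N --> \oo] --> (0 : R);
  weight_sym : forall N k, (0 < N)%N -> K N k = K N (- k);
  weight_ge0 : forall N k, (0 < N)%N -> 0 <= K N k;
  weight_sum : forall N, (0 < N)%N -> sum_window (h N) (K N) = 1;
  weight_sq : sum_window (h N) (fun k => K N k ^+ 2) @[N --> \oo] --> (0 : R) }.

Definition sample (R : realType) (T : Type) (d : nat) (X : int -> T -> 'cV[R]_d)
    (N : nat) (w : T) : 'I_N -> 'cV[R]_d :=
  fun i => X i.+1%:Z w.
Arguments sample {R T d} X N w.

Definition consistent (disp : measure_display) (T : measurableType disp)
    (R : realType) (P : probability T R) (V : zmodType) (nrm : V -> R)
    (Y : nat -> T -> V) (y : V) : Prop :=
  forall e : R, 0 < e ->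
    P [set w | e < nrm (Y N w - y)] @[N --> \oo] --> (0 : \bar R).

Definition no_change (disp : measure_display) (T : measurableType disp)
    (R : realType) (P : probability T R) (d : nat) (X : int -> T -> 'cV[R]_d)
    (N : nat) : Prop :=
  forall i j : 'I_N, mean P (X i.+1%:Z) = mean P (X j.+1%:Z).

(* Under strict stationarity the absence of a change in the mean is automatic,
   so it is not listed as a hypothesis anywhere. *)
Lemma stationary_no_change (disp : measure_display) (T : measurableType disp)
    (R : realType) (P : probability T R) (d : nat) (X : int -> T -> 'cV[R]_d) :
  (forall t, mx_measurable measurable (X t)) ->
  strictly_stationary P X -> forall N, no_change P X N.
Proof.
move=> mX sX N i j; move: i.+1%:Z j.+1%:Z => s t {i j}.
apply/colP => a; rewrite !mxE; congr fine.
have mXa u : measurable_fun setT (fun w => X u w a 0).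
  by move=> _ B mB; rewrite setTI; apply: mX.
pose f u : {mfun T >-> R} := mfun_Sub (mem_set (mXa u)).
have lawE (B : set R) : measurable B ->
    distribution P (f s) B = distribution P (f t) B.
  move=> mB; rewrite /distribution /pushforward /=.
  pose A := [set x : 'I_1 -> 'cV[R]_d | B (x ord0 a 0)].
  have bA : borel_fam A by apply: sub_sigma_algebra; exists ord0, a, 0, B.
  have := sX 1%N (fun=> s) (t - s) A bA; rewrite /A/= => E.
  by rewrite subrKC in E; exact: E.
have intE (q : R -> \bar R) : @measurable_fun _ _ R (\bar R) setT q -> (forall y, (0 <= q y)%E) ->
    (\int[P]_w q (X s w a 0)%R = \int[P]_w q (X t w a 0)%R)%E.
  move=> mq q0.
  apply: etrans (ge0_integral_distribution (f t) mq q0).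
  apply: etrans (esym (ge0_integral_distribution (f s) mq q0)) _.
  by apply: eq_measure_integral => B mB _; exact: lawE.
rewrite unlock integralE [RHS]integralE; congr (_ - _)%E.
- under eq_integral do rewrite funeposE -(funeposE (@EFin R)).
  under [RHS]eq_integral do rewrite funeposE -(funeposE (@EFin R)).
  by apply: intE => //; exact: measurable_funepos.
- under eq_integral do rewrite funenegE -(funenegE (@EFin R)).
  under [RHS]eq_integral do rewrite funenegE -(funenegE (@EFin R)).
  by apply: intE => //; exact: measurable_funeneg.
Qed.

(* Main.v *)
Require Import Defs.
From mathcomp Require Import all_boot all_order all_algebra.
From mathcomp Require Import complex.
From mathcomp Require Import all_classical all_reals all_analysis measurable_realfun.
From mathcomp Require Import zify ring lra.

(** Each entry of the estimator is, up to the factor [1 / (2 * pi)], a complex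
  number whose real and imaginary parts are quadratic forms
  [N^-1 * \sum_s \sum_t kappa (s - t) * x_s * y_t] in two coordinates [x], [y]
  of the sample, where [kappa z] is the average of [cos (z * lam + th)] over the
  frequencies [lam] of the window, with weights [K], and [th] is [0] or
  [pi / 2]. Such forms converge in mean to the sum over [u] of
  [Cov (X_u, X_0) * cos (u * om + th)] ([qform_cvg]); Markov's inequality then
  gives consistency.

  The mean is harmless. A cosine sums to [0] over the sample at every nonzero
  Fourier frequency ([sum_cos_eq0]), so if the window stays away from [0] the
  data may be centered without changing the form ([qform_center]). This is
  the case eventually when [om] is not [0]; at [om = 0] the mean is supposed to
  vanish.

  The window shrinks to the point [om], so [kappa u] tends to [cos (u * om + th)]
  at each lag [u] ([kern_cvg]). The contribution of the lags of absolute value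
  at most [n] therefore converges by a law of large numbers for the products
  [x_s * y_(s - u)] ([lln], [near_cvg]), which holds because the tail of an
  m-dependent sequence is trivial ([decouples_event]). What is left is to show
  that the larger lags are uniformly negligible.

  Only second moments are available, so variances of the form cannot be
  computed. Three facts replace them. First, a centered value [Y_t] has
  covariance at most [rate n] times the norm of [G] with every function [G] of
  the values up to time [t - n], and the rates are summable by the hypothesis on
  the approximations of [X] ([decoupling], [rate_summable]). Second, since
  [cos (u - v)] splits, the form is a convex combination of products of linear
  forms, and its mean is bounded by the energies of the two processes
  ([qform_le]); a truncation of the process thus costs little, and the process
  may be taken bounded. Third, for a bounded process each value is the sum of
  its prediction from the past at distance [r] and of an innovation. Predictions
  have norm at most [rate r], and the form is small when one of its arguments is
  a prediction. Beyond the lag [r], the form in the innovations is a sum of [r]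
  martingale transforms, whose second moments Parseval's inequality
  ([parseval_le]) bounds by the sum of the squared weights, which tends to [0]
  ([far_le]). Conditional expectations are needed here only for finitely valued
  processes, to which a fine quantisation reduces the question ([far_prob]).

  For the long-run covariance, which is [2 * pi] times the spectral density at
  [0], the mean is not known to vanish. The estimator omits the zero frequency,
  so that the mean drops out again, and differs from the previous form by
  [K_N(0)], which tends to [0], times a product of normalised sums, which is
  bounded in mean ([lrc_est_consistent]). *)

Set Implicit Arguments.
Unset Strict Implicit.
Unset Printing Implicit Defensive.

Import Order.TTheory GRing.Theory Num.Theory.
Import numFieldNormedType.Exports.

Local Open Scope classical_set_scope.
Local Open Scope ring_scope.

(** * Finite sums *)

Lemma sum_ord_cst (R : realType) (N : nat) (z : R) : \sum_(i < N) z = N%:R * z.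
Proof. by rewrite sumr_const card_ord mulr_natl. Qed.

Lemma sum_ord_ltn (N n : nat) : (\sum_(i < N) (i < n) = minn n N)%N.
Proof.
elim: N => [|N IH]; first by rewrite big_ord0 minn0.
by rewrite big_ord_recr/= IH; lia.
Qed.

(** * Trigonometric sums *)

Lemma cos_intD (R : realType) (z : int) (x : R) :
  cos (x + 2 * pi * z%:~R) = cos x.
Proof.
have cosn (n : nat) (y : R) : cos (y + 2 * pi * n%:R) = cos y.
  rewrite [2 * pi]mulr_natl mulr_natr; exact: (periodicn (@cosD2pi R)).
case: z => n; first exact: cosn.
by rewrite NegzE mulrNz mulrN -[in RHS](subrK (2 * pi * n.+1%:R) x) cosn.
Qed.

Lemma sin_intD (R : realType) (z : int) (x : R) :
  sin (x + 2 * pi * z%:~R) = sin x.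
Proof. by rewrite -!cosBpihalf addrAC cos_intD. Qed.

(** Multiplied by [2 sin (al / 2)] the sum telescopes to the difference of two
  values of a sine that are whole periods apart. *)
Lemma sum_cos_eq0 (R : realType) (N : nat) (al ph : R) (z : int) :
  0 < `|al| < 2 * pi -> N%:R * al = 2 * pi * z%:~R ->
  \sum_(s < N) cos (s%:R * al + ph) = 0.
Proof.
move=> /andP[al0 alpi] Nal.
have sinn0 : sin (al / 2) != 0.
  have : sin (`|al| / 2) != 0 :> R.
    by rewrite gt_eqF// sin_gt0_pi//; lra.
  by have [_|_] := ger0P al; rewrite // mulNr sinN oppr_eq0.
(* [F s.+1 - F s] is the product [2 sin (al / 2) cos (s al + ph)]. *)
pose F (s : nat) : R := sin (s%:R * al + ph - al / 2).
suff H : (2 * sin (al / 2)) * (\sum_(s < N) cos (s%:R * al + ph)) = 0.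
  by move/eqP: H; rewrite !mulf_eq0 pnatr_eq0/= (negPf sinn0)/= => /eqP.
rewrite mulr_sumr (eq_bigr (fun s : 'I_N => F s.+1 - F s)); last first.
  move=> s _; rewrite /F.
  have -> : s.+1%:R * al + ph - al / 2 = (s%:R * al + ph) + al / 2.
    by rewrite -natr1; field.
  by rewrite sinD sinB; ring.
rewrite -(big_mkord xpredT (fun s => F s.+1 - F s)) telescope_sumr// /F Nal.
have -> : 2 * pi * z%:~R + ph - al / 2 = (ph - al / 2) + 2 * pi * z%:~R by ring.
by rewrite sin_intD mul0r add0r subrr.
Qed.

(** A trigonometric polynomial on frequencies that lie on a grid of step
  [2 pi / N] and within one period has square mean at most the sum of its
  squared weights over any [N] consecutive points: bounding the square of a
  cosine sum by the squared modulus of the exponential sum leaves only the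
  differences of the frequencies, whose exponentials are orthogonal. *)
Lemma parseval_le (R : realType) (n N : nat) (k lam : 'I_n -> R) (x th : R) :
  (n <= N)%N ->
  (forall i j : 'I_n, lam i - lam j = 2 * pi * (i%:R - j%:R) / N%:R) ->
  \sum_(s < N) (\sum_i k i * cos ((s%:R + x) * lam i + th)) ^+ 2 <=
  N%:R * \sum_i k i ^+ 2.
Proof.
case: N => [|N'] nN Hlam.
  by rewrite big_ord0 mul0r.
set N := N'.+1 in nN Hlam *.
pose c (s : 'I_N) i := cos ((s%:R + x) * lam i + th).
pose d (s : 'I_N) i := sin ((s%:R + x) * lam i + th).
apply: (@le_trans _ _ (\sum_(s < N) \sum_i \sum_j k i * k j *
    cos (s%:R * (lam i - lam j) + x * (lam i - lam j)))).
  apply: ler_sum => s _.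
  apply: (@le_trans _ _ ((\sum_i k i * c s i)^+2 + (\sum_i k i * d s i)^+2)).
    by rewrite lerDl sqr_ge0.
  rewrite !expr2 !mulr_suml -big_split/= le_eqVlt; apply/orP; left; apply/eqP.
  apply: eq_bigr => i _; rewrite !mulr_sumr -big_split/=; apply: eq_bigr => j _.
  rewrite /c /d.
  have -> : s%:R * (lam i - lam j) + x * (lam i - lam j) =
     ((s%:R + x) * lam i + th) - ((s%:R + x) * lam j + th) by ring.
  by rewrite cosB; ring.
rewrite exchange_big/= mulr_sumr; apply: ler_sum => i _.
rewrite exchange_big/= (bigD1 i)//= [X in _ + X]big1 ?addr0 => [|j ji].
  under eq_bigr do rewrite subrr !mulr0 addr0 cos0 mulr1.
  by rewrite sum_ord_cst expr2.
rewrite -mulr_sumr (@sum_cos_eq0 _ _ _ _ (i%:Z - j%:Z)) ?mulr0 //.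
  have Hp := pi_gt0 R; have ij : (0 : R) < `|i%:R - j%:R|.
    by rewrite normr_gt0 subr_eq0 eqr_nat eq_sym.
  rewrite Hlam !normrM [`|pi|]gtr0_norm// [`|2|]gtr0_norm//.
  rewrite [`|_^-1|]gtr0_norm ?invr_gt0 ?ltr0n//.
  rewrite divr_gt0 ?mulr_gt0 ?ltr0n//=.
  rewrite ltr_pdivrMr ?ltr0n// ltr_pM2l ?mulr_gt0//.
  have : `|i%:Z - j%:Z| < N%:Z by have := ltn_ord i; have := ltn_ord j; lia.
  by rewrite -(ltr_int R) intr_norm intrB.
by rewrite Hlam intrB; field; rewrite pnatr_eq0.
Qed.

(** * Expectation operators *)

(** The square-integrable calculus below is used both for a probability
  measure and for a weighted finite set, where no integrability has to be
  checked; [mf] and [lf] stand for the measurable and the integrable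
  functions. *)
Record expectation_op (R : realType) (T : Type) := ExpectationOp {
  mf : set (T -> R);
  lf : set (T -> R);
  ex : (T -> R) -> R;
  mf_cst : forall c, mf (fun=> c);
  mfD : forall f g, mf f -> mf g -> mf (fun w => f w + g w);
  mfM : forall f g, mf f -> mf g -> mf (fun w => f w * g w);
  lf_mf : forall f, lf f -> mf f;
  lf_cst : forall c, lf (fun=> c);
  lfD : forall f g, lf f -> lf g -> lf (fun w => f w + g w);
  lfZ : forall c f, lf f -> lf (fun w => c * f w);
  lf_norm : forall f, lf f -> lf (fun w => `|f w|);
  lf_dom : forall f g, mf f -> lf g -> (forall w, `|f w| <= g w) -> lf f;
  ex1 : ex (fun=> 1) = 1;
  exD : forall f g, lf f -> lf g -> ex (fun w => f w + g w) = ex f + ex g;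
  exZ : forall c f, lf f -> ex (fun w => c * f w) = c * ex f;
  ex_ge0 : forall f, lf f -> (forall w, 0 <= f w) -> 0 <= ex f }.

Arguments ex : simpl never.

Section expectation_op_theory.
Context {R : realType} {T : Type} (E : expectation_op R T).
Implicit Types (f g : T -> R) (c : R).

Definition sq : set (T -> R) := fun f => mf E f /\ lf E (fun w => f w ^+ 2).

Definition nrm f : R := Num.sqrt (ex E (fun w => f w ^+ 2)).

Lemma ex_ext f g : f =1 g -> ex E f = ex E g.
Proof. by move=> fg; rewrite (funext fg). Qed.

Lemma lf_ext f g : lf E f -> f =1 g -> lf E g.
Proof. by move=> lff fg; rewrite -(funext fg). Qed.

Lemma sq_ext f g : sq f -> f =1 g -> sq g.
Proof. by move=> lff fg; rewrite -(funext fg). Qed.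

Lemma ex_cst c : ex E (fun=> c) = c.
Proof.
rewrite -[RHS]mulr1 -(ex1 E) -exZ; last exact: lf_cst.
by apply: ex_ext => w; rewrite mulr1.
Qed.

Lemma lfN f : lf E f -> lf E (fun w => - f w).
Proof. by move=> /(lfZ (-1)) h; apply: lf_ext h _ => w; rewrite mulN1r. Qed.

Lemma lfB f g : lf E f -> lf E g -> lf E (fun w => f w - g w).
Proof. by move=> ? ?; apply: (@lfD _ _ E f (fun w => - g w)) => //; exact: lfN. Qed.

Lemma exN f : lf E f -> ex E (fun w => - f w) = - ex E f.
Proof.
by move=> lff; rewrite -mulN1r -exZ//; apply: ex_ext => w; rewrite mulN1r.
Qed.

Lemma exB f g : lf E f -> lf E g -> ex E (fun w => f w - g w) = ex E f - ex E g.
Proof. by move=> ? ?; rewrite (@exD _ _ E f (fun w => - g w))// ?exN//; exact: lfN. Qed.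

Lemma lf_sum (I : Type) (r : seq I) (p : pred I) (F : I -> T -> R) :
  (forall i, p i -> lf E (F i)) -> lf E (fun w => \sum_(i <- r | p i) F i w).
Proof.
move=> lF; elim: r => [|i r IH].
  by apply: lf_ext (lf_cst E 0) _ => w; rewrite big_nil.
case pi : (p i).
  by apply: lf_ext (lfD (lF i pi) IH) _ => w; rewrite big_cons pi.
by apply: lf_ext IH _ => w; rewrite big_cons pi.
Qed.

Lemma ex_sum (I : Type) (r : seq I) (p : pred I) (F : I -> T -> R) :
  (forall i, p i -> lf E (F i)) ->
  ex E (fun w => \sum_(i <- r | p i) F i w) = \sum_(i <- r | p i) ex E (F i).
Proof.
move=> lF; elim: r => [|i r IH].
  by rewrite big_nil -[RHS](ex_cst 0); apply: ex_ext => w; rewrite big_nil.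
rewrite big_cons; case pi : (p i); last first.
  by rewrite -IH; apply: ex_ext => w; rewrite big_cons pi.
rewrite -IH -exD; first by apply: ex_ext => w; rewrite big_cons pi.
- exact: lF.
- exact: lf_sum.
Qed.

Lemma ex_le f g : lf E f -> lf E g -> (forall w, f w <= g w) -> ex E f <= ex E g.
Proof.
move=> lff lfg fg; rewrite -subr_ge0 -exB//.
by apply: ex_ge0 => [|w]; [exact: lfB|rewrite subr_ge0].
Qed.

Lemma ler_norm_ex f : lf E f -> `|ex E f| <= ex E (fun w => `|f w|).
Proof.
move=> lff; have lfn := lf_norm lff; rewrite ler_norml.
apply/andP; split.
  rewrite lerNl -exN//; apply: ex_le => // [|w]; first exact: lfN.
  by rewrite -normrN ler_norm.
by apply: ex_le => // w; rewrite ler_norm.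
Qed.

Lemma mfZ c f : mf E f -> mf E (fun w => c * f w).
Proof. by move=> ?; apply: mfM => //; exact: mf_cst. Qed.

Lemma lfM_sq f g : sq f -> sq g -> lf E (fun w => f w * g w).
Proof.
move=> [mff lff] [mfg lfg]; apply: (lf_dom (mfM mff mfg) (lfD lff lfg)) => w.
rewrite normrM -[f w ^+ 2]real_normK ?num_real// -[g w ^+ 2]real_normK ?num_real//.
by have := sqr_ge0 (`|f w| - `|g w|); have := sqr_ge0 (`|f w| + `|g w|); nra.
Qed.

Lemma sq_cst c : sq (fun=> c).
Proof. by split; [exact: mf_cst|exact: lf_cst]. Qed.

Lemma sq_lf f : sq f -> lf E f.
Proof.
by move=> sf; apply: lf_ext (lfM_sq (sq_cst 1) sf) _ => w; rewrite mul1r.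
Qed.

Lemma sqD f g : sq f -> sq g -> sq (fun w => f w + g w).
Proof.
move=> sf sg; split; first by apply: mfD; [case: sf|case: sg].
have [[_ ff] [_ gg]] := (sf, sg).
apply: lf_ext (lfD (lfD ff gg) (lfZ 2 (lfM_sq sf sg))) _ => w.
by ring.
Qed.

Lemma sqZ c f : sq f -> sq (fun w => c * f w).
Proof.
move=> sf; split; first by apply: mfZ; case: sf.
by case: sf => _ /(lfZ (c ^+ 2)) h; apply: lf_ext h _ => w; rewrite exprMn.
Qed.

Lemma sqN f : sq f -> sq (fun w => - f w).
Proof. by move=> /(sqZ (-1)) h; apply: sq_ext h _ => w; rewrite mulN1r. Qed.

Lemma sqB f g : sq f -> sq g -> sq (fun w => f w - g w).
Proof. by move=> ? /sqN?; exact: sqD. Qed.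

Lemma sq_sum (I : Type) (r : seq I) (p : pred I) (F : I -> T -> R) :
  (forall i, p i -> sq (F i)) -> sq (fun w => \sum_(i <- r | p i) F i w).
Proof.
move=> lF; elim: r => [|i r IH].
  by apply: sq_ext (sq_cst 0) _ => w; rewrite big_nil.
case pi : (p i).
  by apply: sq_ext (sqD (lF i pi) IH) _ => w; rewrite big_cons pi.
by apply: sq_ext IH _ => w; rewrite big_cons pi.
Qed.

Lemma ex_sqr_ge0 f : sq f -> 0 <= ex E (fun w => f w ^+ 2).
Proof. by move=> [_ ?]; apply: ex_ge0 => // w; exact: sqr_ge0. Qed.

Lemma nrm_ge0 f : 0 <= nrm f.
Proof. exact: sqrtr_ge0. Qed.

Lemma sqr_nrm f : sq f -> nrm f ^+ 2 = ex E (fun w => f w ^+ 2).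
Proof. by move=> sf; rewrite sqr_sqrtr// ex_sqr_ge0. Qed.

Lemma nrm_le f (B : R) : 0 <= B -> sq f ->
  ex E (fun w => f w ^+ 2) <= B ^+ 2 -> nrm f <= B.
Proof.
by move=> B0 sf; rewrite -sqr_nrm// ler_pXn2r// nnegrE// nrm_ge0.
Qed.

Lemma nrm_mono f g : sq f -> sq g -> (forall w, `|f w| <= `|g w|) -> nrm f <= nrm g.
Proof.
move=> sf sg fg; apply: ler_wsqrtr; apply: ex_le; [by case: sf|by case: sg|] => w.
by rewrite -[_ ^+ 2]real_normK ?num_real// -[leRHS]real_normK ?num_real// ler_pXn2r.
Qed.

(** From [2 |(a f) (b g)| <= (a f)^2 + (b g)^2] at [a = nrm g], [b = nrm f];
  when one norm vanishes, its factor is taken large instead. *)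
Lemma cauchy_schwarz_abs f g : sq f -> sq g ->
  ex E (fun w => `|f w * g w|) <= nrm f * nrm g.
Proof.
move=> sf sg; have lfg := lf_norm (lfM_sq sf sg).
have [[mff ff] [mfg gg]] := (sf, sg).
set p := ex E _; have p0 : 0 <= p by apply: ex_ge0 => // w; exact: normr_ge0.
have H (a b : R) : 2 * (a * b) * p <= a ^+ 2 * nrm f ^+ 2 + b ^+ 2 * nrm g ^+ 2.
  rewrite !sqr_nrm// -!exZ// -exD; [|exact: lfZ..].
  apply: ex_le => [||w]; [exact: lfZ|by apply: lfD; exact: lfZ|].
  rewrite normrM -[f w ^+ 2]real_normK ?num_real// -[g w ^+ 2]real_normK ?num_real//.
  by have := sqr_ge0 (a * `|f w| - b * `|g w|); nra.
have [f0 g0] := (nrm_ge0 f, nrm_ge0 g).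
have [fz|fnz] := eqVneq (nrm f) 0.
  rewrite fz mul0r leNgt; apply/negP => pp.
  have := H ((nrm g ^+ 2 + 1) / p) 1; rewrite fz => {}H.
  have : 2 * (nrm g ^+ 2 + 1) <= nrm g ^+ 2.
    suff -> : 2 * (nrm g ^+ 2 + 1) = 2 * ((nrm g ^+ 2 + 1) / p * 1) * p.
      by apply: le_trans H _; nra.
    by field; rewrite gt_eqF.
  by nra.
have [gz|gnz] := eqVneq (nrm g) 0.
  rewrite gz mulr0 leNgt; apply/negP => pp.
  have := H 1 ((nrm f ^+ 2 + 1) / p); rewrite gz => {}H.
  have : 2 * (nrm f ^+ 2 + 1) <= nrm f ^+ 2.
    suff -> : 2 * (nrm f ^+ 2 + 1) = 2 * (1 * ((nrm f ^+ 2 + 1) / p)) * p.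
      by apply: le_trans H _; nra.
    by field; rewrite gt_eqF.
  by nra.
have fg0 : 0 < nrm f * nrm g by rewrite mulr_gt0// lt_def ?fnz ?gnz.
have := H (nrm g) (nrm f); nra.
Qed.

Lemma cauchy_schwarz f g : sq f -> sq g ->
  `|ex E (fun w => f w * g w)| <= nrm f * nrm g.
Proof.
move=> sf sg; apply: le_trans (cauchy_schwarz_abs sf sg).
by apply: ler_norm_ex; exact: lfM_sq.
Qed.

Lemma ex_abs_le f : sq f -> ex E (fun w => `|f w|) <= nrm f.
Proof.
move=> sf; have := cauchy_schwarz_abs sf (sq_cst 1).
have -> : nrm (fun=> 1) = 1.
  by rewrite /nrm; under ex_ext do rewrite expr1n; rewrite ex1 sqrtr1.
by rewrite mulr1; under ex_ext do rewrite mulr1.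
Qed.

End expectation_op_theory.

(** * Quadratic forms of two processes *)

(** Kernel with weights [k], frequencies [lam] and phase [th]: the phases [0]
  and [pi / 2] give the real and the imaginary part of the smoothed
  cross-periodogram. *)
Definition kern (R : realType) (n : nat) (k lam : 'I_n -> R) (th z : R) : R :=
  \sum_i k i * cos (z * lam i + th).

Definition qform (R : realType) (T : Type) (N : nat) (ka : R -> R)
    (x y : nat -> T -> R) (w : T) : R :=
  N%:R^-1 * \sum_(s < N) \sum_(t < N) ka (s%:R - t%:R) * (x s w * y t w).

(** Coefficients bounded by [1] cover at once the cosines and sines of every
  frequency, so that [v] bounds the mean periodogram uniformly, up to a factor. *)
Definition energy_le (R : realType) (T : Type) (E : expectation_op R T)
    (N : nat) (x : nat -> T -> R) (v : R) : Prop :=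
  forall c : nat -> R, (forall s, `|c s| <= 1) ->
    ex E (fun w => (\sum_(s < N) c s * x s w) ^+ 2) <= N%:R * v.

Lemma kern_le1 (R : realType) (n : nat) (k lam : 'I_n -> R) (th z : R) :
  (forall i, 0 <= k i) -> \sum_i k i = 1 -> `|kern k lam th z| <= 1.
Proof.
move=> k0 k1; apply: le_trans (ler_norm_sum _ _ _) _.
rewrite -k1; apply: ler_sum => i _; rewrite normrM (ger0_norm (k0 i)).
by rewrite ler_piMr// cos_max.
Qed.

Lemma sum_dist_le (R : realType) (N s : nat) (b : nat -> R) (S : R) :
  (s < N)%N -> (forall n, 0 <= b n) -> \sum_(n < N) b n <= S ->
  \sum_(t < N) b (maxn s t - minn s t)%N <= 2 * S.
Proof.
move=> sN b0 bS.
have mono (n : nat) : (n <= N)%N -> \sum_(i < n) b i <= S.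
  move=> nN; apply: le_trans bS.
  rewrite -!(big_mkord xpredT b) [leRHS](@big_cat_nat _ _ _ n)//= lerDl.
  by rewrite sumr_ge0.
rewrite -(big_mkord xpredT (fun t => b (maxn s t - minn s t)%N)).
rewrite (@big_cat_nat _ _ _ s)//=; last exact: ltnW.
have -> : 2 * S = S + S by ring.
apply: lerD.
  rewrite big_nat_rev/= big_mkord; apply: le_trans (mono s.+1 sN).
  rewrite big_ord_recl/= -[leLHS]add0r; apply: lerD => //.
  rewrite le_eqVlt; apply/orP; left; apply/eqP; apply: eq_bigr => i _.
  by congr b; have := ltn_ord i; rewrite /bump/=; lia.
rewrite -{1}[s]add0n big_addn big_mkord.
apply: le_trans (mono (N - s)%N (leq_subr _ _)).
rewrite le_eqVlt; apply/orP; left; apply/eqP; apply: eq_bigr => i _.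
by congr b; lia.
Qed.

(** Covariances with a summable decay [b] give a finite energy: each row of the
  Gram matrix has sum at most [2 * M * S]. *)
Lemma energy_gram (R : realType) (T : Type) (E : expectation_op R T) (N : nat)
    (x : nat -> T -> R) (M S : R) (b : nat -> R) :
  (forall s, sq E (x s)) -> 0 <= M -> (forall n, 0 <= b n) ->
  \sum_(n < N) b n <= S ->
  (forall s t, (s <= t < N)%N ->
    `|ex E (fun w => x t w * x s w)| <= M * b (t - s)%N) ->
  energy_le E N x (2 * M * S).
Proof.
move=> sx M0 b0 bS Hx c c1.
have Hx2 s t : (s < N)%N -> (t < N)%N ->
    `|ex E (fun w => x s w * x t w)| <= M * b (maxn s t - minn s t)%N.
  move=> sN tN; have [st|ts] := leqP s t.
    by under ex_ext do rewrite mulrC; apply: Hx; rewrite st.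
  by apply: Hx; rewrite ltnW.
have lfx (s t : 'I_N) : lf E (fun w => c s * c t * (x s w * x t w)).
  by apply: lfZ; exact: lfM_sq.
apply: (@le_trans _ _ (\sum_(s < N) \sum_(t < N)
    `|c s * c t * ex E (fun w => x s w * x t w)|)).
  under ex_ext => w.
    rewrite expr2 mulr_suml; under eq_bigr => s _.
      rewrite mulr_sumr; under eq_bigr => t _.
        rewrite (_ : _ * _ = c s * c t * (x s w * x t w)); last by ring.
        over.
      over.
    over.
  rewrite ex_sum => [|s _]; last by apply: lf_sum => t _; exact: lfx.
  apply: ler_sum => s _; rewrite ex_sum => [|t _]; last exact: lfx.
  apply: ler_sum => t _; rewrite exZ ?ler_norm//; exact: lfM_sq.
rewrite -sum_ord_cst.
apply: ler_sum => s _.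
apply: (@le_trans _ _ (M * \sum_(t < N) b (maxn s t - minn s t)%N)).
  rewrite mulr_sumr; apply: ler_sum => t _.
  rewrite !normrM -[leRHS]mul1r; apply: ler_pM => //.
    by rewrite -[leRHS]mul1r; apply: ler_pM.
  exact: Hx2.
rewrite [2 * M]mulrC -mulrA; apply: ler_wpM2l => //.
exact: sum_dist_le.
Qed.

(** Splitting [cos ((s - t) lam + th)] makes the form a convex combination of
  products of two linear forms, so that only the sizes of such forms matter,
  whatever the frequencies. *)
Lemma qform_le (R : realType) (T : Type) (E : expectation_op R T) (N n : nat)
    (k lam : 'I_n -> R) (th : R) (x y : nat -> T -> R) (vx vy : R) :
  (0 < N)%N -> (forall i, 0 <= k i) -> \sum_i k i = 1 ->
  (forall s, sq E (x s)) -> (forall s, sq E (y s)) ->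
  0 <= vx -> 0 <= vy -> energy_le E N x vx -> energy_le E N y vy ->
  lf E (qform N (kern k lam th) x y) /\
  ex E (fun w => `|qform N (kern k lam th) x y w|) <=
    2 * (Num.sqrt vx * Num.sqrt vy).
Proof.
move=> N0 k0 k1 sx sy vx0 vy0 Ex Ey.
pose A (c : nat -> R) (z : nat -> T -> R) w := \sum_(s < N) c s * z s w.
have sA c z : (forall s, sq E (z s)) -> sq E (A c z).
  by move=> sz; apply: sq_sum => s _; exact: sqZ.
pose c1 i (s : nat) := cos (s%:R * lam i + th).
pose c2 i (s : nat) := sin (s%:R * lam i + th).
pose d1 i (s : nat) := cos (s%:R * lam i).
pose d2 i (s : nat) := sin (s%:R * lam i).
pose B i w := A (c1 i) x w * A (d1 i) y w + A (c2 i) x w * A (d2 i) y w.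
have lB i : lf E (B i) by apply: lfD; apply: lfM_sq; exact: sA.
have qE : qform N (kern k lam th) x y =1
    fun w => N%:R^-1 * \sum_i k i * B i w.
  move=> w; rewrite /qform; congr (_ * _).
  under eq_bigr => s _ do under eq_bigr => t _ do rewrite /kern mulr_suml.
  under eq_bigr => s _ do rewrite exchange_big/=.
  rewrite exchange_big/=; apply: eq_bigr => i _.
  rewrite /B /A !mulr_suml -big_split/= mulr_sumr; apply: eq_bigr => s _.
  rewrite !mulr_sumr -big_split/= mulr_sumr; apply: eq_bigr => t _.
  rewrite /c1 /c2 /d1 /d2.
  have -> : (s%:R - t%:R) * lam i + th = (s%:R * lam i + th) - t%:R * lam i by ring.
  by rewrite cosB; ring.
have lS : lf E (fun w => \sum_i k i * B i w) by apply: lf_sum => i _; exact: lfZ.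
split; first by apply: lf_ext (lfZ N%:R^-1 lS) _ => w; rewrite qE.
have nA c z v : (forall s, sq E (z s)) -> 0 <= v -> energy_le E N z v ->
    (forall s, `|c s| <= 1) -> nrm E (A c z) <= Num.sqrt (N%:R * v).
  by move=> sz v0 Ez c1'; apply: ler_wsqrtr; exact: Ez.
have HB i : ex E (fun w => `|B i w|) <= N%:R * (2 * (Num.sqrt vx * Num.sqrt vy)).
  have lB1 : lf E (fun w => A (c1 i) x w * A (d1 i) y w) by apply: lfM_sq; exact: sA.
  have lB2 : lf E (fun w => A (c2 i) x w * A (d2 i) y w) by apply: lfM_sq; exact: sA.
  apply: (@le_trans _ _ (ex E (fun w => `|A (c1 i) x w * A (d1 i) y w|
      + `|A (c2 i) x w * A (d2 i) y w|))).
    apply: ex_le => [||w]; [exact: lf_norm|by apply: lfD; exact: lf_norm|].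
    exact: ler_normD.
  rewrite exD; [|exact: lf_norm..].
  have -> : N%:R * (2 * (Num.sqrt vx * Num.sqrt vy)) =
     Num.sqrt (N%:R * vx) * Num.sqrt (N%:R * vy) +
     Num.sqrt (N%:R * vx) * Num.sqrt (N%:R * vy) :> R.
    rewrite !sqrtrM ?ler0n//.
    have : Num.sqrt N%:R ^+ 2 = N%:R :> R by rewrite sqr_sqrtr ?ler0n.
    by move: (Num.sqrt N%:R) => u <-; ring.
  apply: lerD; (apply: le_trans (cauchy_schwarz_abs _ _) _; [exact: sA|exact: sA|]).
    by apply: ler_pM; rewrite ?nrm_ge0//; apply: nA => // s; exact: cos_max.
  by apply: ler_pM; rewrite ?nrm_ge0//; apply: nA => // s; exact: sin_max.
have N0' : 0 < N%:R :> R by rewrite ltr0n.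
have -> : ex E (fun w => `|qform N (kern k lam th) x y w|) =
    N%:R^-1 * ex E (fun w => `|\sum_i k i * B i w|).
  rewrite -exZ; last exact: lf_norm.
  apply: ex_ext => w; rewrite qE normrM ger0_norm// invr_ge0 ler0n.
rewrite mulrC ler_pdivrMr// [leRHS]mulrC.
apply: (@le_trans _ _ (ex E (fun w => \sum_i k i * `|B i w|))).
  apply: ex_le => [||w]; [exact: lf_norm|by apply: lf_sum => i _; apply: lfZ; exact: lf_norm|].
  apply: le_trans (ler_norm_sum _ _ _) _.
  by apply: ler_sum => i _; rewrite normrM (ger0_norm (k0 i)).
rewrite ex_sum => [|i _]; last by apply: lfZ; exact: lf_norm.
rewrite -[leRHS]mul1r.
set V := (X in _ <= _ * X).
rewrite -k1 mulr_suml; apply: ler_sum => i _.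
rewrite exZ; last exact: lf_norm.
apply: ler_wpM2l => //; exact: HB.
Qed.

Definition mask (R : realType) (A : R -> bool) (ka : R -> R) (z : R) : R :=
  if A z then ka z else 0.

Lemma qformE (R : realType) (T : Type) (N : nat) (ka : R -> R)
    (x y : nat -> T -> R) (w : T) :
  qform N ka x y w =
  N%:R^-1 * \sum_(s < N) x s w * \sum_(t < N) ka (s%:R - t%:R) * y t w.
Proof.
rewrite /qform; congr (_ * _); apply: eq_bigr => s _; rewrite mulr_sumr.
by apply: eq_bigr => t _; rewrite mulrCA.
Qed.

Lemma qform_lf (R : realType) (T : Type) (E : expectation_op R T) (N : nat)
    (ka : R -> R) (x y : nat -> T -> R) :
  (forall s, sq E (x s)) -> (forall s, sq E (y s)) -> lf E (qform N ka x y).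
Proof.
move=> sx sy; apply: lfZ; apply: lf_sum => s _; apply: lf_sum => t _.
by apply: lfZ; exact: lfM_sq.
Qed.

Lemma dist_natE (R : realType) (s t : nat) :
  `|s%:R - t%:R| = (maxn s t - minn s t)%N%:R :> R.
Proof.
by have [st|ts] := leqP s t; [rewrite distrC|]; rewrite -natrB ?normr_nat// ltnW.
Qed.

(** Each row of the form has at most [2 * r] lags below [r]. *)
Lemma qform_near_le (R : realType) (T : Type) (E : expectation_op R T) (N r : nat)
    (ka : R -> R) (x y : nat -> T -> R) (Bx By : R) :
  (0 < N)%N -> (forall z, `|ka z| <= 1) ->
  (forall s, sq E (x s)) -> (forall s, sq E (y s)) ->
  (forall s, (s < N)%N -> nrm E (x s) <= Bx) ->
  (forall s, (s < N)%N -> nrm E (y s) <= By) ->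
  ex E (fun w => `|qform N (mask (fun z => `|z| < r%:R) ka) x y w|) <=
    2 * r%:R * (Bx * By).
Proof.
move=> N0 ka1 sx sy xB yB.
have Bx0 : 0 <= Bx := le_trans (nrm_ge0 _ _) (xB 0%N N0).
have By0 : 0 <= By := le_trans (nrm_ge0 _ _) (yB 0%N N0).
have N0' : 0 < N%:R :> R by rewrite ltr0n.
pose b (n : nat) : R := (n < r)%N%:R.
have lxy s t : lf E (fun w => `|x s w * y t w|) by apply: lf_norm; exact: lfM_sq.
apply: (@le_trans _ _ (ex E (fun w => N%:R^-1 * \sum_(s < N) \sum_(t < N)
    b (maxn s t - minn s t)%N * `|x s w * y t w|))).
  apply: ex_le => [||w].
  - by apply: lf_norm; exact: qform_lf.
  - apply: lfZ; apply: lf_sum => s _; apply: lf_sum => t _; exact: lfZ.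
  rewrite /qform normrM ger0_norm ?invr_ge0 ?ler0n//.
  apply: ler_wpM2l; first by rewrite invr_ge0 ler0n.
  apply: le_trans (ler_norm_sum _ _ _) _; apply: ler_sum => s _.
  apply: le_trans (ler_norm_sum _ _ _) _; apply: ler_sum => t _.
  rewrite normrM; apply: ler_wpM2r => //; rewrite /mask dist_natE ltr_nat /b.
  by case: ltnP => _ //=; rewrite normr0.
rewrite exZ; last by apply: lf_sum => s _; apply: lf_sum => t _; exact: lfZ.
rewrite mulrC ler_pdivrMr// ex_sum => [|s _]; last by apply: lf_sum => t _; exact: lfZ.
rewrite [leRHS]mulrC -(sum_ord_cst N).
apply: ler_sum => s _.
rewrite ex_sum => [|t _]; last exact: lfZ.
apply: (@le_trans _ _ (\sum_(t < N) b (maxn s t - minn s t)%N * (Bx * By))).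
  apply: ler_sum => t _; rewrite exZ//; apply: ler_wpM2l; first exact: ler0n.
  apply: le_trans (cauchy_schwarz_abs (sx s) (sy t)) _.
  by apply: ler_pM; rewrite ?nrm_ge0//; [exact: xB|exact: yB].
rewrite -mulr_suml; apply: ler_wpM2r; first exact: mulr_ge0.
apply: sum_dist_le => //.
by rewrite /b -natr_sum ler_nat sum_ord_ltn geq_minl.
Qed.

(** * Martingale approximation on a finite probability space *)

Section finite_expectation.
Context {R : realType} {F : finType} (p : F -> R).
Hypotheses (p0 : forall v, 0 <= p v) (p1 : \sum_v p v = 1).

Let fex (f : F -> R) : R := \sum_v p v * f v.

Let fex1 : fex (fun=> 1) = 1.
Proof. by rewrite /fex; under eq_bigr do rewrite mulr1. Qed.

Let fexD f g : setT f -> setT g -> fex (fun w => f w + g w) = fex f + fex g.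
Proof. by move=> _ _; rewrite /fex -big_split; apply: eq_bigr => v _; rewrite mulrDr. Qed.

Let fexZ c f : setT f -> fex (fun w => c * f w) = c * fex f.
Proof. by move=> _; rewrite /fex mulr_sumr; apply: eq_bigr => v _; rewrite mulrCA. Qed.

Let fex_ge0 f : setT f -> (forall w, 0 <= f w) -> 0 <= fex f.
Proof. by move=> _ f0; apply: sumr_ge0 => v _; exact: mulr_ge0. Qed.

Definition fin_op : expectation_op R F :=
  @ExpectationOp R F setT setT fex (fun=> I) (fun _ _ _ _ => I)
    (fun _ _ _ _ => I) (fun _ _ => I) (fun=> I) (fun _ _ _ _ => I)
    (fun _ _ _ => I) (fun _ _ => I) (fun _ _ _ _ _ => I) fex1 fexD fexZ fex_ge0.

Lemma fin_opE f : ex fin_op f = \sum_v p v * f v. Proof. by []. Qed.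

Lemma fin_sq f : sq fin_op f. Proof. by []. Qed.

End finite_expectation.
Arguments fin_sq {R F p p0 p1} f.

(** [x] and [y] below are processes on a probability space of paths of length
  [N]; a function is in the past of level [l] if it depends on the first [l]
  coordinates only. *)
Section martingale_approximation.
Context {R : realType} {V : finType} (N : nat).
Local Notation F := {ffun 'I_N -> V}.
Variable p : F -> R.
Hypotheses (p0 : forall v, 0 <= p v) (p1 : \sum_v p v = 1).
Local Notation E := (fin_op p0 p1).
Implicit Types (f g : F -> R) (x y : nat -> F -> R).

Definition agree (l : nat) (u v : F) : bool :=
  [forall s : 'I_N, (s < l)%N ==> (u s == v s)].

Definition dep (l : nat) f : Prop := forall u v, agree l u v -> f u = f v.

(** The conditional expectation given the first [l] coordinates; the division
  by zero on null atoms gives the value [0] there. *)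
Definition cex (l : nat) f (v : F) : R :=
  (\sum_(u | agree l u v) p u * f u) / (\sum_(u | agree l u v) p u).

Lemma agree_refl l u : agree l u u.
Proof. by apply/forallP => s; rewrite eqxx implybT. Qed.

Lemma agree_sym l u v : agree l u v = agree l v u.
Proof. by apply: eq_forallb => s; rewrite eq_sym. Qed.

Lemma agree_trans l u v t : agree l u v -> agree l v t -> agree l u t.
Proof.
move=> /forallP uv /forallP vt; apply/forallP => s; apply/implyP => sl.
by rewrite (eqP (implyP (uv s) sl)); exact: implyP (vt s) sl.
Qed.

Lemma agree_eq l u v t : agree l u v -> agree l t u = agree l t v.
Proof.
move=> uv; apply/idP/idP => h; first exact: agree_trans h uv.
by apply: agree_trans h _; rewrite agree_sym.
Qed.

Lemma dep_le l l' f : (l <= l')%N -> dep l f -> dep l' f.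
Proof.
move=> ll' df u v /forallP uv; apply: df; apply/forallP => s; apply/implyP => sl.
by apply: implyP (uv s) _; exact: leq_trans sl ll'.
Qed.

Lemma depM l f g : dep l f -> dep l g -> dep l (fun v => f v * g v).
Proof. by move=> df dg u v uv; rewrite (df _ _ uv) (dg _ _ uv). Qed.

Lemma depB l f g : dep l f -> dep l g -> dep l (fun v => f v - g v).
Proof. by move=> df dg u v uv; rewrite (df _ _ uv) (dg _ _ uv). Qed.

Lemma depZ l c f : dep l f -> dep l (fun v => c * f v).
Proof. by move=> df u v uv; rewrite (df _ _ uv). Qed.

Lemma dep_sum l (I : Type) (r : seq I) (q : pred I) (H : I -> F -> R) :
  (forall i, q i -> dep l (H i)) -> dep l (fun v => \sum_(i <- r | q i) H i v).
Proof. by move=> dH u v uv; apply: eq_bigr => i qi; exact: dH. Qed.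

Lemma dep_cex l f : dep l (cex l f).
Proof.
by move=> u v uv; rewrite /cex; congr (_ / _); apply: eq_bigl => t; exact: agree_eq.
Qed.

Lemma ex_cex l f g : dep l g ->
  ex E (fun v => cex l f v * g v) = ex E (fun v => f v * g v).
Proof.
move=> dg; rewrite !fin_opE; pose W v := \sum_(u | agree l u v) p u.
transitivity (\sum_v \sum_(u | agree l u v) p v * (p u * f u) / W v * g u).
  apply: eq_bigr => v _; rewrite /cex -/(W v) mulrA mulr_suml mulr_sumr mulr_suml.
  by apply: eq_bigr => u uv; rewrite (dg _ _ uv); ring.
rewrite (exchange_big_dep xpredT)//=; apply: eq_bigr => u _.
have WE v : agree l u v -> W v = W u.
  by move=> uv; apply: eq_bigl => t; rewrite (agree_eq _ uv).
transitivity (W u / W u * (p u * (f u * g u))).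
  transitivity (\sum_(v | agree l u v) p v * (p u * f u / W u * g u)).
    by apply: eq_bigr => v uv; rewrite WE//; ring.
  rewrite -mulr_suml (_ : \sum_(i | _) p i = W u); first by ring.
  by apply: eq_bigl => v; rewrite agree_sym.
have [Wu0|Wu0] := eqVneq (W u) 0; last by rewrite divff// mul1r.
suff -> : p u = 0 by rewrite !mul0r mulr0.
apply/eqP; rewrite eq_le p0 andbT -Wu0 /W (bigD1 u) ?agree_refl//= lerDl.
exact: sumr_ge0.
Qed.

Lemma cex_le l f (C : R) v : 0 <= C -> (forall u, `|f u| <= C) -> `|cex l f v| <= C.
Proof.
move=> C0 fC; rewrite /cex normrM normfV.
set W := \sum_(u | _) p u; have W0 : 0 <= W by exact: sumr_ge0.
rewrite (ger0_norm W0); have [->|Wn0] := eqVneq W 0; first by rewrite invr0 mulr0.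
rewrite ler_pdivrMr ?lt_def ?Wn0//; apply: le_trans (ler_norm_sum _ _ _) _.
rewrite mulr_sumr; apply: ler_sum => u _; rewrite normrM ger0_norm// mulrC.
exact: ler_wpM2r.
Qed.

(** Orthogonality of martingale differences: only the diagonal terms of the
  second moment survive, and the increments are bounded there. *)
Lemma mds_sum_le (C B : R) (l l' : nat -> nat) (D W : nat -> F -> R) :
  0 <= C ->
  (forall s v, `|D s v| <= C) -> (forall s, dep (l s) (W s)) ->
  (forall s, dep (l' s) (D s)) -> (forall s, (l s <= l' s)%N) ->
  (forall s t, (s < t)%N -> (l' s <= l t)%N) ->
  (forall s f, dep (l s) f -> ex E (fun v => D s v * f v) = 0) ->
  (forall s, (s < N)%N -> ex E (fun v => W s v ^+ 2) <= N%:R * B) ->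
  ex E (fun v => `|\sum_(s < N) D s v * W s v|) <= N%:R * (C * Num.sqrt B).
Proof.
move=> C0 DC dW dD ll' llt D0 WB.
have [N0|Npos] := posnP N.
  rewrite (_ : ex E _ = 0) ?N0 ?mul0r//.
  transitivity (ex E (fun=> 0)); last exact: ex_cst.
  apply: ex_ext => v; rewrite big1 ?normr0// => -[s sN].
  by exfalso; move: sN; rewrite N0.
have N0 : 0 < N%:R :> R by rewrite ltr0n.
have B0 : 0 <= B.
  by rewrite -(pmulr_rge0 _ N0); apply: le_trans (WB 0%N Npos); exact: ex_sqr_ge0.
apply: le_trans (ex_abs_le (fin_sq _)) _; apply: nrm_le => //.
  by rewrite !mulr_ge0 ?ler0n// sqrtr_ge0.
have ort (s t : nat) : s != t -> ex E (fun v => D s v * W s v * (D t v * W t v)) = 0.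
  wlog st : s t / (s < t)%N => [H|].
    case: (ltngtP s t) => // [st|ts] _; first by apply: H => //; rewrite ltn_eqF.
    have h : t != s by rewrite ltn_eqF.
    by rewrite -(H t s ts h); apply: ex_ext => v; rewrite mulrC.
  move=> _; rewrite -(D0 t (fun v => W t v * (D s v * W s v))).
    by apply: ex_ext => v; ring.
  by apply: depM => //; apply: dep_le (llt _ _ st) _; apply: depM => //; apply: dep_le (ll' s) _.
have -> : ex E (fun v => (\sum_(s < N) D s v * W s v) ^+ 2) =
    \sum_(s < N) ex E (fun v => D s v * W s v * (D s v * W s v)).
  under ex_ext do rewrite expr2 mulr_suml.
  rewrite ex_sum//; apply: eq_bigr => s _.
  under ex_ext do rewrite mulr_sumr.
  rewrite ex_sum// (bigD1 s)//= [X in _ + X]big1 ?addr0// => t ts.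
  by apply: ort; rewrite eq_sym.
have -> : (N%:R * (C * Num.sqrt B)) ^+ 2 = N%:R * (C ^+ 2 * (N%:R * B)).
  by rewrite !exprMn sqr_sqrtr//; ring.
rewrite -sum_ord_cst.
apply: ler_sum => s _.
apply: (@le_trans _ _ (C ^+ 2 * ex E (fun v => W s v ^+ 2))).
  rewrite -exZ//; apply: ex_le => // v.
  have -> : D s v * W s v * (D s v * W s v) = D s v ^+ 2 * W s v ^+ 2 by ring.
  apply: ler_wpM2r; first exact: sqr_ge0.
  rewrite -[D s v ^+ 2]real_normK ?num_real//.
  by rewrite ler_pXn2r ?nnegrE// DC.
by apply: ler_wpM2l; [exact: sqr_ge0|exact: WB].
Qed.

(** [x t] is projected on the past at distance [r] or more before [t]: the
  level [t.+1 - r] keeps the coordinates up to [t - r]. *)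
Definition predict (r : nat) x (t : nat) : F -> R := cex (t.+1 - r) (x t).

Section predict.
Variables (b : nat -> R) (x : nat -> F -> R).
Hypothesis b0 : forall n, 0 <= b n.
Hypothesis xb : forall t j f, (t < N)%N -> dep (t.+1 - j) f ->
  `|ex E (fun v => x t v * f v)| <= b j * nrm E f.

(** A projection is tested against itself, which is a function of the past. *)
Lemma predict_nrm r t : (t < N)%N -> nrm E (predict r x t) <= b r.
Proof.
move=> tN; have [n0|n0] := eqVneq (nrm E (predict r x t)) 0; first by rewrite n0.
have np : 0 < nrm E (predict r x t) by rewrite lt_def n0 nrm_ge0.
rewrite -(ler_pM2r np) -expr2 sqr_nrm//.
under ex_ext do rewrite expr2.
rewrite ex_cex; last exact: dep_cex.
by apply: le_trans (ler_norm _) _; apply: xb => //; exact: dep_cex.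
Qed.

Lemma nrm_process t : (t < N)%N -> dep t.+1 (x t) -> nrm E (x t) <= b 0%N.
Proof.
move=> tN dx; have [n0|n0] := eqVneq (nrm E (x t)) 0; first by rewrite n0.
have np : 0 < nrm E (x t) by rewrite lt_def n0 nrm_ge0.
rewrite -(ler_pM2r np) -expr2 sqr_nrm//.
under ex_ext do rewrite expr2.
by apply: le_trans (ler_norm _) _; apply: xb => //; rewrite subn0.
Qed.

(** Predictions inherit the decay of the covariances, with one factor replaced
  by the small norm of the prediction. *)
Lemma predict_energy r (S : R) : \sum_(n < N) b n <= S ->
  energy_le E N (predict r x) (2 * b r * S).
Proof.
move=> bS; apply: energy_gram bS _ => // s t /andP[st tN].
rewrite ex_cex; last first.
  apply: (@dep_le (s.+1 - r)); [lia|exact: dep_cex].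
apply: le_trans (xb (j := t - s) tN _) _.
  by apply: (dep_le _ (@dep_cex _ _)); lia.
by rewrite mulrC; apply: ler_wpM2r => //; apply: predict_nrm; exact: leq_ltn_trans tN.
Qed.

Lemma process_energy (S : R) : (forall t, dep t.+1 (x t)) ->
  \sum_(n < N) b n <= S -> energy_le E N x (2 * b 0%N * S).
Proof.
move=> dx bS; apply: energy_gram bS _ => // s t /andP[st tN].
apply: le_trans (xb (j := t - s) tN _) _.
  by apply: (dep_le _ (dx s)); lia.
rewrite mulrC; apply: ler_wpM2r => //; apply: nrm_process => //.
exact: leq_ltn_trans tN.
Qed.

End predict.

Definition innovation (r : nat) x t v := x t v - predict r x t v.

Lemma dep_predict r x t : dep t.+1 (predict r x t).
Proof. by apply: (dep_le _ (@dep_cex _ _)); rewrite leq_subr. Qed.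

Lemma dep_innovation r x t : dep t.+1 (x t) -> dep t.+1 (innovation r x t).
Proof. by move=> dx; apply: depB => //; exact: dep_predict. Qed.

Lemma ex_innovation r x t f : dep (t.+1 - r) f ->
  ex E (fun v => innovation r x t v * f v) = 0.
Proof.
move=> df; under ex_ext do rewrite /innovation mulrBl.
by rewrite exB// ex_cex// subrr.
Qed.

Lemma innovation_le r x t (C : R) v : 0 <= C -> (forall v, `|x t v| <= C) ->
  `|innovation r x t v| <= 2 * C.
Proof.
move=> C0 xC; apply: le_trans (ler_normB _ _) _.
have -> : 2 * C = C + C by ring.
by apply: lerD => //; exact: cex_le.
Qed.

(** An innovation with gap [r] is the sum of the [r] martingale differences
  obtained by forgetting one more coordinate at a time; each of them is
  orthogonal to a weight of the past of gap [r]. *)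
Lemma innovation_sum_le (r : nat) (C B : R) x (W : nat -> F -> R) :
  (0 < r)%N -> 0 <= C -> (forall t v, `|x t v| <= C) ->
  (forall t, dep t.+1 (x t)) -> (forall t, dep (t.+1 - r) (W t)) ->
  (forall s, (s < N)%N -> ex E (fun v => W s v ^+ 2) <= N%:R * B) ->
  ex E (fun v => `|\sum_(s < N) innovation r x s v * W s v|) <=
    r%:R * (N%:R * (2 * C * Num.sqrt B)).
Proof.
move=> r0 C0 xC dx dW WB.
pose lad s i := if i is 0%N then x s else cex (s.+1 - i) (x s).
pose D i s v := lad s i v - lad s i.+1 v.
have ladC s i v : `|lad s i v| <= C by case: i => [|i] /=; [exact: xC|exact: cex_le].
have dlad s i : dep (s.+1 - i) (lad s i).
  by case: i => [|i] /=; [rewrite subn0|exact: dep_cex].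
have elad s i l f : (l <= s.+1 - i)%N -> dep l f ->
    ex E (fun v => lad s i v * f v) = ex E (fun v => x s v * f v).
  by case: i => [|i] // ll df; rewrite /lad ex_cex//; apply: (dep_le ll df).
have HE s v : innovation r x s v = \sum_(i < r) D i s v.
  have -> : innovation r x s v = - (lad s r v - lad s 0%N v).
    by rewrite opprB /innovation /predict; case: r r0 {dW}.
  rewrite -(telescope_sumr (fun i => lad s i v)) ?leq0n// big_mkord -sumrN.
  by apply: eq_bigr => i _; rewrite opprB.
apply: (@le_trans _ _ (ex E (fun v => \sum_(i < r) `|\sum_(s < N) D i s v * W s v|))).
  apply: ex_le => // v; apply: le_trans (ler_norm_sum _ _ _).
  rewrite exchange_big/= le_eqVlt; apply/orP; left; apply/eqP; congr `|_|.
  by apply: eq_bigr => s _; rewrite HE mulr_suml.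
rewrite ex_sum// -sum_ord_cst.
apply: ler_sum => i _.
apply: (@mds_sum_le _ _ (fun s => s - i)%N (fun s => s.+1 - i)%N) => //.
- by rewrite mulr_ge0.
- move=> s v; apply: le_trans (ler_normB _ _) _.
  have -> : 2 * C = C + C by ring.
  exact: lerD.
- by move=> s; apply: (dep_le _ (dW s)); have := ltn_ord i; lia.
- move=> s; apply: depB => //; apply: (dep_le _ (dlad s i.+1)); lia.
- by move=> s; lia.
- by move=> s t; lia.
- move=> s f df; under ex_ext do rewrite mulrBl.
  by rewrite exB// (elad s i (s - i)%N)//; [rewrite (elad s i.+1 (s - i)%N)// ?subrr//; lia|lia].
Qed.

(** The factor of the innovation at time [s] is a linear form in earlier
  innovations, which are uncorrelated from lag [r] on, so that its second moment
  is a multiple of the sum of its squared coefficients; these are values of a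
  trigonometric polynomial, and Parseval bounds their sum. *)
Lemma lower_le (n r : nat) (k lam : 'I_n -> R) (th C : R) x y :
  (0 < r)%N -> (n <= N)%N ->
  (forall i j : 'I_n, lam i - lam j = 2 * pi * (i%:R - j%:R) / N%:R) ->
  0 <= C -> (forall t v, `|x t v| <= C) -> (forall t v, `|y t v| <= C) ->
  (forall t, dep t.+1 (x t)) -> (forall t, dep t.+1 (y t)) ->
  ex E (fun v => `|qform N (mask (fun z => r%:R <= z) (kern k lam th))
      (innovation r x) (innovation r y) v|) <=
    r%:R * (2 * C * Num.sqrt ((\sum_i k i ^+ 2) * (2 * (r%:R * (4 * C ^+ 2))))).
Proof.
move=> r0 nN Hlam C0 xC yC dx dy.
have [N0|Npos] := posnP N.
  rewrite (_ : ex E _ = 0).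
    by rewrite mulr_ge0// mulr_ge0 ?sqrtr_ge0// mulr_ge0.
  transitivity (ex E (fun=> 0)); last exact: ex_cst.
  apply: ex_ext => v; rewrite /qform big1 ?mulr0 ?normr0// => -[s sN].
  by exfalso; move: sN; rewrite N0.
have N0 : 0 < N%:R :> R by rewrite ltr0n.
set ka := mask _ _.
pose W s v := \sum_(t < N) ka (s%:R - t%:R) * innovation r y t v.
have dW s : dep (s.+1 - r) (W s).
  apply: dep_sum => t _; rewrite /ka /mask; case: ifPn => [|_].
    rewrite lerBrDl -natrD ler_nat => tr; apply: depZ.
    by apply: (dep_le _ (@dep_innovation r y t (dy t))); lia.
  by move=> u v _; rewrite !mul0r.
have WB s : (s < N)%N -> ex E (fun v => W s v ^+ 2) <=
    N%:R * ((\sum_i k i ^+ 2) * (2 * (r%:R * (4 * C ^+ 2)))).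
  move=> sN; pose a (t : nat) := ka (s%:R - t%:R).
  pose bb (m : nat) : R := (m < r)%N%:R * (4 * C ^+ 2).
  have C2 : 0 <= 4 * C ^+ 2 by rewrite mulr_ge0// sqr_ge0.
  have bb0 m : 0 <= bb m by rewrite mulr_ge0.
  have bbS : \sum_(m < N) bb m <= r%:R * (4 * C ^+ 2).
    by rewrite -mulr_suml; apply: ler_wpM2r => //; rewrite -natr_sum ler_nat sum_ord_ltn geq_minl.
  have G t u : `|ex E (fun v => innovation r y t v * innovation r y u v)| <=
      bb (maxn t u - minn t u)%N.
    wlog ut : t u / (u <= t)%N => [H|].
      case/orP: (leq_total u t) => tu; first exact: H.
      by rewrite maxnC minnC; under ex_ext do rewrite mulrC; apply: H; exact: tu.
    rewrite /bb (maxn_idPl ut) (minn_idPr ut); case: ltnP => tur.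
      rewrite mul1r; apply: le_trans (ler_norm_ex _) _ => //.
      rewrite -[leRHS](ex_cst E); apply: ex_le => // v; rewrite normrM.
      have -> : 4 * C ^+ 2 = (2 * C) * (2 * C) by ring.
      by apply: ler_pM => //; exact: innovation_le.
    rewrite mul0r ex_innovation ?normr0//.
    by apply: (dep_le _ (@dep_innovation r y u (dy u))); lia.
  apply: (@le_trans _ _ ((\sum_(t < N) a t ^+ 2) * (2 * (r%:R * (4 * C ^+ 2))))).
    under ex_ext do rewrite expr2 mulr_suml.
    rewrite ex_sum//.
    apply: (@le_trans _ _ (\sum_(t < N) \sum_(u < N)
       (1/2 * (a t ^+ 2 * bb (maxn t u - minn t u)%N)
       + 1/2 * (a u ^+ 2 * bb (maxn t u - minn t u)%N)))).
      apply: ler_sum => t _.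
      under ex_ext do rewrite mulr_sumr.
      rewrite ex_sum//; apply: ler_sum => u _.
      under ex_ext => v do rewrite mulrACA.
      rewrite exZ// -/(a t) -/(a u).
      have := G t u; set g := ex E _; set c := bb _ => gc.
      have : a t * a u * g <= `|a t| * `|a u| * c.
        apply: le_trans (ler_norm _) _; rewrite !normrM.
        by apply: ler_wpM2l => //; exact: mulr_ge0.
      have : 0 <= c by exact: bb0.
      rewrite -[a t ^+ 2]real_normK ?num_real// -[a u ^+ 2]real_normK ?num_real//.
      by have := sqr_ge0 (`|a t| - `|a u|); nra.
    have half : \sum_(t < N) \sum_(u < N) a t ^+ 2 * bb (maxn t u - minn t u)%N <=
       (\sum_(t < N) a t ^+ 2) * (2 * (r%:R * (4 * C ^+ 2))).
      rewrite mulr_suml; apply: ler_sum => t _; rewrite -mulr_sumr.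
      by apply: ler_wpM2l; [exact: sqr_ge0|exact: sum_dist_le].
    have scal (c : R) (f : 'I_N -> 'I_N -> R) :
        \sum_t \sum_u c * f t u = c * \sum_t \sum_u f t u.
      by rewrite mulr_sumr; apply: eq_bigr => t _; rewrite mulr_sumr.
    under eq_bigr do rewrite big_split/=.
    rewrite big_split/= !scal.
    have : \sum_(t < N) \sum_(u < N) a u ^+ 2 * bb (maxn t u - minn t u)%N <=
       (\sum_(t < N) a t ^+ 2) * (2 * (r%:R * (4 * C ^+ 2))).
      rewrite exchange_big/=; apply: le_trans half.
      by apply: ler_sum => t _; apply: ler_sum => u _; rewrite maxnC minnC.
    by move: half; lra.
  rewrite [leRHS]mulrA; apply: ler_wpM2r; first by rewrite !mulr_ge0.
  apply: (@le_trans _ _ (\sum_(t < N) (\sum_i k i * cos ((t%:R - s%:R) * lam i - th)) ^+ 2)).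
    apply: ler_sum => t _; rewrite /a /ka /mask; case: ifP => _; last first.
      by rewrite expr0n/= sqr_ge0.
    rewrite le_eqVlt; apply/orP; left; apply/eqP; congr (_ ^+ 2).
    by apply: eq_bigr => i _; rewrite -[in RHS]cosN; congr (_ * cos _); ring.
  exact: parseval_le.
under ex_ext do rewrite qformE normrM.
rewrite exZ// ger0_norm ?invr_ge0 ?ler0n// mulrC ler_pdivrMr//.
rewrite [leRHS](_ : _ = r%:R * (N%:R * (2 * C * Num.sqrt ((\sum_i k i ^+ 2) *
  (2 * (r%:R * (4 * C ^+ 2))))))); last by ring.
apply: (@innovation_sum_le r C _ x W) => //.
Qed.

Lemma qform_swap n (k lam : 'I_n -> R) (A : R -> bool) (th : R) x y v :
  qform N (mask A (kern k lam th)) x y v =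
  qform N (mask (fun z => A (- z)) (kern k lam (- th))) y x v.
Proof.
rewrite /qform exchange_big/=; congr (_ * _).
apply: eq_bigr => t _; apply: eq_bigr => s _.
rewrite /mask opprB; case: ifP => _; rewrite ?mul0r// [y t v * _]mulrC; congr (_ * _).
by apply: eq_bigr => i _; rewrite -[in RHS]cosN; congr (_ * cos _); ring.
Qed.

(** The off-diagonal part of the form is small: predictions with gap [r] have
  small energy, and what they leave is a martingale transform whose second
  moment Parseval bounds by the sum of squared weights. *)
Lemma far_le (n r : nat) (k lam : 'I_n -> R) (th C S : R) (b : nat -> R) x y :
  (0 < r)%N -> (n <= N)%N ->
  (forall i j : 'I_n, lam i - lam j = 2 * pi * (i%:R - j%:R) / N%:R) ->
  (forall i, 0 <= k i) -> \sum_i k i = 1 ->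
  0 <= C -> (forall t v, `|x t v| <= C) -> (forall t v, `|y t v| <= C) ->
  (forall t, dep t.+1 (x t)) -> (forall t, dep t.+1 (y t)) ->
  (forall m, 0 <= b m) -> \sum_(m < N) b m <= S -> b r <= b 0%N ->
  (forall t j f, (t < N)%N -> dep (t.+1 - j) f ->
    `|ex E (fun v => x t v * f v)| <= b j * nrm E f) ->
  (forall t j f, (t < N)%N -> dep (t.+1 - j) f ->
    `|ex E (fun v => y t v * f v)| <= b j * nrm E f) ->
  ex E (fun v => `|qform N (kern k lam th) x y v -
      qform N (mask (fun z => `|z| < r%:R) (kern k lam th)) x y v|) <=
  2 * (r%:R * (2 * C * Num.sqrt ((\sum_i k i ^+ 2) * (2 * (r%:R * (4 * C ^+ 2))))))
  + 3 * (4 * S * Num.sqrt (b 0%N * b r) + 2 * r%:R * (b 0%N * b r)).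
Proof.
move=> r0 nN Hlam k0 k1 C0 xC yC dx dy b0 bS br xb yb.
have Npos : (0 < N)%N.
  rewrite (leq_trans _ nN)// lt0n; apply/eqP => n0; move: k1.
  rewrite big1 ?(rwP eqP) 1?eq_sym ?oner_eq0//.
  by move=> -[i iN] _; exfalso; move: iN; rewrite n0.
set ka := kern k lam th.
have ka1 z : `|ka z| <= 1 by exact: kern_le1.
have S0 : 0 <= S by apply: le_trans bS; exact: sumr_ge0.
pose near := mask (fun z => `|z| < r%:R) ka.
pose far (u w : nat -> F -> R) v := qform N ka u w v - qform N near u w v.
pose low (z : R) := r%:R <= z.
pose Rx := predict r x; pose Ry := predict r y.
pose Ix := innovation r x; pose Iy := innovation r y.
have farE v : far x y v = far Ix Iy v + far Rx y v + far x Ry v - far Rx Ry v.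
  rewrite /far /qform -!mulrBr -!mulrDr -!mulrBr -?mulrDr; congr (_ * _).
  rewrite -!(sumrB, big_split)/= -?sumrB -?big_split/= -?sumrB; apply: eq_bigr => s _.
  rewrite -!(sumrB, big_split)/= -?sumrB -?big_split/= -?sumrB; apply: eq_bigr => t _.
  by rewrite /Ix /Iy /innovation -/(Rx s v) -/(Ry t v); ring.
pose main := r%:R * (2 * C * Num.sqrt ((\sum_i k i ^+ 2) * (2 * (r%:R * (4 * C ^+ 2))))).
pose sm := 4 * S * Num.sqrt (b 0%N * b r) + 2 * r%:R * (b 0%N * b r).
have H1 : ex E (fun v => `|far Ix Iy v|) <= 2 * main.
  apply: (@le_trans _ _ (ex E (fun v => `|qform N (mask low ka) Ix Iy v|
     + `|qform N (mask low (kern k lam (- th))) Iy Ix v|))).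
    apply: ex_le => // v; apply: le_trans (ler_normD _ _).
    rewrite le_eqVlt; apply/orP; left; apply/eqP; congr `|_|.
    have -> : qform N (mask low (kern k lam (- th))) Iy Ix v =
        qform N (mask (fun z => low (- z)) ka) Ix Iy v.
      by rewrite [RHS]qform_swap; congr (qform N (mask _ _) _ _ _); apply/funext => z; rewrite opprK.
    rewrite /far /qform -mulrBr -mulrDr; congr (_ * _).
    rewrite -sumrB -big_split/=; apply: eq_bigr => s _.
    rewrite -sumrB -big_split/=; apply: eq_bigr => t _.
    rewrite /near /mask /low.
    have r0' : 0 < r%:R :> R by rewrite ltr0n.
    have [z0|z0] := ger0P (s%:R - t%:R).
      have -> : (r%:R <= - (s%:R - t%:R) :> R) = false.
        by apply/negbTE; rewrite -ltNge; lra.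
      by rewrite mul0r addr0; case: ltP => _; rewrite ?subrr ?mul0r ?subr0.
    have -> : (r%:R <= s%:R - t%:R :> R) = false.
      by apply/negbTE; rewrite -ltNge; lra.
    by rewrite mul0r add0r; case: ltP => _; rewrite ?subrr ?mul0r ?subr0.
  rewrite exD// mulr_natl mulr2n; apply: lerD; exact: lower_le.
have H2 u w (bu bw : R) : 0 <= bu -> 0 <= bw ->
    energy_le E N u (2 * bu * S) -> energy_le E N w (2 * bw * S) ->
    (forall s, (s < N)%N -> nrm E (u s) <= bu) ->
    (forall s, (s < N)%N -> nrm E (w s) <= bw) ->
    bu * bw <= b 0%N * b r -> ex E (fun v => `|far u w v|) <= sm.
  move=> bu0 bw0 Eu Ew nu nw buw.
  apply: (@le_trans _ _ (ex E (fun v => `|qform N ka u w v| + `|qform N near u w v|))).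
    by apply: ex_le => // v; exact: ler_normB.
  rewrite exD//; apply: lerD; last first.
    have h := @qform_near_le _ _ E N r ka u w bu bw Npos ka1
      (fun s => fin_sq _) (fun s => fin_sq _) nu nw.
    apply: le_trans h _.
    by apply: ler_wpM2l => //; rewrite mulr_ge0.
  have [_ h] := @qform_le _ _ E N n k lam th u w _ _ Npos k0 k1
    (fun s => fin_sq (u s)) (fun s => fin_sq (w s))
    (mulr_ge0 (mulr_ge0 (ler0n R 2) bu0) S0) (mulr_ge0 (mulr_ge0 (ler0n R 2) bw0) S0) Eu Ew.
  apply: le_trans h _.
  rewrite -sqrtrM ?mulr_ge0// (_ : 2 * bu * S * (2 * bw * S) = (2 * S) ^+ 2 * (bu * bw)); last by ring.
  rewrite sqrtrM ?sqr_ge0// sqrtr_sqr ger0_norm ?mulr_ge0//.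
  have -> : 2 * (2 * S * Num.sqrt (bu * bw)) = 4 * S * Num.sqrt (bu * bw) by ring.
  by apply: ler_wpM2l; [rewrite mulr_ge0|exact: ler_wsqrtr].
have Erx : energy_le E N Rx (2 * b r * S) by exact: predict_energy.
have Ery : energy_le E N Ry (2 * b r * S) by exact: predict_energy.
have Ex : energy_le E N x (2 * b 0%N * S) by exact: process_energy.
have Ey : energy_le E N y (2 * b 0%N * S) by exact: process_energy.
have nrx s : (s < N)%N -> nrm E (Rx s) <= b r by move=> sN; exact: (predict_nrm b0 xb).
have nry s : (s < N)%N -> nrm E (Ry s) <= b r by move=> sN; exact: (predict_nrm b0 yb).
have nx s : (s < N)%N -> nrm E (x s) <= b 0%N by move=> sN; exact: (nrm_process b0 xb).
have ny s : (s < N)%N -> nrm E (y s) <= b 0%N by move=> sN; exact: (nrm_process b0 yb).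
apply: (@le_trans _ _ (ex E (fun v =>
    `|far Ix Iy v| + `|far Rx y v| + `|far x Ry v| + `|far Rx Ry v|))).
  apply: ex_le => // v; rewrite -/(far x y v) farE.
  apply: le_trans (ler_normB _ _) _; rewrite lerD2r.
  apply: le_trans (ler_normD _ _) _; rewrite lerD2r.
  exact: ler_normD.
rewrite !exD// -!addrA; apply: lerD => //.
have -> : 3 * sm = sm + (sm + sm) by ring.
apply: lerD; first by apply: (H2 _ _ (b r) (b 0%N)) => //; rewrite mulrC.
apply: lerD; first by apply: (H2 _ _ (b 0%N) (b r)).
by apply: (H2 _ _ (b r) (b r)) => //; exact: ler_wpM2r.
Qed.

End martingale_approximation.

(** * Random variables *)

Section prob_op.
Context {disp : measure_display} {T : measurableType disp} {R : realType}.
Variable P : probability T R.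

Let plf (f : T -> R) : Prop := P.-integrable setT (EFin \o f).
Let pex (f : T -> R) : R := fine 'E_P[f].

Let pexE f : pex f = \int[P]_w f w.
Proof. by rewrite /pex unlock. Qed.

Let plf_mf f : plf f -> measurable_fun setT f.
Proof. by move=> /measurable_int /measurable_EFinP. Qed.

Let plf_cst c : plf (fun=> c).
Proof.
exact: (@finite_measure_integrable_cst _ _ _ P setT c).
Qed.

Let plfD f g : plf f -> plf g -> plf (fun w => f w + g w).
Proof. by move=> ff gg; apply: (integrableD measurableT ff gg). Qed.

Let plfZ c f : plf f -> plf (fun w => c * f w).
Proof. by move=> ff; exact: (integrableZl measurableT c ff). Qed.

Let plf_norm f : plf f -> plf (fun w => `|f w|).
Proof. by move=> ff; exact: (integrable_norm ff). Qed.

Let plf_dom (f g : T -> R) : measurable_fun setT f -> plf g ->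
  (forall w, `|f w| <= g w) -> plf f.
Proof.
move=> mf lg fg; apply: le_integrable lg => //; first exact/measurable_EFinP.
by move=> w _ /=; rewrite lee_fin (le_trans (fg w))// ler_norm.
Qed.

Let pex1 : pex (fun=> 1) = 1.
Proof. by rewrite /pex expectation_cst. Qed.

Let pexD f g : plf f -> plf g -> pex (fun w => f w + g w) = pex f + pex g.
Proof. by move=> ff gg; rewrite !pexE RintegralD. Qed.

Let pexZ c f : plf f -> pex (fun w => c * f w) = c * pex f.
Proof. by move=> ff; rewrite !pexE RintegralZl. Qed.

Let pex_ge0 f : plf f -> (forall w, 0 <= f w) -> 0 <= pex f.
Proof. by move=> _ f0; rewrite pexE Rintegral_ge0. Qed.

Definition prob_op : expectation_op R T :=
  @ExpectationOp R T (fun f : T -> R => measurable_fun setT f) plf pex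
    (fun c => @measurable_cst _ _ _ _ setT c)
    (fun f g mf mg => measurable_funD mf mg)
    (fun f g mf mg => measurable_funM mf mg)
    plf_mf plf_cst plfD plfZ plf_norm plf_dom pex1 pexD pexZ pex_ge0.

Lemma prob_exE f : ex prob_op f = fine 'E_P[f]. Proof. by []. Qed.

Lemma prob_lf_EFin f : lf prob_op f -> ('E_P[f] = (ex prob_op f)%:E)%E.
Proof.
by move=> lff; rewrite prob_exE fineK// unlock; exact: integrable_fin_num.
Qed.

Lemma ge0_lf (f : T -> R) : measurable_fun setT f -> (forall w, 0 <= f w) ->
  ('E_P[f] < +oo)%E -> lf prob_op f.
Proof.
move=> mf f0 foo; apply/integrableP; split; first exact/measurable_EFinP.
rewrite (le_lt_trans _ foo)// unlock; apply: ge0_le_integral => //=.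
- by apply/measurable_EFinP; exact: measurableT_comp.
- exact/measurable_EFinP.
- by move=> w _; rewrite ger0_norm.
Qed.

Lemma bounded_sq (f : T -> R) (C : R) : measurable_fun setT f -> (forall w, `|f w| <= C) ->
  sq prob_op f.
Proof.
move=> mf fC; split => //; apply: (@lf_dom _ _ prob_op _ (fun=> C ^+ 2)).
- by apply: measurable_funX.
- exact: lf_cst.
- move=> w; rewrite normrX ler_pXn2r ?nnegrE//.
  exact: le_trans (normr_ge0 (f w)) (fC w).
Qed.

Lemma bounded_lf (f : T -> R) (C : R) : measurable_fun setT f -> (forall w, `|f w| <= C) ->
  lf prob_op f.
Proof. by move=> mf fC; apply: sq_lf; exact: bounded_sq fC. Qed.

Lemma ex_indic (A : set T) : measurable A -> ex prob_op (\1_A) = fine (P A).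
Proof. by move=> mA; rewrite prob_exE expectation_indic. Qed.

Lemma measurable_gt (f : T -> R) (e : R) : measurable_fun setT f ->
  measurable [set w | e < f w].
Proof.
move=> mf; rewrite -[X in measurable X]setTI.
rewrite (_ : [set w | e < f w] = f @^-1` `]e, +oo[%classic).
  by apply: mf => //; exact: measurable_itv.
by apply/seteqP; split => w /=; rewrite in_itv/= andbT.
Qed.

Lemma markov_ex (f : T -> R) (e : R) : 0 < e -> lf prob_op f -> (forall w, 0 <= f w) ->
  (P [set w | (e < f w)%R] <= (ex prob_op f / e)%:E)%E.
Proof.
move=> e0 lff f0; have mff := lf_mf lff.
have mA := measurable_gt e mff.
rewrite -(@fineK _ (P _)) ?fin_num_measure// lee_fin ler_pdivlMr// -ex_indic// mulrC.
have li : lf prob_op (\1_[set w | e < f w]).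
  apply: (@bounded_lf _ 1) => // w; rewrite indicE ger0_norm// lern1; by case: (_ \in _).
rewrite -exZ//; apply: ex_le => //; first exact: lfZ.
move=> w; rewrite indicE; case: (boolP (w \in _)) => [|_]; last by rewrite mulr0.
by rewrite mulr1 inE/= => /ltW.
Qed.

Definition RV_of (d' : measure_display) (T' : measurableType d') (f : T -> T')
    (mf : measurable_fun setT f) : {mfun T >-> T'} := mfun_Sub (mem_set mf).

Lemma eq_law_expectation (f g : T -> R) :
  measurable_fun setT f -> measurable_fun setT g ->
  (forall B : set R, measurable B -> P [set w | B (f w)] = P [set w | B (g w)]) ->
  ('E_P[f] = 'E_P[g])%E.
Proof.
move=> mff mfg fg.
have intE (q : R -> \bar R) : @measurable_fun _ _ R (\bar R) setT q ->
    (forall y, (0 <= q y)%E) -> (\int[P]_w q (f w) = \int[P]_w q (g w))%E.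
  move=> mq q0.
  apply: etrans (ge0_integral_distribution (RV_of mfg) mq q0).
  apply: etrans (esym (ge0_integral_distribution (RV_of mff) mq q0)) _.
  by apply: eq_measure_integral => B mB _; exact: fg.
rewrite unlock integralE [RHS]integralE; congr (_ - _)%E.
- under eq_integral do rewrite funeposE -(funeposE (@EFin R)).
  under [RHS]eq_integral do rewrite funeposE -(funeposE (@EFin R)).
  by apply: intE => //; exact: measurable_funepos.
- under eq_integral do rewrite funenegE -(funenegE (@EFin R)).
  under [RHS]eq_integral do rewrite funenegE -(funenegE (@EFin R)).
  by apply: intE => //; exact: measurable_funeneg.
Qed.

Lemma eq_law_lf (f g : T -> R) :
  measurable_fun setT f -> measurable_fun setT g ->
  (forall B : set R, measurable B -> P [set w | B (f w)] = P [set w | B (g w)]) ->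
  lf prob_op f -> lf prob_op g.
Proof.
move=> mff mfg fg lff.
have [mnf mng] : measurable_fun setT (fun w => `|f w|) /\ measurable_fun setT (fun w => `|g w|).
  by split; exact: measurableT_comp.
apply: (@lf_dom _ _ prob_op _ (fun w => `|g w|)) => //.
apply: ge0_lf => //; rewrite -(@eq_law_expectation (fun w => `|f w|))//.
  by rewrite prob_lf_EFin ?ltry//; exact: lf_norm.
move=> B mB; apply: (fg [set x | B `|x|]).
rewrite -[X in measurable X]setTI.
exact: (@normr_measurable R setT measurableT B mB).
Qed.

(** The joint law of two independent variables is the product of their laws,
  by uniqueness of the product measure; Fubini's theorem concludes. *)
Lemma indep_ex (f g : T -> R) : lf prob_op f -> lf prob_op g ->
  lf prob_op (fun w => f w * g w) ->
  (forall A B : set R, measurable A -> measurable B ->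
    (P ([set w | A (f w)] `&` [set w | B (g w)]) =
    P [set w | A (f w)] * P [set w | B (g w)])%E) ->
  ex prob_op (fun w => f w * g w) = ex prob_op f * ex prob_op g.
Proof.
move=> lff lfg lffg ind.
have mff := lf_mf lff; have mfg := lf_mf lfg.
have mp : measurable_fun setT (fun w => (f w, g w)) by exact: measurable_fun_pair.
pose F := RV_of mff; pose G := RV_of mfg; pose H := RV_of mp.
pose m1 := distribution P F; pose m2 := distribution P G; pose m := distribution P H.
have mE X : measurable X -> (m1 \x m2)%E X = m X.
  by apply: product_measure_unique => A B mA mB; exact: ind.
pose q (z : R * R) : \bar R := (z.1 * z.2)%:E.
have mq : measurable_fun setT q.
  apply/measurable_EFinP; apply: measurable_funM => //=.
have iH : P.-integrable setT (q \o H) by exact: lffg.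
have e1 : (\int[P]_w (f w * g w)%:E = \int[m]_z q z)%E.
  by rewrite /m integral_distribution.
have e2 : (\int[m]_z q z = \int[(m1 \x m2)%E]_z q z)%E.
  by apply: eq_measure_integral => A mA _; first [exact: (mE A mA)|exact: (esym (mE A mA))].
have iq : ((m1 \x m2)%E).-integrable setT q.
  apply/integrableP; split => //.
  have -> : (\int[(m1 \x m2)%E]_z `|q z| = \int[m]_z `|q z|)%E.
    by apply: eq_measure_integral => A mA _; first [exact: (mE A mA)|exact: (esym (mE A mA))].
  rewrite ge0_integral_distribution//; last exact: measurableT_comp.
  by have /integrableP[_] := iH.
have iG : m2.-integrable setT (EFin \o id).
  apply/integrableP; split; first exact/measurable_EFinP.
  rewrite ge0_integral_distribution//=; last by apply/measurableT_comp => //; exact/measurable_EFinP.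
  by have /integrableP[_] := lfg.
have iF : m1.-integrable setT (EFin \o id).
  apply/integrableP; split; first exact/measurable_EFinP.
  rewrite ge0_integral_distribution//=; last by apply/measurableT_comp => //; exact/measurable_EFinP.
  by have /integrableP[_] := lff.
have eG : (\int[m2]_y y%:E = 'E_P[g])%E.
  by rewrite unlock integral_distribution//; exact/measurable_EFinP.
have eF : (\int[m1]_y y%:E = 'E_P[f])%E.
  by rewrite unlock integral_distribution//; exact/measurable_EFinP.
rewrite !prob_exE -fineM -?prob_lf_EFin//; [|by rewrite prob_lf_EFin..].
congr fine; transitivity (\int[P]_w (f w * g w)%:E)%E; first by rewrite unlock.
rewrite e1 e2 -integral12_prod_meas1//=.
transitivity (\int[m1]_x (x%:E * 'E_P[g]))%E.
  apply: eq_integral => x _; rewrite -eG -integralZl//.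
by rewrite prob_lf_EFin// integralZr// eF.
Qed.

End prob_op.

(** * Path spaces *)

(** [borel_fam] as a measurable type, so that the closure properties of
  measurable real functions apply to functions of a family of vectors. *)
Definition fam_gen (R : realType) (d : nat) (I : Type) : set (set (I -> 'cV[R]_d)) :=
  [set A | exists i j k (B : set R),
     [/\ [set: I] i, measurable B & A = [set s : I -> 'cV[R]_d | B (s i j k)]]].

Definition bfam (R : realType) (d : nat) (I : Type) :=
  g_sigma_algebraType (@fam_gen R d I).

Section path_space.
Context {R : realType} {d : nat}.

Lemma bfamE (I : Type) : @measurable _ (bfam R d I) = @borel_fam R d I.
Proof. by []. Qed.

Lemma measurable_coord (I : Type) (i : I) (a : 'I_d) (b : 'I_1) :
  measurable_fun setT (fun x : bfam R d I => x i a b).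
Proof.
by move=> _ B mB; rewrite setTI; apply: sub_sigma_algebra; exists i, a, b, B.
Qed.

Lemma measurable_to_bfam (I : Type) {disp} {S : measurableType disp}
    (f : S -> bfam R d I) :
  (forall i a b, measurable_fun setT (fun s => f s i a b)) -> measurable_fun setT f.
Proof.
move=> mf; refine (@measurability _ _ S (bfam R d I) setT f (@fam_gen R d I) _ _) => //.
move=> _ [A [i [a [b [B [_ mB ->]]]]] <-].
by have := mf i a b measurableT B mB.
Qed.

Lemma measurable_reindex (I J : Type) (r : J -> I) :
  measurable_fun setT ((fun x j => x (r j)) : bfam R d I -> bfam R d J).
Proof. by apply: measurable_to_bfam => j a b; exact: measurable_coord. Qed.

Lemma mx_measurable_fun (I : Type) (g : (I -> 'cV[R]_d) -> 'cV[R]_d) a b :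
  mx_measurable (@borel_fam R d I) g ->
  measurable_fun setT (fun x : bfam R d I => g x a b).
Proof. by move=> mg _ B mB; rewrite setTI; exact: mg. Qed.

Lemma sigma_gen_preimage (S I J : Type) (D : set I) (f : I -> S -> 'cV[R]_d)
    (r : J -> I) (A : set (J -> 'cV[R]_d)) :
  (forall j, D (r j)) -> borel_fam A ->
  sigma_gen D f [set s | A (fun j => f (r j) s)].
Proof.
move=> Dr; apply: (@smallest_sub _ _ (@fam_gen R d J)
    [set A | sigma_gen D f [set s | A (fun j => f (r j) s)]]).
  split => [|B HB|B HB]; first exact: sigma_algebra0.
    by rewrite setTD; have := sigma_algebraCD HB; rewrite setTD.
  rewrite /= (_ : [set s | _] = \bigcup_k [set s | B k (fun j => f (r j) s)]).
    exact: sigma_algebra_bigcup.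
  by apply/seteqP; split => s [k _ h]; exists k.
move=> _ [j [a [b [B [_ mB ->]]]]].
by apply: sub_sigma_algebra; exists (r j), a, b, B.
Qed.

End path_space.

Section stationary.
Context {disp : measure_display} {T : measurableType disp} {R : realType}.
Variables (P : probability T R) (d : nat).
Variable X : int -> T -> 'cV[R]_d.
Hypothesis mX : forall t a b, measurable_fun setT (fun w => X t w a b).

Lemma measurable_paths (I : Type) (t : I -> int) :
  measurable_fun setT ((fun w i => X (t i) w) : T -> bfam R d I).
Proof. exact: measurable_to_bfam. Qed.

Lemma measurable_of_paths (I : Type) (t : I -> int) (h : bfam R d I -> R) :
  measurable_fun setT h -> measurable_fun setT (fun w => h (fun i => X (t i) w)).
Proof. by move=> mh; exact: measurableT_comp mh (measurable_paths t). Qed.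

Hypothesis sX : strictly_stationary P X.

Lemma stationary_law (n : nat) (t : 'I_n -> int) (s : int) (h : bfam R d 'I_n -> R) :
  measurable_fun setT h -> forall B : set R, measurable B ->
  P [set w | B (h (fun i => X (t i) w))] = P [set w | B (h (fun i => X (t i + s) w))].
Proof.
move=> mh B mB; apply: (sX t s (A := [set x | B (h x)])).
by have := mh measurableT B mB; rewrite setTI.
Qed.

Lemma stationary_ex (n : nat) (t : 'I_n -> int) (s : int) (h : bfam R d 'I_n -> R) :
  measurable_fun setT h ->
  ex (prob_op P) (fun w => h (fun i => X (t i) w)) =
  ex (prob_op P) (fun w => h (fun i => X (t i + s) w)).
Proof.
move=> mh; rewrite !prob_exE; congr fine; apply: eq_law_expectation.
- exact: (measurable_of_paths t mh).
- exact: (measurable_of_paths (fun i => t i + s) mh).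
- by move=> B mB; exact: (stationary_law t s mh mB).
Qed.

Lemma stationary_lf (n : nat) (t : 'I_n -> int) (s : int) (h : bfam R d 'I_n -> R) :
  measurable_fun setT h ->
  lf (prob_op P) (fun w => h (fun i => X (t i) w)) ->
  lf (prob_op P) (fun w => h (fun i => X (t i + s) w)).
Proof.
move=> mh; apply: eq_law_lf.
- exact: (measurable_of_paths t mh).
- exact: (measurable_of_paths (fun i => t i + s) mh).
- by move=> B mB; exact: (stationary_law t s mh mB).
Qed.

End stationary.

(** * Mixing *)

Section mixing.
Context {disp : measure_display} {T : measurableType disp} {R : realType}.
Variables (P : probability T R) (d m : nat).
Variable xi : int -> T -> 'cV[R]_d.
Hypothesis mxi : forall t a b, measurable_fun setT (fun w => xi t w a b).
Hypothesis dep_xi : m_dependent P m xi.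
Local Notation E := (prob_op P).

Definition past (n : nat) (w : T) : bfam R d nat := fun k => xi (- n%:Z - k%:Z) w.

Definition recent (l : nat) (w : T) : bfam R d 'I_l.+1 := fun k => xi (- k%:Z) w.
Arguments recent l w : clear implicits.

Lemma measurable_past n (h : bfam R d nat -> R) : measurable_fun setT h ->
  measurable_fun setT (fun w => h (past n w)).
Proof. exact: (measurable_of_paths mxi _). Qed.

Lemma measurable_recent l (h : bfam R d 'I_l.+1 -> R) : measurable_fun setT h ->
  measurable_fun setT (fun w => h (recent l w)).
Proof. exact: (measurable_of_paths mxi _). Qed.

Lemma recent_past_indep (l n : nat) (f : bfam R d 'I_l.+1 -> R)
    (h : bfam R d nat -> R) : (l + m < n)%N ->
  measurable_fun setT f -> measurable_fun setT h ->
  lf E (fun w => f (recent l w)) -> lf E (fun w => h (past n w)) ->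
  lf E (fun w => f (recent l w) * h (past n w)) ->
  ex E (fun w => f (recent l w) * h (past n w)) =
  ex E (fun w => f (recent l w)) * ex E (fun w => h (past n w)).
Proof.
move=> lmn mf mh lff lfh lffh; apply: indep_ex => // A B mA mB.
pose I := [set i : int | (- l%:Z <= i)%R]; pose J := [set j : int | (j <= - n%:Z)%R].
apply: (@dep_xi I J).
- by move=> i j; rewrite /I /J/=; lia.
- have mA' : @borel_fam R d _ (f @^-1` A) by have := mf measurableT A mA; rewrite setTI.
  apply: (@sigma_gen_preimage R d T int 'I_l.+1 I xi (fun k => - k%:Z) _ _ mA').
  by move=> k; rewrite /I/=; have := ltn_ord k; lia.
- have mB' : @borel_fam R d _ (h @^-1` B) by have := mh measurableT B mB; rewrite setTI.
  apply: (@sigma_gen_preimage R d T int nat J xi (fun k => - n%:Z - k%:Z) _ _ mB').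
  by move=> k; rewrite /J/=; lia.
Qed.

Definition cov (f g : T -> R) : R := ex E (fun w => f w * g w) - ex E f * ex E g.

(** Covariance with the past of distance [n] tends to [0] uniformly over the
  bounded functions of that past. *)
Definition decouples (f : T -> R) : Prop := forall e : R, 0 < e ->
  exists n0, forall n (h : bfam R d nat -> R), (n0 <= n)%N ->
    measurable_fun setT h -> (forall x, `|h x| <= 1) ->
    `|cov f (fun w => h (past n w))| <= e.

Lemma lf_past n (h : bfam R d nat -> R) : measurable_fun setT h ->
  (forall x, `|h x| <= 1) -> lf E (fun w => h (past n w)).
Proof. by move=> mh h1; apply: (@bounded_lf _ _ _ _ _ 1) => //; exact: measurable_past. Qed.

Lemma lfM_past n f (h : bfam R d nat -> R) : measurable_fun setT h ->
  (forall x, `|h x| <= 1) -> lf E f -> lf E (fun w => f w * h (past n w)).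
Proof.
move=> mh h1 lff; apply: (@lf_dom _ _ E _ (fun w => `|f w|)).
- by apply: mfM; [exact: lf_mf lff|exact: measurable_past].
- exact: lf_norm.
- by move=> w; rewrite normrM ler_piMr.
Qed.

Lemma covDl f f' g : lf E f -> lf E f' -> lf E (fun w => f w * g w) ->
  lf E (fun w => f' w * g w) -> cov (fun w => f w + f' w) g = cov f g + cov f' g.
Proof.
move=> lff lff' lfg lfg'; rewrite /cov.
by under ex_ext do rewrite mulrDl; rewrite !exD//; ring.
Qed.

Lemma covZl c f g : lf E f -> lf E (fun w => f w * g w) ->
  cov (fun w => c * f w) g = c * cov f g.
Proof.
move=> lff lfg; rewrite /cov.
by under ex_ext do rewrite -mulrA; rewrite !exZ//; ring.
Qed.

Lemma cov_le f n (h : bfam R d nat -> R) : lf E f -> measurable_fun setT h ->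
  (forall x, `|h x| <= 1) ->
  `|cov f (fun w => h (past n w))| <= 2 * ex E (fun w => `|f w|).
Proof.
move=> lff mh h1; apply: le_trans (ler_normB _ _) _.
have -> : 2 * ex E (fun w => `|f w|) = ex E (fun w => `|f w|) + ex E (fun w => `|f w|) * 1.
  by ring.
have lnf := lf_norm lff; have lh := lf_past n mh h1.
apply: lerD.
  have lfh := lfM_past n mh h1 lff.
  apply: le_trans (ler_norm_ex lfh) _; apply: ex_le => //; first exact: lf_norm.
  by move=> w; rewrite normrM ler_piMr.
rewrite normrM; apply: ler_pM => //; first exact: ler_norm_ex.
apply: le_trans (ler_norm_ex lh) _.
by rewrite -[leRHS](ex_cst E); apply: ex_le => //; [exact: lf_norm|exact: lf_cst].
Qed.

Lemma decouplesD f g : lf E f -> lf E g -> decouples f -> decouples g ->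
  decouples (fun w => f w + g w).
Proof.
move=> lff lfg df dg e e0; have e20 : 0 < e / 2 by rewrite divr_gt0.
have [n1 H1] := df _ e20; have [n2 H2] := dg _ e20.
exists (maxn n1 n2) => n h; rewrite geq_max => /andP[n1n n2n] mh h1.
rewrite covDl//; try exact: lfM_past.
rewrite (splitr e); apply: le_trans (ler_normD _ _) _.
by apply: lerD; [exact: H1|exact: H2].
Qed.

Lemma decouplesZ c f : lf E f -> decouples f -> decouples (fun w => c * f w).
Proof.
move=> lff df e e0; have c1 : 0 < `|c| + 1 by rewrite ltr_pwDr.
have [n0 H0] := df _ (divr_gt0 e0 c1); exists n0 => n h n0n mh h1.
rewrite covZl//; last exact: lfM_past.
rewrite normrM; apply: (@le_trans _ _ ((`|c| + 1) * (e / (`|c| + 1)))).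
  by apply: ler_pM => //; [rewrite lerDl|exact: H0].
by rewrite mulrCA divff ?mulr1 ?gt_eqF.
Qed.

Lemma decouples_cst c : decouples (fun=> c).
Proof.
move=> e e0; exists 0%N => n h _ mh h1.
rewrite /cov exZ ?ex_cst ?subrr ?normr0 ?ltW//; exact: lf_past.
Qed.

Lemma decouples_sum (I : Type) (r : seq I) (F : I -> T -> R) :
  (forall i, lf E (F i)) -> (forall i, decouples (F i)) ->
  decouples (fun w => \sum_(i <- r) F i w).
Proof.
move=> lF dF; elim: r => [|i r IH].
  have -> : (fun w => \sum_(i <- [::]) F i w) = (fun=> 0).
    by apply/funext => w; rewrite big_nil.
  exact: decouples_cst.
have -> : (fun w => \sum_(j <- i :: r) F j w) = (fun w => F i w + \sum_(j <- r) F j w).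
  by apply/funext => w; rewrite big_cons.
by apply: decouplesD => //; exact: lf_sum.
Qed.

(** The covariance with a function bounded by [1] is at most twice the mean of
  [f], so that decoupling passes to limits in mean. *)
Lemma decouples_lim f : lf E f ->
  (forall e, 0 < e -> exists g, [/\ lf E g, decouples g &
    ex E (fun w => `|f w - g w|) <= e]) -> decouples f.
Proof.
move=> lff H e e0; have e40 : 0 < e / 4 by rewrite divr_gt0.
have [g [lfg dg fg]] := H _ e40.
have [n0 H0] := dg _ (divr_gt0 e0 (ltr0n R 2)); exists n0 => n h n0n mh h1.
have lfB : lf E (fun w => f w - g w) by exact: lfB.
have -> : f = (fun w => g w + (f w - g w)) by apply/funext => w; ring.
rewrite covDl//; try exact: lfM_past.
have -> : e = e / 2 + 2 * (e / 4) by field.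
apply: le_trans (ler_normD _ _) _; apply: lerD; first exact: H0.
by apply: le_trans (cov_le n lfB mh h1) _; rewrite ler_pM2l.
Qed.

Let path0 (A : set (bfam R d nat)) (w : T) : R := \1_A (past 0 w).

Let path0_lf A : measurable A -> lf E (path0 A).
Proof.
move=> mA; apply: (@bounded_lf _ _ _ _ _ 1).
  exact: (measurable_past 0 (measurable_indic mA)).
by move=> w; rewrite /path0 indicE ger0_norm// lern1; case: (_ \in _).
Qed.

(** The tail of an [m]-dependent sequence is trivial: the events that
  decouple from the far past form a Dynkin class that contains the
  finite-dimensional events. *)
Lemma decouples_event A : measurable A -> decouples (path0 A).
Proof.
pose cyl := [set A : set (bfam R d nat) | exists l (B : set (bfam R d 'I_l.+1)),
   measurable B /\ A = [set x | B (fun i : 'I_l.+1 => x (nat_of_ord i))]].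
have cylm A0 : cyl A0 -> measurable A0.
  move=> [l [B [mB ->]]].
  by have := @measurable_reindex R d nat 'I_l.+1 (@nat_of_ord _) measurableT B mB; rewrite setTI.
have cylE : @measurable _ (bfam R d nat) = <<s cyl >>.
  apply/seteqP; split.
    apply: smallest_sub; first exact: smallest_sigma_algebra.
    move=> _ [k [a [b [B [_ mB ->]]]]]; apply: sub_sigma_algebra.
    exists k, [set x | B (x ord_max a b)]; split => //.
    by have := @measurable_coord R d 'I_k.+1 ord_max a b measurableT B mB; rewrite setTI.
  by apply: smallest_sub; [exact: sigma_algebra_measurable|exact: cylm].
move=> mA; have sA : <<s cyl >> A by rewrite -cylE.
apply: (@dynkin_induction _ _ cyl (fun A => decouples (path0 A)) cylE) sA.
- move=> A1 A2 [l1 [B1 [mB1 ->]]] [l2 [B2 [mB2 ->]]].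
  pose l := maxn l1 l2.
  have le1 : (l1.+1 <= l.+1)%N by rewrite ltnS leq_maxl.
  have le2 : (l2.+1 <= l.+1)%N by rewrite ltnS leq_maxr.
  exists l, ([set x | B1 (fun i => x (widen_ord le1 i))] `&`
             [set x | B2 (fun i => x (widen_ord le2 i))]); split => //.
  apply: measurableI.
    by have := @measurable_reindex R d _ _ (widen_ord le1) measurableT B1 mB1; rewrite setTI.
  by have := @measurable_reindex R d _ _ (widen_ord le2) measurableT B2 mB2; rewrite setTI.
- have -> : path0 setT = (fun=> 1) by apply/funext => w; rewrite /path0 indicT.
  exact: decouples_cst.
- move=> _ [l [B [mB ->]]] e e0; exists (l + m).+1 => n h ln mh h1.
  pose f (x : bfam R d 'I_l.+1) : R := \1_B x.
  have mf : measurable_fun setT f by exact: measurable_indic.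
  have f0E : path0 [set x | B (fun i : 'I_l.+1 => x i)] = (fun w => f (recent l w)).
    apply/funext => w; rewrite /path0 /f !indicE; congr ((nat_of_bool _)%:R).
    have -> : recent l w = (fun i : 'I_l.+1 => past 0 w i).
      by apply/funext => i; rewrite /recent /past oppr0 sub0r.
    by apply/idP/idP; rewrite !inE.
  have lff : lf E (fun w => f (recent l w)).
    rewrite -f0E; apply: path0_lf; apply: cylm; by exists l, B.
  rewrite f0E /cov recent_past_indep// ?subrr ?normr0 ?ltW//; first exact: lf_past.
  exact: lfM_past.
- move=> S mS dS; have lfS := path0_lf mS.
  have -> : path0 (~` S) = (fun w => 1 + (-1) * path0 S w).
    apply/funext => w; rewrite /path0 !indicE in_setC.
    by case: (_ \in _); rewrite /= ?mulr1 ?subrr ?mulr0 ?addr0.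
  apply: decouplesD; [exact: lf_cst|exact: lfZ|exact: decouples_cst|exact: decouplesZ].
- move=> F mF tF dF.
  have mU : measurable (\bigcup_k F k) by exact: bigcup_measurable.
  apply: decouples_lim => [|e e0]; first exact: path0_lf.
  pose Q := P \o (fun A => [set w | A (past 0 w)]).
  pose G k := [set w | F k (past 0 w)].
  have mpast : measurable_fun setT (past 0) by exact: (measurable_paths mxi).
  have mG k : measurable (G k).
    by have := mpast measurableT _ (mF k); rewrite setTI.
  have tG : trivIset setT G.
    by move=> i j _ _ [w [Fi Fj]]; apply: (tF i j I I); exists (past 0 w).
  have mUG : measurable (\bigcup_k G k) by exact: bigcup_measurable.
  have cG : (fun n => (\sum_(k < n) fine (P (G k)))%:E) @ \oo --> P (\bigcup_k G k).
    have := @measure_sigma_additive _ _ _ P G mG tG.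
    rewrite (_ : (fun n => _) = (fun n => (\sum_(k < n) fine (P (G k)))%:E))//.
    apply/funext => n; rewrite big_mkord -sumEFin; apply: eq_bigr => k _.
    by rewrite fineK ?fin_num_measure.
  have cG' : (fun n => \sum_(k < n) fine (P (G k))) @ \oo --> fine (P (\bigcup_k G k)).
    apply: (@fine_cvg _ _ _ _ (fun n => (\sum_(k < n) fine (P (G k)))%:E)).
    by rewrite fineK ?fin_num_measure.
  move/cvgrPdist_le: cG' => /(_ e e0)[N _ HN].
  exists (fun w => \sum_(k < N) path0 (F k) w); split.
  - by apply: lf_sum => k _; exact: path0_lf.
  - rewrite (_ : (fun w => _) = (fun w => \sum_(k <- index_enum 'I_N) path0 (F k) w))//.
    by apply: decouples_sum => k; [exact: path0_lf|exact: dF].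
  have le1 w : \sum_(k < N) path0 (F k) w <= path0 (\bigcup_k F k) w.
    have [[k0 _ Fk0]|nF] := pselect ((\bigcup_k F k) (past 0 w)); last first.
      rewrite big1// => k _; rewrite /path0 indicE memNset// => Fk.
      by apply: nF; exists k.
    have -> : path0 (\bigcup_k F k) w = 1.
      by rewrite /path0 indicE mem_set//; exists k0.
    rewrite (eq_bigr (fun k : 'I_N => ((k : nat) == k0)%:R)) => [|k _].
      rewrite -natr_sum lern1; have [k0N|k0N] := ltnP k0 N.
        by rewrite (bigD1 (Ordinal k0N))//= eqxx big1// => i /negPf; rewrite -val_eqE/= => ->.
      by rewrite big1// => i _; rewrite ltn_eqF// (leq_trans (ltn_ord i)).
    rewrite /path0 indicE; have [->|kk0] := eqVneq (k : nat) k0; first by rewrite mem_set.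
    rewrite memNset// => Fk; move/eqP: kk0; apply.
    by apply: (tF _ _ I I); exists (past 0 w).
  have le2 : ex E (fun w => path0 (\bigcup_k F k) w) = fine (P (\bigcup_k G k)).
    rewrite -ex_indic//; apply: ex_ext => w; rewrite /path0 !indicE; congr ((nat_of_bool _)%:R).
  have le3 k : ex E (path0 (F k)) = fine (P (G k)).
    rewrite -ex_indic//; apply: ex_ext => w; rewrite /path0 !indicE; congr ((nat_of_bool _)%:R).
  under ex_ext => w do rewrite ger0_norm ?subr_ge0//.
  have lS : lf E (fun w => \sum_(k < N) path0 (F k) w).
    by apply: lf_sum => k _; exact: path0_lf.
  have lU : lf E (fun w => path0 (\bigcup_k F k) w) by exact: path0_lf.
  rewrite exB// ex_sum => [|k _]; last exact: path0_lf.
  rewrite le2 (eq_bigr (fun k : 'I_N => fine (P (G k)))) => [|k _]; last exact: le3.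
  exact: le_trans (ler_norm _) (HN N (leqnn N)).
Qed.

End mixing.

Arguments past {disp T R d} xi n w.
Arguments recent {disp T R d} xi l w.

(** * Processes subordinate to an m-dependent sequence *)

Section nrm_facts.
Context {R : realType} {T : Type} (E : expectation_op R T).

Lemma nrm_center (f : T -> R) : sq E f -> nrm E (fun w => f w - ex E f) <= nrm E f.
Proof.
move=> sf; apply: ler_wsqrtr; have [mff lff2] := sf; have lff := sq_lf sf.
have -> : (fun w => (f w - ex E f) ^+ 2) =
    (fun w => f w ^+ 2 - (2 * ex E f * f w - ex E f ^+ 2)).
  by apply/funext => w; ring.
have l1 : lf E (fun w => 2 * ex E f * f w) by exact: lfZ.
have l2 := lf_cst E (ex E f ^+ 2).
rewrite exB ?exB//; last exact: lfB.
by rewrite exZ// ex_cst; have := sqr_ge0 (ex E f); nra.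
Qed.

End nrm_facts.

Section subordinate.
Context {disp : measure_display} {T : measurableType disp} {R : realType}.
Variables (P : probability T R) (d m : nat).
Variable xi : int -> T -> 'cV[R]_d.
Variable g : (nat -> 'cV[R]_d) -> 'cV[R]_d.
Variable gtr : forall l : nat, ('I_l.+1 -> 'cV[R]_d) -> 'cV[R]_d.
Variable X : int -> T -> 'cV[R]_d.
Hypothesis shift : mdep_shift P m xi g gtr X.
Local Notation E := (prob_op P).

Lemma measurable_xi t a b : measurable_fun setT (fun w => xi t w a b).
Proof. by move=> _ B mB; rewrite setTI; apply: (shift_xi_measurable shift). Qed.

Lemma measurable_g a b : measurable_fun setT (fun x : bfam R d nat => g x a b).
Proof. by apply: mx_measurable_fun; exact: (shift_g shift). Qed.

Lemma measurable_gtr l a b :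
  measurable_fun setT (fun x : bfam R d 'I_l.+1 => @gtr l x a b).
Proof. by apply: mx_measurable_fun; exact: (shift_gtr shift). Qed.

Lemma measurable_X t a b : measurable_fun setT (fun w => X t w a b).
Proof.
under eq_fun do rewrite (shift_X shift).
exact: (measurable_of_paths measurable_xi (fun k => t - k%:Z) (measurable_g a b)).
Qed.

Lemma enorm_sqr (A : 'cV[R]_d) : enorm A ^+ 2 = \sum_a A a 0 ^+ 2.
Proof.
rewrite /enorm sqr_sqrtr; first by apply: eq_bigr => a _; rewrite big_ord1.
by apply: sumr_ge0 => a _; apply: sumr_ge0 => b _; exact: sqr_ge0.
Qed.

Lemma sqmoment_entry (Y : T -> 'cV[R]_d) a :
  (forall a, measurable_fun setT (fun w => Y w a 0)) -> (sqmoment P Y < +oo)%E ->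
  sq E (fun w => Y w a 0) /\
  ((nrm E (fun w => Y w a 0))%:E <= sqrte (sqmoment P Y))%E.
Proof.
move=> mY Yoo.
have mn : measurable_fun setT (fun w => enorm (Y w) ^+ 2).
  under eq_fun do rewrite enorm_sqr.
  by apply: measurable_sum => b; exact: measurable_funX.
have ln : lf E (fun w => enorm (Y w) ^+ 2) by apply: ge0_lf => // w; exact: sqr_ge0.
have le w : Y w a 0 ^+ 2 <= enorm (Y w) ^+ 2.
  by rewrite enorm_sqr (bigD1 a)//= lerDl; apply: sumr_ge0 => b _; exact: sqr_ge0.
have sY : sq E (fun w => Y w a 0).
  split; first exact: mY.
  apply: (@lf_dom _ _ E _ (fun w => enorm (Y w) ^+ 2)) => //.
    by apply: (measurable_funX 2 (mY a)).
  by move=> w; rewrite ger0_norm ?sqr_ge0.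
split => //; rewrite /sqmoment prob_lf_EFin//= lee_fin.
by apply: ler_wsqrtr; apply: ex_le => //; case: sY.
Qed.

Lemma sq_X t a : sq E (fun w => X t w a 0).
Proof.
apply: (sqmoment_entry a (Y := X t) _ (shift_sq shift t)).1 => b.
exact: measurable_X.
Qed.

(** The functions applied to the entries of [X]: the identity, a truncation and
  its complement. Being 1-Lipschitz, they do not increase approximation errors. *)
Definition lip1 (psi : R -> R) : Prop :=
  measurable_fun setT psi /\ forall x y, `|psi x - psi y| <= `|x - y|.

Lemma sq_lip psi (f : T -> R) : lip1 psi -> sq E f -> sq E (fun w => psi (f w)).
Proof.
move=> [mpsi lpsi] sf; have sa : sq E (fun w => psi (f w) - psi 0).
  split.
    by apply: measurable_funB => //; apply: measurableT_comp => //; case: sf.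
  apply: (@lf_dom _ _ E _ (fun w => f w ^+ 2)); [|by case: sf|].
    apply: measurable_funX; apply: measurable_funB => //.
    by apply: measurableT_comp => //; case: sf.
  move=> w; rewrite normrX -[leRHS]real_normK ?num_real// ler_pXn2r ?nnegrE//.
  by have := lpsi (f w) 0; rewrite subr0.
by apply: sq_ext (sqD sa (sq_cst E (psi 0))) _ => w; rewrite subrK.
Qed.

(** Centering by the mean at time [0] is centering at all times, by
  stationarity. *)
Definition Y (psi : R -> R) (a : 'I_d) (t : int) (w : T) : R :=
  psi (X t w a 0) - ex E (fun w => psi (X 0 w a 0)).

Lemma sq_Y psi a t : lip1 psi -> sq E (Y psi a t).
Proof.
move=> lp; apply: sqB; last exact: sq_cst.
by apply: (@sq_lip psi (fun w => X t w a 0)) => //; exact: sq_X.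
Qed.

(** The hypotheses make this finite for [l >= 1]; the approximation [gtr 0] is
  not controlled. *)
Definition approx_err (l : nat) : R :=
  fine (sqrte (sqmoment P (fun w => X 0 w - @gtr l (fun k => xi (- k%:Z) w)))).

(** At a gap [n] beyond [m + 1] the rate is the error of the approximation with
  [l = n - (m + 1)], the longest one that is independent of the past of
  distance [n]; at smaller gaps it is a bound for the norm of [X 0]. The added
  [1] makes [rate 0] positive, so that it can be divided by. *)
Definition rate (n : nat) : R :=
  if (n < m.+2)%N then \sum_a nrm E (fun w => X 0 w a 0) + 1
  else approx_err (n - m.+1).

Lemma rate_ge0 n : 0 <= rate n.
Proof.
rewrite /rate; case: ifP => _; last by rewrite fine_ge0// sqrte_ge0.
by rewrite addr_ge0// sumr_ge0// => a _; exact: nrm_ge0.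
Qed.

Lemma rate0_gt0 : 0 < rate 0.
Proof. by rewrite /rate/= ltr_wpDl// sumr_ge0// => a _; exact: nrm_ge0. Qed.

Lemma approx_sqmoment l : (0 < l)%N ->
  (sqmoment P (fun w => (X 0 w - @gtr l (fun k => xi (- k%:Z) w))%R) < +oo)%E.
Proof.
move=> l0; have := shift_sum shift; pose u l := sqrte (sqmoment P (fun w => X 0 w - @gtr l (fun k => xi (- k%:Z) w))).
move=> uoo; have {}uoo : (\sum_(1 <= l <oo) u l < +oo)%E by [].
have : (u l < +oo)%E.
  apply: le_lt_trans uoo; apply: le_trans (nneseries_lim_ge l.+1 _); last first.
    by move=> n _ _; exact: sqrte_ge0.
  rewrite big_nat_recr//= leeDr//; apply: sume_ge0 => n _; exact: sqrte_ge0.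
by rewrite /u; case: (sqmoment P _) => //= r _; rewrite ltry.
Qed.

Lemma approx_errE l : (0 < l)%N ->
  ((approx_err l)%:E = sqrte (sqmoment P (fun w => (X 0 w - @gtr l (fun k => xi (- k%:Z) w))%R)))%E.
Proof.
move=> l0; rewrite /approx_err fineK//.
have := approx_sqmoment l0; set v := sqmoment P _ => voo.
have v0 : (0 <= v)%E by rewrite /v /sqmoment expectation_ge0// => w; exact: sqr_ge0.
by rewrite sqrte_fin_num// ge0_fin_numE.
Qed.

Lemma rate_summable : exists S, forall M, \sum_(n < M) rate n <= S.
Proof.
have := shift_sum shift; pose u l := sqrte (sqmoment P (fun w => X 0 w - @gtr l (fun k => xi (- k%:Z) w))).
move=> uoo; have {}uoo : (\sum_(1 <= l <oo) u l < +oo)%E by [].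
have u0 n : (0 <= u n)%E by exact: sqrte_ge0.
pose U := fine (\sum_(1 <= l <oo) u l)%E.
have U0 : (0 <= \sum_(1 <= l <oo) u l)%E by exact: nneseries_ge0.
exists (\sum_(n < m.+2) rate n + U) => M.
have mono : \sum_(n < M) rate n <= \sum_(n < m.+2 + M) rate n.
  rewrite -!(big_mkord xpredT rate) [leRHS](@big_cat_nat _ _ _ M)//= ?leq_addl//.
  by rewrite lerDl sumr_ge0// => n _; exact: rate_ge0.
apply: le_trans mono _.
rewrite -!(big_mkord xpredT rate) (@big_cat_nat _ _ _ m.+2)//= ?leq_addr// lerD2l.
rewrite -lee_fin /U fineK ?ge0_fin_numE//.
apply: le_trans (nneseries_lim_ge M.+1 (fun n _ _ => u0 n)).
rewrite -sumEFin -{1}[m.+2]add0n big_addn addKn.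
rewrite -[1%N in leRHS]add0n big_addn subn1/=.
rewrite le_eqVlt; apply/orP; left; apply/eqP; apply: eq_bigr => n _.
rewrite /rate ltnNge leq_addl/= approx_errE; last by lia.
by rewrite /u (_ : n + m.+2 - m.+1 = n + 1)%N//; lia.
Qed.

Lemma X_past (n k : nat) w :
  X (- n%:Z - k%:Z) w = g (fun j => past xi n w (k + j)%N).
Proof.
rewrite (shift_X shift); congr g; apply/funext => j; rewrite /past.
by congr (xi _ w); lia.
Qed.

Lemma nrm_Y_le psi a : lip1 psi -> nrm E (Y psi a 0) <= nrm E (fun w => X 0 w a 0).
Proof.
move=> lp; have sX0 := sq_X 0 a.
have sp : sq E (fun w => psi (X 0 w a 0)) by exact: (@sq_lip psi (fun w => X 0 w a 0)).
have s0 : sq E (fun w => psi (X 0 w a 0) - psi 0) by apply: sqB => //; exact: sq_cst.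
apply: le_trans (_ : nrm E (fun w => psi (X 0 w a 0) - psi 0) <= _).
  have -> : Y psi a 0 = (fun w => (psi (X 0 w a 0) - psi 0) -
      ex E (fun w => psi (X 0 w a 0) - psi 0)).
    apply/funext => w; rewrite /Y exB; [|exact: sq_lf|exact: lf_cst].
    by rewrite ex_cst; ring.
  exact: nrm_center.
apply: nrm_mono => // w; by have := lp.2 (X 0 w a 0) 0; rewrite subr0.
Qed.

(** [psi (X 0)] is replaced by [psi] of its approximation, which is independent
  of the past and so contributes a product of means; the remainder is paid by
  the Cauchy-Schwarz inequality. *)
Lemma decoupling0 psi a (M n : nat) (k : 'I_M -> nat) (h : bfam R d 'I_M -> R) :
  lip1 psi -> measurable_fun setT h ->
  let G w := h (fun i => X (- n%:Z - (k i)%:Z) w) in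
  sq E G -> `|ex E (fun w => Y psi a 0 w * G w)| <= rate n * nrm E G.
Proof.
move=> lp mh G sG; rewrite /rate; case: ltnP => nm.
  apply: le_trans (cauchy_schwarz (sq_Y a 0 lp) sG) _.
  apply: ler_wpM2r; first exact: nrm_ge0.
  apply: le_trans (nrm_Y_le a lp) _.
  rewrite (bigD1 a)//= -addrA lerDl addr_ge0// sumr_ge0// => b _; exact: nrm_ge0.
set l := (n - m.+1)%N; have l0 : (0 < l)%N by rewrite /l; lia.
pose ug (x : bfam R d 'I_l.+1) : R := psi (@gtr l x a 0).
have mug : measurable_fun setT ug by apply: measurableT_comp lp.1 _; exact: measurable_gtr.
pose U w := ug (recent xi l w).
pose D w := X 0 w a 0 - @gtr l (recent xi l w) a 0.
have mU0 b : measurable_fun setT (fun w => @gtr l (recent xi l w) b 0).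
  exact: (measurable_recent measurable_xi (measurable_gtr b 0)).
have [sD nD] : sq E D /\ nrm E D <= approx_err l.
  have := @sqmoment_entry (fun w => X 0 w - @gtr l (fun k => xi (- k%:Z) w)) a _ (approx_sqmoment l0).
  rewrite -approx_errE// lee_fin.
  have -> : (fun w => (X 0 w - @gtr l (fun k => xi (- k%:Z) w)) a 0) = D.
    by apply/funext => w; rewrite !mxE.
  apply => b; under eq_fun do rewrite !mxE.
  by apply: measurable_funB; [exact: measurable_X|exact: mU0].
have mU : measurable_fun setT U by exact: (measurable_recent measurable_xi mug).
have sp : sq E (fun w => psi (X 0 w a 0)).
  by apply: (@sq_lip psi (fun w => X 0 w a 0)) => //; exact: sq_X.
have meD : measurable_fun setT (fun w => psi (X 0 w a 0) - U w).
  by apply: measurable_funB => //; case: sp.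
have leD w : `|psi (X 0 w a 0) - U w| <= `|D w| by exact: lp.2.
have seD : sq E (fun w => psi (X 0 w a 0) - U w).
  split => //; apply: (@lf_dom _ _ E _ (fun w => D w ^+ 2)); [|by case: sD|].
    exact: measurable_funX.
  by move=> w; rewrite normrX -[leRHS]real_normK ?num_real// ler_pXn2r ?nnegrE.
have sU : sq E U by apply: sq_ext (sqB sp seD) _ => w; ring.
have lU := sq_lf sU; have lG := sq_lf sG; have lp' := sq_lf sp.
pose e w := psi (X 0 w a 0) - U w - ex E (fun w => psi (X 0 w a 0) - U w).
have se : sq E e by apply: sqB => //; exact: sq_cst.
have indUG : ex E (fun w => U w * G w) = ex E U * ex E G.
  pose h' (x : bfam R d nat) := h (fun i => g (fun j => x (k i + j)%N)).
  have mh' : measurable_fun setT h'.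
    apply: (measurableT_comp mh); apply: measurable_to_bfam => i b c.
    apply: (measurableT_comp (measurable_g b c)).
    exact: (measurable_reindex (fun j => (k i + j)%N)).
  have GE : G = (fun w => h' (past xi n w)).
    apply/funext => w; rewrite /G /h'; congr h; apply/funext => i.
    by rewrite X_past.
  have lUG : lf E (fun w => U w * G w) by exact: lfM_sq.
  rewrite GE in lG lUG *.
  apply: (recent_past_indep (shift_xi_dep shift) (f := ug) (h := h')) => //.
  by rewrite /l; lia.
have -> : ex E (fun w => Y psi a 0 w * G w) = ex E (fun w => e w * G w).
  have -> : (fun w => Y psi a 0 w * G w) =
      (fun w => e w * G w + (U w * G w - ex E U * G w)).
    by apply/funext => w; rewrite /Y /e exB//; ring.
  have lUG : lf E (fun w => U w * G w) by exact: lfM_sq.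
  have leG : lf E (fun w => e w * G w) by exact: lfM_sq.
  have lcG : lf E (fun w => ex E U * G w) by exact: lfZ.
  rewrite exD//; last exact: lfB.
  by rewrite exB// exZ// indUG subrr addr0.
apply: le_trans (cauchy_schwarz se sG) _; apply: ler_wpM2r; first exact: nrm_ge0.
apply: le_trans (nrm_center seD) _; apply: le_trans nD.
exact: nrm_mono.
Qed.

(** Only [X 0] is known to be close to a function of finitely many of the
  [xi]; stationarity of [X] moves the estimate to any other time. *)
Lemma decoupling psi a (M n : nat) (t : int) (tt : 'I_M -> int)
    (h : bfam R d 'I_M -> R) :
  lip1 psi -> measurable_fun setT h -> (forall i, tt i <= t - n%:Z) ->
  let G w := h (fun i => X (tt i) w) in
  sq E G -> `|ex E (fun w => Y psi a t w * G w)| <= rate n * nrm E G.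
Proof.
move=> lp mh ttn G sG.
pose k i := absz (tt i - (t - n%:Z))%R.
pose G0 w := h (fun i => X (- n%:Z - (k i)%:Z) w).
have G0E : G0 = (fun w => h (fun i => X (tt i - t) w)).
  apply/funext => w; rewrite /G0; congr h; apply/funext => i; congr X.
  by rewrite /k; have := ttn i; lia.
have mh2 : measurable_fun setT (fun x => h x ^+ 2) by exact: measurable_funX.
have sG0 : sq E G0.
  split; first exact: (measurable_of_paths measurable_X _ mh).
  rewrite G0E; apply: (stationary_lf measurable_X (shift_stationary shift) (t := tt) (- t) mh2).
  by case: sG.
have nG : nrm E G = nrm E G0.
  rewrite /nrm G0E; congr Num.sqrt.
  exact: (stationary_ex measurable_X (shift_stationary shift) tt (- t) mh2).
pose th (x : bfam R d 'I_M.+1) : R :=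
  (psi (x ord0 a 0) - ex E (fun w => psi (X 0 w a 0))) * h (fun i => x (lift ord0 i)).
have mth : measurable_fun setT th.
  apply: measurable_funM.
    by apply: measurable_funB => //; apply: measurableT_comp lp.1 _; exact: measurable_coord.
  exact: (measurableT_comp mh (measurable_reindex (lift ord0))).
pose t' (i : 'I_M.+1) := if unlift ord0 i is Some j then tt j else t.
have := stationary_ex measurable_X (shift_stationary shift) t' (- t) mth.
have -> : (fun w => th (fun i => X (t' i) w)) = (fun w => Y psi a t w * G w).
  apply/funext => w; rewrite /th /Y /t' unlift_none; congr (_ * h _).
  by apply/funext => i; rewrite liftK.
have -> : (fun w => th (fun i => X (t' i + - t) w)) = (fun w => Y psi a 0 w * G0 w).
  apply/funext => w; rewrite /th /Y /t' unlift_none subrr G0E; congr (_ * h _).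
  by apply/funext => i; rewrite liftK.
by move=> ->; rewrite nG; exact: decoupling0.
Qed.

Lemma cov_Y psi psi' a a' (t s : int) (n : nat) : lip1 psi -> lip1 psi' ->
  s <= t - n%:Z ->
  `|ex E (fun w => Y psi a t w * Y psi' a' s w)| <= rate n * nrm E (Y psi' a' s).
Proof.
move=> lp lp' st.
have mh : measurable_fun setT (fun x : bfam R d 'I_1 =>
    psi' (x ord0 a' 0) - ex E (fun w => psi' (X 0 w a' 0))).
  by apply: measurable_funB => //; apply: measurableT_comp lp'.1 _; exact: measurable_coord.
by apply: (decoupling a lp mh (tt := fun=> s)) => //; exact: (sq_Y a' s lp').
Qed.

End subordinate.

(** * Law of large numbers for products *)

Section bounded_decouples.
Context {disp : measure_display} {T : measurableType disp} {R : realType}.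
Variables (P : probability T R) (d m : nat).
Variable xi : int -> T -> 'cV[R]_d.
Hypothesis mxi : forall t a b, measurable_fun setT (fun w => xi t w a b).
Hypothesis dep_xi : m_dependent P m xi.
Local Notation E := (prob_op P).

(** The sum is the integer part of [y], written with the indicators of the level
  sets of [y]. *)
Lemma sum_levels (J : nat) (y : R) : 0 <= y < J%:R ->
  `|y - \sum_(j < J) (j.+1%:R <= y)%R%:R| <= 1.
Proof.
move=> /andP[y0 yJ]; have /andP[k1 k2] := truncn_itv y0.
have kJ : (Num.truncn y <= J)%N by rewrite -(ler_nat R) (le_trans k1)// ltW.
have -> : \sum_(j < J) (j.+1%:R <= y)%R%:R = (Num.truncn y)%:R :> R.
  under eq_bigr do rewrite -truncn_ge_nat//.
  by rewrite -natr_sum sum_ord_ltn (minn_idPl kJ).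
by rewrite ger0_norm ?subr_ge0// lerBlDl natr1 ltW.
Qed.

(** A bounded function is a uniform limit of combinations of indicators of its
  level sets. *)
Lemma decouples_bounded (h : bfam R d nat -> R) (C : R) :
  measurable_fun setT h -> (forall x, `|h x| <= C) ->
  decouples P xi (fun w => h (past xi 0 w)).
Proof.
move=> mh hC.
have C0 : 0 < C + 1.
  by rewrite ltr_wpDl// (le_trans (normr_ge0 (h (fun=> 0)))).
have mhp : measurable_fun setT (fun w => h (past xi 0 w)) by exact: measurable_past.
apply: (decouples_lim mxi) => [|e e0]; first exact: bounded_lf mhp (fun w => hC _).
pose D := C + 1.
pose J := (Num.truncn (2 * D / e)).+1.
have J0 : 0 < J%:R :> R by rewrite ltr0n.
pose y (x : bfam R d nat) := (h x + D) / (2 * D) * J%:R.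
have my : measurable_fun setT y.
  apply: measurable_funM => //; apply: measurable_funM => //.
  exact: measurable_funD.
have D0 : 0 < 2 * D by rewrite mulr_gt0.
have yb x : 0 <= y x < J%:R.
  have := hC x; rewrite ler_norml => /andP[h1 h2]; apply/andP; split.
    apply: mulr_ge0; last exact: ltW.
    by apply: divr_ge0; [rewrite /D; lra|exact: ltW].
  rewrite /y gtr_pMl// ltr_pdivrMr// mul1r /D; lra.
pose A j := [set x : bfam R d nat | (j.+1%:R <= y x)%R].
have mA j : measurable (A j).
  rewrite (_ : A j = y @^-1` `[j.+1%:R, +oo[%classic).
    by rewrite -[X in measurable X]setTI; apply: my => //; exact: measurable_itv.
  by apply/seteqP; split => x; rewrite /A/= in_itv/= andbT.
pose ind j w : R := \1_(A j) (past xi 0 w).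
have lind j : lf E (ind j).
  apply: (@bounded_lf _ _ _ _ _ 1).
    exact: (measurable_past mxi 0 (measurable_indic (mA j))).
  by move=> w; rewrite /ind indicE ger0_norm// lern1; case: (_ \in _).
pose f w := - D + 2 * D / J%:R * \sum_(j < J) ind j w.
have lS : lf E (fun w => \sum_(j < J) ind j w) by apply: lf_sum => j _.
exists f; split.
- by apply: lfD; [exact: lf_cst|exact: lfZ].
- apply: (decouplesD mxi); [exact: lf_cst|exact: lfZ|exact: decouples_cst|].
  apply: (decouplesZ mxi) => //.
  by apply: (decouples_sum mxi) => j; [exact: lind|exact: (decouples_event mxi dep_xi)].
rewrite -[leRHS](ex_cst E); apply: ex_le.
- apply: lf_norm; apply: lfB; last by apply: lfD; [exact: lf_cst|exact: lfZ].
  exact: bounded_lf mhp (fun w => hC _).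
- exact: lf_cst.
move=> w; rewrite /f; set x := past xi 0 w.
have -> : h x = - D + 2 * D / J%:R * y x.
  by rewrite /y; field; rewrite (gt_eqF J0) (gt_eqF C0).
set S := \sum_(j < J) _.
have -> : - D + 2 * D / J%:R * y x - (- D + 2 * D / J%:R * S) =
  2 * D / J%:R * (y x - S) by ring.
rewrite normrM ger0_norm; last first.
  by apply: divr_ge0; exact: ltW.
have -> : S = \sum_(j < J) (j.+1%:R <= y x)%R%:R.
  apply: eq_bigr => j _; rewrite /ind indicE; congr ((nat_of_bool _)%:R).
  by apply/idP/idP; rewrite inE.
apply: (@le_trans _ _ (2 * D / J%:R * 1)).
  by apply: ler_wpM2l; [apply: divr_ge0; exact: ltW|exact: sum_levels].
rewrite mulr1 ler_pdivrMr// [leRHS]mulrC -ler_pdivrMr//.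
exact/ltW/truncnS_gt.
Qed.

End bounded_decouples.

Section lln.
Context {disp : measure_display} {T : measurableType disp} {R : realType}.
Variables (P : probability T R) (d m : nat).
Variable xi : int -> T -> 'cV[R]_d.
Variable g : (nat -> 'cV[R]_d) -> 'cV[R]_d.
Variable gtr : forall l : nat, ('I_l.+1 -> 'cV[R]_d) -> 'cV[R]_d.
Variable X : int -> T -> 'cV[R]_d.
Hypothesis shift : mdep_shift P m xi g gtr X.
Local Notation E := (prob_op P).

Variables (phi phi' : R -> R) (C : R) (a a' : 'I_d) (u : nat).
Hypotheses (mphi : measurable_fun setT phi) (mphi' : measurable_fun setT phi').
Hypotheses (phiC : forall x, `|phi x| <= C) (phiC' : forall x, `|phi' x| <= C).

Definition lagprod (t : int) (w : T) : R :=
  phi (X t w a 0) * phi' (X (t - u%:Z) w a' 0).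

Let mX := measurable_X shift.

Lemma lagprod_le t w : `|lagprod t w| <= C * C.
Proof. by rewrite normrM; apply: ler_pM. Qed.

Lemma sq_lagprod t : sq E (lagprod t).
Proof.
apply: bounded_sq (lagprod_le t); apply: measurable_funM.
- by apply: measurableT_comp mphi _; exact: mX.
- by apply: measurableT_comp mphi' _; exact: mX.
Qed.

Let h (x : bfam R d nat) : R := phi (g x a 0) * phi' (g (fun j => x (u + j)%N) a' 0).

Let mh : measurable_fun setT h.
Proof.
apply: measurable_funM.
- by apply: measurableT_comp mphi _; exact: (measurable_g shift).
- apply: measurableT_comp mphi' _.
  apply: (measurableT_comp (measurable_g shift a' 0)).
  exact: measurable_reindex.
Qed.

Let lagprod_past n w : lagprod (- n%:Z) w = h (past xi n w).
Proof.
rewrite /lagprod /h -(X_past shift n u).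
by have := X_past shift n 0 w; rewrite subr0 => ->.
Qed.

Let rho (n : nat) : R := cov P (lagprod 0) (lagprod (- n%:Z)).

Let rho_cvg0 : (fun n => `|rho n|) @ \oo --> (0 : R).
Proof.
have C20 : 0 <= C * C by apply: le_trans (lagprod_le 0 point).
have dh : decouples P xi (lagprod 0).
  have -> : lagprod 0 = (fun w => h (past xi 0 w)).
    by apply/funext => w; rewrite -lagprod_past oppr0.
  apply: (decouples_bounded (measurable_xi shift) (shift_xi_dep shift) (C := C * C)) => // x.
  by rewrite normrM; apply: ler_pM.
apply/cvgrPdist_le => e e0; have C1 : 0 < C * C + 1 by rewrite ltr_wpDl.
have [n0 H0] := dh _ (divr_gt0 e0 C1); exists n0 => // n /= n0n.
rewrite sub0r normrN normr_id.
pose h1 x := h x / (C * C + 1).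
have mh1 : measurable_fun setT h1 by exact: measurable_funM.
have h1le x : `|h1 x| <= 1.
  rewrite normrM normfV (gtr0_norm C1) ler_pdivrMr// mul1r.
  rewrite normrM; apply: le_trans (_ : C * C <= _); last by rewrite lerDl.
  by apply: ler_pM.
have := H0 n h1 n0n mh1 h1le.
rewrite ler_pdivlMr// -[X in _ * X](gtr0_norm C1) -normrM; apply: le_trans.
rewrite le_eqVlt; apply/orP; left; apply/eqP; congr `|_|.
rewrite /rho /cov.
have -> : lagprod (- n%:Z) = (fun w => (C * C + 1) * h1 (past xi n w)).
  by apply/funext => w; rewrite lagprod_past /h1 mulrC divfK// gt_eqF.
have lh1 : lf E (fun w => h1 (past xi n w)).
  exact: (lf_past P (measurable_xi shift) n mh1 h1le).
have lA : lf E (fun w => lagprod 0 w * h1 (past xi n w)).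
  apply: (@lfM_past _ _ _ P _ _ (measurable_xi shift)) => //.
  by apply: sq_lf; exact: sq_lagprod.
under ex_ext do rewrite mulrCA.
by rewrite !exZ//; ring.
Qed.

Lemma ex_lagprod t : ex E (lagprod t) = ex E (lagprod 0).
Proof.
pose tt (i : 'I_2) : int := if i == ord0 then t else t - u%:Z.
pose hh (x : bfam R d 'I_2) : R := phi (x ord0 a 0) * phi' (x ord_max a' 0).
have mhh : measurable_fun setT hh.
  apply: measurable_funM; [apply: measurableT_comp mphi _|apply: measurableT_comp mphi' _];
    exact: measurable_coord.
transitivity (ex E (fun w => hh (fun i => X (tt i) w))); first exact: ex_ext.
rewrite (stationary_ex mX (shift_stationary shift) tt (- t) mhh).
by apply: ex_ext => w; rewrite /hh /tt/= /lagprod addrAC subrr.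
Qed.

Let ex_lagprod2 (t s : int) (n : nat) : t = s + n%:Z ->
  ex E (fun w => lagprod t w * lagprod s w) =
  ex E (fun w => lagprod 0 w * lagprod (- n%:Z) w).
Proof.
move=> ts.
pose tt (i : 'I_4) : int := nth 0 [:: t; t - u%:Z; s; s - u%:Z] i.
pose hh (x : bfam R d 'I_4) : R := phi (x (inord 0) a 0) * phi' (x (inord 1) a' 0) *
  (phi (x (inord 2) a 0) * phi' (x (inord 3) a' 0)).
have mhh : measurable_fun setT hh.
  by apply: measurable_funM; apply: measurable_funM;
    (apply: measurableT_comp mphi _ || apply: measurableT_comp mphi' _);
    exact: measurable_coord.
transitivity (ex E (fun w => hh (fun i => X (tt i) w))).
  by apply: ex_ext => w; rewrite /hh /tt !inordK.
rewrite (stationary_ex mX (shift_stationary shift) tt (- t) mhh).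
apply: ex_ext => w; rewrite /hh /tt !inordK//= /lagprod addrAC subrr ts.
by congr (_ * (phi (X _ w a 0) * phi' (X _ w a' 0))); ring.
Qed.

(** The autocovariances of the products tend to [0], hence so do their Cesaro
  means, and with them the variance of the average. *)
Lemma lln (e : R) : 0 < e -> exists N0, forall N, (N0 <= N)%N -> forall c : int,
  ex E (fun w => `|N%:R^-1 * \sum_(s < N) (lagprod (c + s%:Z) w - ex E (lagprod 0))|) <= e.
Proof.
move=> e0; pose ga := ex E (lagprod 0).
have e2 : 0 < e ^+ 2 / 2 by rewrite divr_gt0// exprn_gt0.
move/cvgrPdist_le: (cesaro rho_cvg0) => /(_ _ e2)[N0 _ HN].
exists N0.+1 => N N0N c; case: N N0N => // N N0N.
pose S := \sum_(k < N.+1) `|rho k|.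
have {}HN : N.+1%:R^-1 * S <= e ^+ 2 / 2.
  have := HN N N0N; rewrite /arithmetic_mean/= sub0r normrN /series/= big_mkord.
  by apply: le_trans; exact: ler_norm.
have N1 : 0 < N.+1%:R :> R by rewrite ltr0n.
have SN : S <= N.+1%:R * (e ^+ 2 / 2).
  by rewrite -ler_pdivrMl.
pose z (s : nat) w := lagprod (c + s%:Z) w - ga.
have sz s : sq E (z s) by apply: sqB; [exact: sq_lagprod|exact: sq_cst].
have en : energy_le E N.+1 z (2 * 1 * S).
  apply: (energy_gram (b := fun n => `|rho n|)) => // s t /andP[st tN].
  rewrite mul1r /rho /cov le_eqVlt; apply/orP; left; apply/eqP; congr `|_|.
  have ts : c + t%:Z = c + s%:Z + (t - s)%N%:Z by lia.
  rewrite -(ex_lagprod2 ts) ex_lagprod -/ga.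
  have l1 := sq_lf (sq_lagprod (c + t%:Z)); have l2 := sq_lf (sq_lagprod (c + s%:Z)).
  have l3 := lfM_sq (sq_lagprod (c + t%:Z)) (sq_lagprod (c + s%:Z)).
  have -> : (fun w => z t w * z s w) = (fun w => lagprod (c + t%:Z) w * lagprod (c + s%:Z) w
      + (- ga * lagprod (c + t%:Z) w + (- ga * lagprod (c + s%:Z) w + ga * ga))).
    by apply/funext => w; rewrite /z; ring.
  have l4 : lf E (fun w => - ga * lagprod (c + t%:Z) w) by exact: lfZ.
  have l5 : lf E (fun w => - ga * lagprod (c + s%:Z) w) by exact: lfZ.
  have l6 := lf_cst E (ga * ga).
  rewrite exD//; last by do !apply: lfD => //.
  rewrite exD//; last exact: lfD.
  by rewrite exD// ex_cst !exZ// !(ex_lagprod (c + _)) -/ga; ring.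
have sS : sq E (fun w => \sum_(s < N.+1) z s w) by apply: sq_sum.
apply: (@le_trans _ _ (N.+1%:R^-1 * nrm E (fun w => \sum_(s < N.+1) z s w))).
  rewrite (_ : ex E _ = N.+1%:R^-1 * ex E (fun w => `|\sum_(s < N.+1) z s w|)); last first.
    rewrite -exZ; last by apply: lf_norm; exact: sq_lf.
    by apply: ex_ext => w; rewrite normrM ger0_norm ?invr_ge0 ?ler0n.
  by apply: ler_wpM2l; [rewrite invr_ge0 ler0n|exact: ex_abs_le].
rewrite ler_pdivrMl//; apply: nrm_le => //; first by rewrite mulr_ge0// ltW.
have := en (fun=> 1) (fun=> _); rewrite normr1 => /(_ (fun=> lexx _)).
under ex_ext do under eq_bigr do rewrite mul1r.
move=> h0; apply: le_trans h0 _.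
by rewrite exprMn mulr1; nra.
Qed.

End lln.

(** * The near-diagonal part *)

(** A row of the near-diagonal form, indexed by the lag [s - t] in place of [t]. *)
Lemma sum_lags (R : realType) (N n s : nat) (ka : R -> R) (f : int -> R) : (s < N)%N ->
  \sum_(t < N) mask (fun z => `|z| < n.+1%:R) ka (s%:R - t%:R) * f t%:Z =
  \sum_(i < n.*2.+1) ka (i%:Z - n%:Z)%:~R *
    (if (0 <= s%:Z - (i%:Z - n%:Z) < N%:Z) then f (s%:Z - (i%:Z - n%:Z)) else 0).
Proof.
move=> sN; pose u (i : 'I_(n.*2.+1)) : int := i%:Z - n%:Z.
transitivity (\sum_(t < N) \sum_(i < n.*2.+1)
    if t%:Z == s%:Z - u i then ka (u i)%:~R * f t%:Z else 0).
  apply: eq_bigr => t _; rewrite /mask; case: ifPn => [st|st].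
    have {}st : (`|s%:Z - t%:Z| < n.+1%:Z)%R.
      by rewrite -(ltr_int R) intr_norm intrB.
    have iN : (absz (s%:Z - t%:Z + n%:Z)%R < n.*2.+1)%N by lia.
    rewrite [RHS](bigD1 (Ordinal iN))//= [X in _ = _ + X]big1 ?addr0 => [|i ii].
      have -> : u (Ordinal iN) = s%:Z - t%:Z by rewrite /u/=; lia.
      have -> : t%:Z == s%:Z - (s%:Z - t%:Z) by apply/eqP; lia.
      by rewrite intrB.
    case: eqP => // e; exfalso; move/eqP: ii; apply; apply/val_inj => /=.
    by move: e; rewrite /u; lia.
  rewrite mul0r big1// => i _; case: eqP => // e; exfalso; move/negP: st; apply.
  rewrite -[s%:R]/(s%:Z%:~R) -[t%:R]/(t%:Z%:~R) -intrB -intr_norm.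
  by rewrite -[n.+1%:R]/(n.+1%:Z%:~R) ltr_int; have := ltn_ord i; move: e; rewrite /u; lia.
rewrite exchange_big/=; apply: eq_bigr => i _; rewrite -/(u i).
case: ifPn => [/andP[h1 h2]|h].
  have tN : (absz (s%:Z - u i)%R < N)%N by lia.
  rewrite [LHS](bigD1 (Ordinal tN))//= [X in _ + X = _]big1 ?addr0 => [|t tt].
    have e : (absz (s%:Z - u i)%R)%:Z = s%:Z - u i by lia.
    by rewrite !e eqxx.
  case: eqP => // e; exfalso; move/eqP: tt; apply; apply/val_inj => /=; lia.
rewrite mulr0 big1// => t _; case: eqP => // e; exfalso; move/negP: h; apply.
by rewrite -e; have := ltn_ord t; lia.
Qed.

(** The edge effect of a lag [u]: only [s] within [n] of an end of the sample
  can have [s - u] outside of it. *)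
Lemma count_out (N n : nat) (u : int) : `|u| <= n%:Z ->
  (\sum_(s < N) ~~ (0 <= s%:Z - u < N%:Z)%R <= n.*2)%N.
Proof.
move=> un.
apply: (@leq_trans (\sum_(s < N) ((s < n) + (N <= s + n))%N)).
  apply: leq_sum => s _; case: (boolP (0 <= s%:Z - u < N%:Z)%R) => //= h.
  have : ((s < n) || (N <= s + n))%N.
    apply/negPn/negP; rewrite negb_or -leqNgt -ltnNge => /andP[h1 h2].
    by move/negP: h; apply; have := ltn_ord s; lia.
  by case: (s < n)%N; case: (N <= s + n)%N.
rewrite big_split/= -addnn; apply: leq_add; first by rewrite sum_ord_ltn geq_minl.
rewrite (reindex_inj rev_ord_inj)/=.
rewrite (eq_bigr (fun s : 'I_N => (s < n)%N : nat)) ?sum_ord_ltn ?geq_minl// => s _.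
by congr nat_of_bool; have := ltn_ord s; lia.
Qed.

Lemma cvgD0 (R : realType) (f g : nat -> R) :
  f @ \oo --> (0 : R) -> g @ \oo --> (0 : R) ->
  (fun n => f n + g n) @ \oo --> (0 : R).
Proof. by move=> cf cg; rewrite -[0 : R]addr0; exact: cvgD. Qed.

Lemma cvgMr0 (R : realType) (f : nat -> R) (c : R) :
  f @ \oo --> (0 : R) -> (fun n => f n * c) @ \oo --> (0 : R).
Proof. by move=> cf; rewrite -(mul0r c); apply: cvgM => //; exact: cvg_cst. Qed.

Lemma cvg_dist0 (R : realType) (f : nat -> R) (l : R) :
  f @ \oo --> l -> (fun n => `|f n - l|) @ \oo --> (0 : R).
Proof.
move=> cf; rewrite -(@normr0 R R) -(subrr l); apply: cvg_norm.
by apply: cvgB => //; exact: cvg_cst.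
Qed.

Lemma cvg_natV (R : realType) : (fun n => n%:R^-1) @ \oo --> (0 : R).
Proof. by rewrite -cvg_shiftS; exact: cvg_harmonic. Qed.

Lemma cvg_sum0 (R : realType) (n : nat) (f : 'I_n -> nat -> R) :
  (forall i, f i @ \oo --> (0 : R)) -> (fun N => \sum_i f i N) @ \oo --> (0 : R).
Proof.
move=> cf; elim: n f cf => [|n IH] f cf.
  under eq_fun do rewrite big_ord0.
  exact: cvg_cst.
under eq_fun do rewrite big_ord_recl.
by apply: cvgD0; [exact: cf|apply: IH => i; exact: cf].
Qed.

(** With finitely many lags, the limit of the form is the sum over the lags of
  the limit of the kernel times that of the sample autocovariance. *)
Lemma near_cvg (R : realType) (T : Type) (E : expectation_op R T)
    (x y : int -> T -> R) (C : R) (ga kinf : int -> R) (ka : nat -> R -> R) (n : nat) :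
  (forall t, sq E (x t)) -> (forall t, sq E (y t)) ->
  (forall t w, `|x t w| <= C) -> (forall t w, `|y t w| <= C) ->
  (forall N z, (0 < N)%N -> `|ka N z| <= 1) ->
  (forall u : int, (fun N => ka N u%:~R) @ \oo --> kinf u) ->
  (forall u : int, (fun N => ex E (fun w => `|N%:R^-1 *
      \sum_(s < N) (x s%:Z w * y (s%:Z - u) w - ga u)|)) @ \oo --> (0 : R)) ->
  (fun N => ex E (fun w => `|qform N (mask (fun z => `|z| < n.+1%:R) (ka N))
      (fun s => x s%:Z) (fun s => y s%:Z) w -
      \sum_(i < n.*2.+1) kinf (i%:Z - n%:Z) * ga (i%:Z - n%:Z)|)) @ \oo --> (0 : R).
Proof.
move=> sx sy xC yC ka1 kacvg lln.
pose u (i : 'I_(n.*2.+1)) : int := i%:Z - n%:Z.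
pose A N i w := N%:R^-1 * \sum_(s < N) (x s%:Z w * y (s%:Z - u i) w - ga (u i)).
have lxy s t : lf E (fun w => x s w * y t w) by exact: lfM_sq.
have lA N i : lf E (A N i).
  by apply: lfZ; apply: lf_sum => s _; apply: lfB => //; exact: lf_cst.
pose bnd N := \sum_i ex E (fun w => `|A N i w|) +
  \sum_i `|ka N (u i)%:~R - kinf (u i)| * `|ga (u i)| +
  N%:R^-1 * (n.*2.+1%:R * (n.*2%:R * (C * C))).
have lq N : lf E (qform N (mask (fun z => `|z| < n.+1%:R) (ka N))
      (fun s => x s%:Z) (fun s => y s%:Z)) by exact: qform_lf.
have qE N w : (0 < N)%N -> `|qform N (mask (fun z => `|z| < n.+1%:R) (ka N))
      (fun s => x s%:Z) (fun s => y s%:Z) w -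
      \sum_i kinf (u i) * ga (u i)| <=
    \sum_i `|A N i w| + (\sum_i `|ka N (u i)%:~R - kinf (u i)| * `|ga (u i)| +
      N%:R^-1 * (n.*2.+1%:R * (n.*2%:R * (C * C)))).
  move=> N0; have N0' : 0 < N%:R :> R by rewrite ltr0n.
  pose o (s : nat) i := ~~ (0 <= s%:Z - u i < N%:Z)%R.
  pose B := N%:R^-1 * \sum_i ka N (u i)%:~R *
    \sum_(s < N) (o s i)%:R * (x s%:Z w * y (s%:Z - u i) w).
  have -> : qform N (mask (fun z => `|z| < n.+1%:R) (ka N))
      (fun s => x s%:Z) (fun s => y s%:Z) w =
      \sum_i ka N (u i)%:~R * (A N i w + ga (u i)) - B.
    rewrite qformE.
    under eq_bigr => s _.
      rewrite (sum_lags n (ka N) (fun t => y t w) (ltn_ord s)) mulr_sumr.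
      over.
    rewrite exchange_big/= mulr_sumr /B [X in _ = _ - X]mulr_sumr -sumrB.
    apply: eq_bigr => i _.
    have -> : A N i w + ga (u i) = N%:R^-1 * \sum_(s < N) (x s%:Z w * y (s%:Z - u i) w).
      by rewrite /A sumrB sum_ord_cst mulrBr mulKf ?gt_eqF// subrK.
    rewrite mulrCA -mulrBr; congr (_ * _); rewrite -mulrBr -sumrB mulr_sumr.
    apply: eq_bigr => s _; rewrite -/(u i) /o; case: ifP => _ /=; ring.
  have -> : \sum_i ka N (u i)%:~R * (A N i w + ga (u i)) - B - \sum_i kinf (u i) * ga (u i) =
    \sum_i ka N (u i)%:~R * A N i w +
    (\sum_i (ka N (u i)%:~R - kinf (u i)) * ga (u i) - B).
    have -> : \sum_i (ka N (u i)%:~R - kinf (u i)) * ga (u i) =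
        \sum_i ka N (u i)%:~R * ga (u i) - \sum_i kinf (u i) * ga (u i).
      by rewrite -sumrB; apply: eq_bigr => i _; ring.
    have -> : \sum_i ka N (u i)%:~R * (A N i w + ga (u i)) =
        \sum_i ka N (u i)%:~R * A N i w + \sum_i ka N (u i)%:~R * ga (u i).
      by rewrite -big_split; apply: eq_bigr => i _ /=; ring.
    ring.
  apply: le_trans (ler_normD _ _) _; apply: lerD.
    apply: le_trans (ler_norm_sum _ _ _) _; apply: ler_sum => i _.
    by rewrite normrM ler_piMl// ka1.
  apply: le_trans (ler_normB _ _) _; apply: lerD.
    apply: le_trans (ler_norm_sum _ _ _) _; apply: ler_sum => i _.
    by rewrite normrM.
  rewrite /B normrM ger0_norm ?invr_ge0 ?ler0n//; apply: ler_wpM2l.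
    by rewrite invr_ge0 ler0n.
  apply: le_trans (ler_norm_sum _ _ _) _.
  rewrite -sum_ord_cst; apply: ler_sum => i _.
  rewrite normrM -[leRHS]mul1r; apply: ler_pM => //; first exact: ka1.
  apply: le_trans (ler_norm_sum _ _ _) _.
  apply: (@le_trans _ _ (\sum_(s < N) (o s i)%:R * (C * C))).
    apply: ler_sum => s _; rewrite normrM ger0_norm ?ler0n//.
    by apply: ler_wpM2l; [exact: ler0n|rewrite normrM; exact: ler_pM].
  rewrite -mulr_suml; apply: ler_wpM2r.
    by apply: mulr_ge0; apply: le_trans (xC 0 w).
  by rewrite -natr_sum ler_nat; apply: count_out; rewrite /u; have := ltn_ord i; lia.
have bnd0 : bnd @ \oo --> (0 : R).
  apply: cvgD0; first apply: cvgD0.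
  - by apply: cvg_sum0 => i; exact: lln.
  - by apply: cvg_sum0 => i; apply: cvgMr0; apply: cvg_dist0; exact: kacvg.
  by apply: cvgMr0; exact: cvg_natV.
apply: (squeeze_cvgr _ (cvg_cst 0) bnd0).
exists 1%N => // M /= M0; apply/andP; split.
  by apply: ex_ge0 => //; apply: lf_norm; apply: lfB => //; exact: lf_cst.
have lAn i : lf E (fun w => `|A M i w|) by exact: lf_norm.
pose c := \sum_i `|ka M (u i)%:~R - kinf (u i)| * `|ga (u i)| +
  M%:R^-1 * (n.*2.+1%:R * (n.*2%:R * (C * C))).
have -> : bnd M = ex E (fun w => \sum_i `|A M i w| + c).
  rewrite exD; [|by apply: lf_sum|exact: lf_cst].
  by rewrite ex_cst ex_sum// /bnd addrA.
apply: ex_le => [||w]; last exact: qE.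
- by apply: lf_norm; apply: lfB => //; exact: lf_cst.
- by apply: lfD; [apply: lf_sum|exact: lf_cst].
Qed.

(** * Truncation *)

Section clip.
Context {R : realType}.

Definition clip (c x : R) : R := Num.max (- c) (Num.min c x).

Definition unclip (c x : R) : R := x - clip c x.

Lemma clipE (c x : R) : 0 <= c ->
  clip c x = if x < - c then - c else if c < x then c else x.
Proof.
move=> c0; rewrite /clip; case: (ltP x (- c)) => h1.
  by rewrite max_l// ge_min (ltW h1) orbT.
by case: (ltP c x) => h2; rewrite max_r//; lra.
Qed.

Lemma clip_le (c x : R) : 0 <= c -> `|clip c x| <= c.
Proof.
move=> c0; rewrite clipE// ler_norml.
by case: ltP => h1; [|case: ltP => h2]; apply/andP; split; lra.
Qed.

Lemma unclip_le (c x : R) : 0 <= c -> `|unclip c x| <= `|x|.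
Proof.
move=> c0; rewrite /unclip clipE//.
rewrite ler_norml; have [x0|x0] := ger0P x; case: ltP => h1; try case: ltP => h2;
  apply/andP; split; lra.
Qed.

Lemma unclip0 (c x : R) : 0 <= c -> `|x| <= c -> unclip c x = 0.
Proof.
move=> c0; rewrite ler_norml /unclip clipE// => /andP[h1 h2].
by rewrite !ltNge h1 h2/= subrr.
Qed.

(** Truncations and their complements are nondecreasing, and so is the identity
  minus either of them; this form reduces the bound to linear cases. *)
Lemma lip1P (psi : R -> R) : (forall x y, x <= y -> 0 <= psi y - psi x <= y - x) ->
  lip1 psi.
Proof.
move=> H; have L x y : `|psi x - psi y| <= `|x - y|.
  wlog xy : x y / y <= x => [h|].
    by have [/h//|/ltW/h] := leP y x; rewrite distrC [leRHS]distrC.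
  by have /andP[h1 h2] := H _ _ xy; rewrite !ger0_norm// subr_ge0.
split => //; apply: continuous_measurable_fun => x.
apply/cvgrPdist_le => e e0; near=> y; apply: le_trans (L x y) _; near: y.
exact: cvgr_dist_le cvg_id _ e0.
Unshelve. all: by end_near. Qed.

Lemma lip1_clip c : 0 <= c -> lip1 (clip c).
Proof.
move=> c0; apply: lip1P => x y xy; rewrite !clipE//.
by do !case: ltP => ?; apply/andP; split; lra.
Qed.

Lemma lip1_unclip c : 0 <= c -> lip1 (unclip c).
Proof.
move=> c0; apply: lip1P => x y xy; rewrite /unclip !clipE//.
by do !case: ltP => ?; apply/andP; split; lra.
Qed.

Lemma lip1_id : lip1 (@id R).
Proof. by apply: lip1P => x y xy; apply/andP; split; rewrite ?subr_ge0. Qed.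

End clip.

(** * Finitely valued maps *)

Section discrete.
Context {disp : measure_display} {S : measurableType disp} {R : realType}.

Definition dmeas (F : finType) (q : S -> F) : Prop :=
  forall v, measurable [set z | q z = v].

Lemma dmeas_cst (F : finType) (v : F) : dmeas (fun=> v).
Proof.
move=> u; have [->|vu] := eqVneq v u.
  by rewrite (_ : [set _ | _] = setT)//; apply/seteqP.
by rewrite (_ : [set _ | _] = set0)//; apply/seteqP; split => // z /= e; rewrite e eqxx in vu.
Qed.

Lemma dmeas_ffun (I V : finType) (q : I -> S -> V) :
  (forall i, dmeas (q i)) -> dmeas (fun z => [ffun i => q i z]).
Proof.
move=> mq v; rewrite (_ : [set _ | _] = \bigcap_(i in [set` enum I]) [set z | q i z = v i]).
  rewrite bigcap_seq; apply: bigsetI_measurable => i _; exact: mq.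
apply/seteqP; split => z /=; first by move=> <- i _ /=; rewrite ffunE.
by move=> h; apply/ffunP => i; rewrite ffunE; apply: h => /=; rewrite mem_enum.
Qed.

Lemma dmeas_pair (V W : finType) (q : S -> V) (r : S -> W) :
  dmeas q -> dmeas r -> dmeas (fun z => (q z, r z)).
Proof.
move=> mq mr [v w]; rewrite (_ : [set _ | _] = [set z | q z = v] `&` [set z | r z = w]).
  by apply: measurableI; [exact: mq|exact: mr].
by apply/seteqP; split => z /= [-> ->].
Qed.

Lemma dmeas_ge (f : S -> R) (c : R) : measurable_fun setT f ->
  dmeas (fun z => c <= f z).
Proof.
move=> mf; have mA : measurable [set z | c <= f z].
  rewrite (_ : [set _ | _] = f @^-1` `[c, +oo[%classic).
    by rewrite -[X in measurable X]setTI; apply: mf => //; exact: measurable_itv.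
  by apply/seteqP; split => x /=; rewrite in_itv/= andbT.
case; first by rewrite (_ : [set _ | _] = [set z | c <= f z]).
rewrite (_ : [set _ | _] = ~` [set z | c <= f z]); first exact: measurableC.
by apply/seteqP; split => z /=; [move=> ->|move/negP/negbTE].
Qed.

Lemma sum_fibers (F : finType) (q : S -> F) (f : F -> R) z :
  f (q z) = \sum_v f v * \1_[set z | q z = v] z.
Proof.
rewrite (bigD1 (q z))//= big1 => [|v vz].
  by rewrite addr0 indicE mem_set ?mulr1.
by rewrite indicE memNset ?mulr0//= => e; rewrite e eqxx in vz.
Qed.

Lemma measurable_dmeas (F : finType) (q : S -> F) (f : F -> R) :
  dmeas q -> measurable_fun setT (fun z => f (q z)).
Proof.
move=> mq; under eq_fun do rewrite sum_fibers.
by apply: measurable_sum => v; apply: measurable_funM.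
Qed.

End discrete.

Section quantizer.
Context {R : realType} (M : nat) (eta B : R).
Hypotheses (eta0 : 0 < eta) (B0 : 0 <= B).

(** The values [(r + B) / eta >= j] for [j = 1, ..., M] determine [r] in
  [[-B, B]] up to [eta]. *)
Definition bits (r : R) : {ffun 'I_M -> bool} :=
  [ffun j : 'I_M => (j.+1%:R <= (r + B) / eta)].

Definition level (v : {ffun 'I_M -> bool}) : R := eta * (\sum_j (v j)%:R) - B.

Hypothesis MB : 2 * B / eta < M%:R.

Lemma level_bits r : `|r| <= B -> `|level (bits r) - r| <= eta.
Proof.
rewrite ler_norml => /andP[h1 h2].
have yb : 0 <= (r + B) / eta < M%:R.
  apply/andP; split; first by apply: divr_ge0; [lra|exact: ltW].
  by apply: le_lt_trans MB; rewrite ler_pM2r ?invr_gt0//; lra.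
have := sum_levels yb; rewrite /level; under [in X in _ -> X]eq_bigr do rewrite ffunE.
set S := \sum_(j < M) _ => hS.
have -> : eta * S - B - r = - (eta * ((r + B) / eta - S)).
  by field; rewrite gt_eqF.
by rewrite normrN normrM gtr0_norm// ger_pMr.
Qed.

Lemma level_le v : (M%:R <= 2 * B / eta + 1) -> eta <= 1 -> `|level v| <= B + 1.
Proof.
move=> MB' eta1; have s0 : 0 <= \sum_j (v j)%:R :> R by apply: sumr_ge0 => j _.
have sM : \sum_j (v j)%:R <= M%:R :> R.
  rewrite -natr_sum ler_nat -[leqRHS](card_ord M) -sum1_card.
  by apply: leq_sum => j _; case: (v j).
have : eta * (\sum_j (v j)%:R) <= 2 * B + eta.
  apply: le_trans (_ : eta * (2 * B / eta + 1) <= _).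
    by rewrite ler_pM2l//; exact: le_trans MB'.
  by rewrite mulrDr mulr1 mulrCA divff ?mulr1// gt_eqF.
rewrite /level ler_norml => h.
have := mulr_ge0 (ltW eta0) s0.
by move=> h'; apply/andP; split; lra.
Qed.

Lemma dmeas_bits {disp} {S : measurableType disp} (f : S -> R) :
  measurable_fun setT f -> dmeas (fun z => bits (f z)).
Proof.
move=> mf; apply: dmeas_ffun => j; apply: dmeas_ge.
by apply: measurable_funM => //; exact: measurable_funD.
Qed.

End quantizer.

Arguments bits {R} M eta B r.
Arguments level {R M} eta B v.

(** * The off-diagonal part for bounded processes *)

Section far.
Context {disp : measure_display} {T : measurableType disp} {R : realType}.
Variables (P : probability T R) (d m : nat).
Variable xi : int -> T -> 'cV[R]_d.
Variable g : (nat -> 'cV[R]_d) -> 'cV[R]_d.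
Variable gtr : forall l : nat, ('I_l.+1 -> 'cV[R]_d) -> 'cV[R]_d.
Variable X : int -> T -> 'cV[R]_d.
Hypothesis shift : mdep_shift P m xi g gtr X.
Local Notation E := (prob_op P).
Local Notation Y := (Y P X).
Local Notation rate := (rate P m xi gtr X).

Let mX := measurable_X shift.

Lemma nrm_Y psi a t : lip1 psi -> nrm E (Y psi a t) = nrm E (Y psi a 0).
Proof.
move=> lp; pose h (x : bfam R d 'I_1) : R :=
  (psi (x ord0 a 0) - ex E (fun w => psi (X 0 w a 0))) ^+ 2.
have mh : measurable_fun setT h.
  apply: measurable_funX; apply: measurable_funB => //.
  by apply: measurableT_comp lp.1 _; exact: measurable_coord.
rewrite /nrm; congr Num.sqrt.
transitivity (ex E (fun w => h (fun=> X t w))); first exact: ex_ext.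
rewrite (stationary_ex mX (shift_stationary shift) (fun=> t) (- t) mh).
by apply: ex_ext => w; rewrite /h subrr.
Qed.

Lemma nrm_Y_rate psi a t : lip1 psi -> nrm E (Y psi a t) <= rate 0.
Proof.
move=> lp; rewrite nrm_Y//; apply: le_trans (nrm_Y_le shift a lp) _.
rewrite /rate/= (bigD1 a)//= -addrA lerDl addr_ge0// sumr_ge0// => b _.
exact: nrm_ge0.
Qed.

(** The rates are summable, so the energy of [Y] is finite, and proportional to
  its norm: it is small for the complement of a truncation. *)
Lemma Y_energy psi a N S : lip1 psi -> \sum_(n < N) rate n <= S ->
  energy_le E N (fun s => Y psi a s.+1%:Z) (2 * nrm E (Y psi a 0) * S).
Proof.
move=> lp bS; apply: energy_gram bS _ => [s||n|s t /andP[st tN]].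
- exact: (sq_Y shift).
- exact: nrm_ge0.
- exact: rate_ge0.
rewrite mulrC -(nrm_Y a s.+1%:Z lp); apply: (cov_Y shift) => //; lia.
Qed.

Section bounded.
Variables (psi : R -> R) (c : R) (a b : 'I_d) (N : nat).
Hypotheses (lpsi : lip1 psi) (psic : forall x, `|psi x| <= c) (N0 : (0 < N)%N).

Let B := 2 * c.
(* The form has [N ^ 2] terms, each moved by about [eta], and a factor [1 / N]:
   this step makes the total error of quantisation of order [1 / N]. *)
Let eta : R := (N%:R ^+ 2)^-1.
Let M := (Num.truncn (2 * B / eta)).+1.
Let V : finType := ({ffun 'I_M -> bool} * {ffun 'I_M -> bool})%type.
Local Notation F := {ffun 'I_N -> V}.

Let c0 : 0 <= c := le_trans (normr_ge0 (psi 0)) (psic 0).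
Let B0 : 0 <= B. Proof. by rewrite mulr_ge0. Qed.
Let N0' : 0 < N%:R :> R. Proof. by rewrite ltr0n. Qed.
Let eta0 : 0 < eta. Proof. by rewrite invr_gt0 exprn_gt0. Qed.
Let eta1 : eta <= 1.
Proof. by rewrite invf_le1 ?exprn_gt0// exprn_ege1// ler1n. Qed.
Let MB : 2 * B / eta < M%:R. Proof. exact: truncnS_gt. Qed.
Let MB' : M%:R <= 2 * B / eta + 1.
Proof.
rewrite /M -natr1 lerD2r; have h : 0 <= 2 * B / eta by rewrite divr_ge0 ?mulr_ge0// ltW.
by have /andP[] := truncn_itv h.
Qed.

Let mpsi := lpsi.1.
Let mean_psi (e : 'I_d) := ex E (fun w => psi (X 0 w e 0)).

Lemma Y_bounded e t w : `|Y psi e t w| <= B.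
Proof.
rewrite /Y /B; apply: le_trans (ler_normB _ _) _.
have -> : 2 * c = c + c by ring.
apply: lerD => //.
have mp : measurable_fun setT (fun w => psi (X 0 w e 0)).
  by apply: measurableT_comp mpsi _; exact: mX.
have lp : lf E (fun w => psi (X 0 w e 0)) by exact: bounded_lf mp (fun w => psic _).
apply: le_trans (ler_norm_ex lp) _; rewrite -[leRHS](ex_cst E).
by apply: ex_le => //; [exact: lf_norm|exact: lf_cst].
Qed.

(** The quantised sample, of which only the first [k] values are kept: a
  function of the first [k] coordinates of a path in [F] is then a function of
  the first [k] values of [X]. *)
Let enc (k : nat) (z : bfam R d 'I_k) : F :=
  [ffun s : 'I_N => if (insub (s : nat) : option 'I_k) is Some i
    then (bits M eta B (psi (z i a 0) - mean_psi a), bits M eta B (psi (z i b 0) - mean_psi b))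
    else ([ffun=> false], [ffun=> false])].

Let full (w : T) : F := enc (fun i : 'I_N => X i.+1%:Z w).

Let dmeas_enc k : dmeas (@enc k).
Proof.
apply: dmeas_ffun => s; case: (insub (s : nat) : option 'I_k) => [i|]; last exact: dmeas_cst.
have mp e : measurable_fun setT (fun z : bfam R d 'I_k => psi (z i e 0) - mean_psi e).
  by apply: measurable_funB => //; apply: measurableT_comp mpsi _; exact: measurable_coord.
by apply: dmeas_pair; exact: dmeas_bits.
Qed.

Let m_full v : measurable [set w | full w = v].
Proof.
have := measurable_paths mX (fun i : 'I_N => i.+1%:Z) measurableT (dmeas_enc v).
by rewrite setTI.
Qed.

Let p (v : F) : R := fine (P [set w | full w = v]).

Let ex_full (f : F -> R) : ex E (fun w => f (full w)) = \sum_v p v * f v.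
Proof.
under ex_ext do rewrite sum_fibers.
have li v : lf E (\1_[set w | full w = v]).
  apply: (@bounded_lf _ _ _ _ _ 1) => [|w]; first exact: measurable_indic.
  by rewrite indicE ger0_norm// lern1; case: (_ \in _).
rewrite ex_sum => [|v _]; last exact: lfZ.
by apply: eq_bigr => v _; rewrite exZ// ex_indic// mulrC.
Qed.

Let p0 v : 0 <= p v. Proof. exact: fine_ge0. Qed.

Let p1 : \sum_v p v = 1.
Proof.
rewrite -[RHS](ex_cst E) (ex_full (fun=> 1)).
by apply: eq_bigr => v _; rewrite mulr1.
Qed.

Local Notation Ef := (fin_op p0 p1).

Let exE (f : F -> R) : ex Ef f = ex E (fun w => f (full w)).
Proof. by rewrite ex_full. Qed.

Let m_of_full (f : F -> R) : measurable_fun setT (fun w => f (full w)).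
Proof. exact: (measurable_dmeas f m_full). Qed.

Let lev (pr : V -> {ffun 'I_M -> bool}) (s : nat) (v : F) : R :=
  if (insub s : option 'I_N) is Some i then level eta B (pr (v i)) else 0.

Let levE pr e s w : (s < N)%N ->
  (forall u : 'cV[R]_d, pr (bits M eta B (psi (u a 0) - mean_psi a),
    bits M eta B (psi (u b 0) - mean_psi b)) = bits M eta B (psi (u e 0) - mean_psi e)) ->
  `|Y psi e s.+1%:Z w - lev pr s (full w)| <= eta.
Proof.
move=> sN pre; rewrite /lev insubT/= /full /enc ffunE/= insubT/=.
rewrite (pre (X s.+1%:Z w)) distrC; apply: level_bits => //.
exact: (Y_bounded e s.+1%:Z w).
Qed.

Let lev_le pr s v : `|lev pr s v| <= B + 1.
Proof.
rewrite /lev; case: insubP => [i _ _|_]; first exact: level_le.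
by rewrite normr0 addr_ge0.
Qed.

Let dep_lev pr s : dep s.+1 (lev pr s).
Proof.
move=> u v /forallP uv; rewrite /lev; case: insubP => [i _ si|//].
by have := uv i; rewrite si ltnS leqnn/= => /eqP ->.
Qed.

Let dep_full (k : nat) (f : F -> R) w : (k <= N)%N -> dep k f ->
  f (full w) = f (enc (fun i : 'I_k => X i.+1%:Z w)).
Proof.
move=> kN; apply; apply/forallP => s; apply/implyP => sk.
by rewrite /full /enc !ffunE !insubT//= => ?.
Qed.

Let lev_decoupling pr e t j f : (t < N)%N ->
  (forall u : 'cV[R]_d, pr (bits M eta B (psi (u a 0) - mean_psi a),
    bits M eta B (psi (u b 0) - mean_psi b)) = bits M eta B (psi (u e 0) - mean_psi e)) ->
  dep (t.+1 - j) f ->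
  `|ex Ef (fun v => lev pr t v * f v)| <= (rate j + eta) * nrm Ef f.
Proof.
move=> tN pre df; set k := (t.+1 - j)%N in df.
have kN : (k <= N)%N by rewrite /k; lia.
pose G w := f (full w).
have sG : sq E G.
  split; first exact: m_of_full.
  apply: (@bounded_lf _ _ _ _ _ (\sum_v f v ^+ 2)); first exact: (m_of_full (fun v => f v ^+ 2)).
  move=> w; rewrite ger0_norm ?sqr_ge0// /G (bigD1 (full w))//= lerDl sumr_ge0// => v _.
  exact: sqr_ge0.
have nG : nrm Ef f = nrm E G by rewrite /nrm exE.
have sL : sq E (fun w => lev pr t (full w)).
  apply: (@bounded_sq _ _ _ _ _ (B + 1)) => [|w]; last exact: lev_le.
  exact: (m_of_full (lev pr t)).
have sYt : sq E (Y psi e t.+1%:Z) by exact: (sq_Y shift).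
rewrite exE nG.
have -> : (fun w => lev pr t (full w) * f (full w)) =
    (fun w => Y psi e t.+1%:Z w * G w - (Y psi e t.+1%:Z w - lev pr t (full w)) * G w).
  by apply/funext => w; rewrite /G; ring.
have l1 : lf E (fun w => Y psi e t.+1%:Z w * G w) by exact: lfM_sq.
have sD : sq E (fun w => Y psi e t.+1%:Z w - lev pr t (full w)) by exact: sqB.
have l2 : lf E (fun w => (Y psi e t.+1%:Z w - lev pr t (full w)) * G w) by exact: lfM_sq.
rewrite exB// mulrDl; apply: le_trans (ler_normB _ _) _; apply: lerD.
  have GE : G = (fun w => f (enc (fun i : 'I_k => X i.+1%:Z w))).
    by apply/funext => w; exact: dep_full.
  rewrite GE in sG *.
  apply: (decoupling shift e (h := fun z => f (enc z)) lpsi _ _ sG).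
    exact: measurable_dmeas.
  by move=> i; have := ltn_ord i; rewrite /k; lia.
apply: le_trans (ler_norm_ex l2) _.
apply: (@le_trans _ _ (ex E (fun w => eta * `|G w|))).
  apply: ex_le; [exact: lf_norm|by apply: lfZ; apply: lf_norm; exact: sq_lf|].
  by move=> w; rewrite normrM; apply: ler_wpM2r => //; exact: levE.
rewrite exZ; last by apply: lf_norm; exact: sq_lf.
by apply: ler_wpM2l; [exact: ltW|exact: ex_abs_le].
Qed.

Let qform_quant (ka : R -> R) w : (forall z, `|ka z| <= 1) ->
  `|qform N ka (fun s => Y psi a s.+1%:Z) (fun s => Y psi b s.+1%:Z) w -
    qform N ka (lev fst) (lev snd) (full w)| <= (2 * B + 1) / N%:R.
Proof.
move=> ka1; rewrite /qform -mulrBr normrM ger0_norm ?invr_ge0 ?ler0n//.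
rewrite [leRHS]mulrC; apply: ler_wpM2l; first by rewrite invr_ge0 ler0n.
apply: (@le_trans _ _ (\sum_(s < N) \sum_(t < N) (2 * B + 1) * eta)); last first.
  rewrite !sum_ord_cst /eta expr2 invfM.
  have -> : N%:R * (N%:R * ((2 * B + 1) * (N%:R^-1 / N%:R))) = 2 * B + 1 :> R.
    by field; rewrite gt_eqF.
  exact: lexx.
rewrite -sumrB; apply: le_trans (ler_norm_sum _ _ _) _; apply: ler_sum => s _.
rewrite -sumrB; apply: le_trans (ler_norm_sum _ _ _) _; apply: ler_sum => t _.
rewrite -mulrBr normrM -[leRHS]mul1r; apply: ler_pM => //.
set x := Y psi a _ _; set y := Y psi b _ _; set x' := lev _ _ _; set y' := lev _ _ _.
have -> : x * y - x' * y' = x * (y - y') + y' * (x - x') by ring.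
have -> : (2 * B + 1) * eta = B * eta + (B + 1) * eta by ring.
apply: le_trans (ler_normD _ _) _; apply: lerD; rewrite normrM; apply: ler_pM => //.
- exact: Y_bounded.
- exact: (levE (e := b) w (ltn_ord t) (fun=> erefl)).
- exact: lev_le.
- exact: (levE (e := a) w (ltn_ord s) (fun=> erefl)).
Qed.

(** Quantisation makes the law of the sample a weight on a finite set, where
  conditional expectations are finite averages. The quantised process decouples
  at the rate [rate j + eta]. *)
Lemma far_prob (n r : nat) (k lam : 'I_n -> R) (th S K2 bb : R) :
  (0 < r)%N -> (n <= N)%N ->
  (forall i j : 'I_n, lam i - lam j = 2 * pi * (i%:R - j%:R) / N%:R) ->
  (forall i, 0 <= k i) -> \sum_i k i = 1 ->
  (forall M, \sum_(m < M) rate m <= S) -> rate r <= rate 0 ->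
  K2 = \sum_i k i ^+ 2 -> bb = (rate 0 + N%:R^-1) * (rate r + N%:R^-1) ->
  ex E (fun w => `|qform N (kern k lam th) (fun s => Y psi a s.+1%:Z)
        (fun s => Y psi b s.+1%:Z) w -
      qform N (mask (fun z => `|z| < r%:R) (kern k lam th))
        (fun s => Y psi a s.+1%:Z) (fun s => Y psi b s.+1%:Z) w|) <=
  2 * (r%:R * (2 * (B + 1) * Num.sqrt (K2 * (2 * (r%:R * (4 * (B + 1) ^+ 2))))))
  + 3 * (4 * (S + 1) * Num.sqrt bb + 2 * r%:R * bb)
  + 2 * ((2 * B + 1) / N%:R).
Proof.
move=> r0 nN Hlam k0 k1 bS br -> bbE.
have S0 : 0 <= S by have := bS 0%N; rewrite big_ord0.
have etaN : eta <= N%:R^-1.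
  by rewrite /eta lef_pV2 ?posrE ?exprn_gt0// expr2 ler_peMr ?ler0n// ler1n.
pose bt j := rate j + eta.
have bt0 j : 0 <= bt j by rewrite addr_ge0 ?rate_ge0// ltW.
have btS : \sum_(j < N) bt j <= S + 1.
  rewrite big_split/=; apply: lerD; first exact: bS.
  rewrite sum_ord_cst.
  by apply: le_trans (ler_wpM2l (ler0n _ _) etaN) _; rewrite divff// gt_eqF.
have btr : bt r <= bt 0%N by rewrite lerD2r.
have B1 : 0 <= B + 1 by rewrite addr_ge0.
set ka := kern k lam th; set near := mask _ _.
have ka1 z : `|ka z| <= 1 by exact: kern_le1.
have near1 z : `|near z| <= 1.
  by rewrite /near /mask; case: ifP => // _; rewrite normr0.
have H := @far_le R V N p p0 p1 n r k lam th (B + 1) (S + 1) bt (lev fst) (lev snd) r0 nN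
  Hlam k0 k1 B1 (lev_le fst) (lev_le snd) (dep_lev fst) (dep_lev snd) bt0 btS btr.
have {}H := H (fun t j f tN => lev_decoupling (e := a) tN (fun=> erefl)).
have {}H := H (fun t j f tN => lev_decoupling (e := b) tN (fun=> erefl)).
set x := (fun s => Y psi a s.+1%:Z); set y := (fun s => Y psi b s.+1%:Z).
have sx s : sq E (x s) by exact: (sq_Y shift).
have sy s : sq E (y s) by exact: (sq_Y shift).
pose D (v : F) := `|qform N ka (lev fst) (lev snd) v - qform N near (lev fst) (lev snd) v|.
have lD : lf E (fun w => D (full w)).
  apply: (@bounded_lf _ _ _ _ _ (\sum_v D v)); first exact: m_of_full.
  move=> w; rewrite /D normr_id (bigD1 (full w))//= lerDl sumr_ge0//.
apply: (@le_trans _ _ (ex E (fun w => D (full w) + 2 * ((2 * B + 1) / N%:R)))).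
  apply: ex_le => [||w].
  - by apply: lf_norm; apply: lfB; exact: qform_lf.
  - by apply: lfD => //; exact: lf_cst.
  have q1 := qform_quant w ka1; have q2 := qform_quant w near1.
  set u1 := qform N ka x y w in q1 *; set u2 := qform N near x y w in q2 *.
  rewrite /D; set v1 := qform N ka _ _ _ in q1 *; set v2 := qform N near _ _ _ in q2 *.
  have -> : u1 - u2 = (v1 - v2) + ((u1 - v1) - (u2 - v2)) by ring.
  apply: le_trans (ler_normD _ _) _; rewrite lerD2l mulr_natl mulr2n.
  by apply: le_trans (ler_normB _ _) _; apply: lerD.
rewrite exD ?ex_cst//; last exact: lf_cst.
rewrite lerD2r -exE; apply: le_trans H _; rewrite lerD2l ler_pM2l//.
have hbb : bt 0%N * bt r <= bb.
  rewrite bbE.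
  by apply: ler_pM => //; rewrite lerD2l.
apply: lerD; last by apply: ler_wpM2l => //; rewrite mulr_ge0.
by apply: ler_wpM2l; [rewrite mulr_ge0// addr_ge0|exact: ler_wsqrtr].
Qed.

End bounded.
End far.

(** * Limits *)

(** Limsup argument: for each [e] the sequence is eventually below one whose
  limit is at most [e]. *)
Lemma cvg0_approx (R : realType) (u : nat -> R) :
  (forall N, 0 <= u N) ->
  (forall e, 0 < e -> exists (v : nat -> R) (l : R),
    [/\ l <= e, v @ \oo --> l & \forall N \near \oo, u N <= v N]) ->
  u @ \oo --> (0 : R).
Proof.
move=> u0 H; apply/cvgrPdist_le => e e0.
have [v [l [le vl uv]]] := H _ (divr_gt0 e0 (ltr0n R 2)).
have /cvgrPdist_le/(_ _ (divr_gt0 e0 (ltr0n R 2))) vl2 := vl.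
near=> N; rewrite sub0r normrN ger0_norm//.
have h1 : u N <= v N by near: N.
have h2 : `|l - v N| <= e / 2 by near: N.
move: h2; rewrite ler_norml => /andP[h2 h3]; lra.
Unshelve. all: by end_near. Qed.

(** If [n * b n] stayed away from [0] the series of [b] would dominate a
  multiple of the harmonic series. *)
Lemma summable_small (R : realType) (b : nat -> R) (S e : R) (n1 : nat) :
  (forall n, 0 <= b n) -> (forall M, \sum_(n < M) b n <= S) -> 0 < e ->
  exists2 n, (n1 <= n)%N & n.+1%:R * b n.+1 <= e.
Proof.
move=> b0 bS e0; apply: contrapT => H.
have Hb n : (n1 <= n)%N -> harmonic n <= b n.+1 / e.
  move=> n1n; rewrite ler_pdivlMr// /harmonic/= mulrC ler_pdivrMr ?ltr0n//.
  rewrite leNgt; apply/negP => h; apply: H; exists n => //.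
  by rewrite mulrC ltW.
apply: (@dvg_harmonic R); apply: nondecreasing_is_cvgn.
  by apply: nondecreasing_series => n _ _; exact: harmonic_ge0.
exists (\sum_(n < n1) harmonic n + S / e) => _ [M _ <-].
apply: (@le_trans _ _ (series harmonic (n1 + M))).
  by apply: nondecreasing_series => [n _ _|]; [exact: harmonic_ge0|rewrite leq_addl].
rewrite /series/= (@big_cat_nat _ _ _ n1)//= ?leq_addr// big_mkord lerD2l.
apply: (@le_trans _ _ (\sum_(n1 <= n < n1 + M) b n.+1 / e)).
  by rewrite big_nat_cond [leRHS]big_nat_cond; apply: ler_sum => n /andP[/andP[? _] _]; exact: Hb.
rewrite -mulr_suml ler_pM2r ?invr_gt0//; apply: le_trans (bS (n1 + M).+1).
rewrite -(big_mkord xpredT b) big_nat_recl//= -[leLHS]add0r; apply: lerD => //.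
rewrite [leRHS](@big_cat_nat _ _ _ n1)//= ?leq_addr// lerDr.
exact: sumr_ge0.
Qed.

Lemma sumZ_partialS (R : realType) (f : int -> R) n :
  \sum_(i < n.+1.*2.+1) f (i%:Z - n.+1%:Z) =
  \sum_(i < n.*2.+1) f (i%:Z - n%:Z) + (f n.+1%:Z + f (- n.+1%:Z)).
Proof.
rewrite doubleS big_ord_recl big_ord_recr/= /bump/=.
rewrite (eq_bigr (fun i : 'I_(n.*2.+1) => f (i%:Z - n%:Z))) => [|i _]; last first.
  by congr f; lia.
rewrite [LHS]addrC -[LHS]addrA; congr (_ + (f _ + f _)); lia.
Qed.

Lemma sumZ_cvg (R : realType) (f : int -> R) (b : nat -> R) (S : R) :
  (forall u, `|f u| <= b (absz u)) -> (forall M, \sum_(n < M) b n <= S) ->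
  (fun n : nat => \sum_(i < n.*2.+1) f (i%:Z - n%:Z)) @ \oo --> sumZ f.
Proof.
move=> fb bS; have b0 n : 0 <= b n by apply: le_trans (normr_ge0 _) (fb n%:Z).
pose v n := if n is n'.+1 then f n%:Z + f (- n%:Z) else f 0.
have sE (n : nat) : \sum_(i < n.*2.+1) f (i%:Z - n%:Z) = series v n.+1.
  rewrite /series/= big_mkord.
  elim: n => [|n IH]; first by rewrite !big_ord1.
  by rewrite sumZ_partialS IH [RHS]big_ord_recr.
have cb : cvgn (series (fun n => 2 * b n)).
  apply: nondecreasing_is_cvgn.
    by apply: nondecreasing_series => n _ _; rewrite mulr_ge0.
  exists (2 * S) => _ [M _ <-]; rewrite /series/= -mulr_sumr big_mkord.
  by apply: ler_wpM2l.
have cv : cvgn (series v).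
  apply: normed_cvg; apply: (series_le_cvg _ _ _ cb) => [n|n|n].
  - exact: normr_ge0.
  - exact: mulr_ge0.
  case: n => [|n] /=; first by apply: le_trans (fb 0) _; have := b0 0%N; lra.
  apply: le_trans (ler_normD _ _) _.
  have := fb n.+1%:Z; have := fb (- n.+1%:Z); rewrite abszN absz_nat; lra.
rewrite /sumZ (_ : (fun n : nat => _) = (fun n => series v n.+1)); last first.
  by apply/funext => n; exact: sE.
have : (fun n => series v n.+1) @ \oo --> limn (series v) by rewrite cvg_shiftS.
by move=> h; rewrite (cvg_lim _ h).
Qed.

(** The window shrinks to the point [om], so that the kernel tends to a single
  cosine. *)
Lemma kern_cvg (R : realType) (n : nat -> nat) (k lam : forall N, 'I_(n N) -> R)
    (om th u : R) (dl : nat -> R) :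
  (forall N i, (0 < N)%N -> 0 <= k N i) -> (forall N, (0 < N)%N -> \sum_i k N i = 1) ->
  (forall N i, (0 < N)%N -> `|lam N i - om| <= dl N) -> dl @ \oo --> (0 : R) ->
  (fun N => kern (k N) (lam N) th u) @ \oo --> cos (u * om + th).
Proof.
move=> k0 k1 lamd dl0; apply/cvgrPdist_le => e e0.
have := @continuous_cos R (u * om + th); move/cvgrPdist_le/(_ _ e0).
case=> d /= d0 H; have u1 : 0 < `|u| + 1 by rewrite ltr_wpDl.
move/cvgrPdist_lt: dl0 => /(_ _ (divr_gt0 d0 u1)) dl0.
near=> N; have N0 : (0 < N)%N by near: N; exists 1%N.
have dN : `|dl N| < d / (`|u| + 1) by rewrite -normrN -sub0r; near: N.
have -> : cos (u * om + th) = \sum_i k N i * cos (u * om + th).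
  by rewrite -mulr_suml k1// mul1r.
rewrite /kern -sumrB; apply: le_trans (ler_norm_sum _ _ _) _.
rewrite -[leRHS]mul1r -(k1 N N0) mulr_suml; apply: ler_sum => i _.
rewrite -mulrBr normrM ger0_norm ?k0//; apply: ler_wpM2l; first exact: k0.
apply: H => /=.
have -> : u * om + th - (u * lam N i + th) = - (u * (lam N i - om)) by ring.
rewrite normrN normrM; apply: (@le_lt_trans _ _ (`|u| * `|dl N|)).
  by apply: ler_wpM2l => //; apply: le_trans (lamd N i N0) (ler_norm _).
move: dN; rewrite ltr_pdivlMr//; apply: le_lt_trans.
by rewrite mulrDr mulr1 mulrC lerDl.
Unshelve. all: by end_near. Qed.

Lemma cvg_sqrt (R : realType) (f : nat -> R) (l : R) :
  f @ \oo --> l -> (fun n => Num.sqrt (f n)) @ \oo --> Num.sqrt l.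
Proof.
move=> fl.
exact: (@continuous_cvg _ _ _ _ _ f (@Num.sqrt R) l (@sqrt_continuous R l) fl).
Qed.

Section unclip_limit.
Context {disp : measure_display} {T : measurableType disp} {R : realType}.
Variable P : probability T R.
Local Notation E := (prob_op P).

(** Dominated convergence: the truncation at level [n] is eventually exact at
  each point. *)
Lemma unclip_cvg (f : T -> R) : sq E f ->
  (fun n => nrm E (fun w => unclip n%:R (f w))) @ \oo --> (0 : R).
Proof.
move=> sf; have [mf lf2] := sf.
have lip n : lip1 (@unclip R n%:R) by exact: lip1_unclip.
have mu n : measurable_fun setT (fun w => unclip n%:R (f w)).
  by apply: measurableT_comp (lip n).1 _.
rewrite /nrm -(@sqrtr0 R); apply: cvg_sqrt.
pose F n w : \bar R := (unclip n%:R (f w) ^+ 2)%:E.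
have c0 : (fun n => \int[P]_w F n w)%E @ \oo --> (\int[P]_w (cst 0 w))%E.
  apply: (@dominated_cvg _ _ _ P setT measurableT F (cst 0) (fun w => (f w ^+ 2)%:E)).
  - by move=> n; apply/measurable_EFinP; exact: measurable_funX.
  - move=> w _; apply: cvg_near_cst.
    have [n0 Hn0] : exists n0 : nat, `|f w| <= n0%:R.
      by exists (Num.truncn `|f w|).+1; exact/ltW/truncnS_gt.
    exists n0 => // n /= n0n; rewrite /F unclip0 ?expr0n//.
    by apply: le_trans Hn0 _; rewrite ler_nat.
  - by [].
  - exact: lf2.
  - move=> n w _; rewrite /F/= lee_fin ger0_norm ?sqr_ge0//.
    rewrite -[leLHS]real_normK ?num_real// -[leRHS]real_normK ?num_real//.
    by rewrite ler_pXn2r ?nnegrE// unclip_le.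
rewrite integral0 in c0.
have -> : (fun n => ex E (fun w => unclip n%:R (f w) ^+ 2)) =
    fine \o (fun n => \int[P]_w F n w)%E.
  by apply/funext => n; rewrite prob_exE unlock.
exact: fine_cvg.
Qed.

End unclip_limit.

(** * The smoothed periodogram of a centered process *)

Section main.
Context {disp : measure_display} {T : measurableType disp} {R : realType}.
Variables (P : probability T R) (d m : nat).
Variable xi : int -> T -> 'cV[R]_d.
Variable g : (nat -> 'cV[R]_d) -> 'cV[R]_d.
Variable gtr : forall l : nat, ('I_l.+1 -> 'cV[R]_d) -> 'cV[R]_d.
Variable X : int -> T -> 'cV[R]_d.
Hypothesis shift : mdep_shift P m xi g gtr X.
Variables (h : nat -> nat) (K : nat -> int -> R).
Hypothesis hK : weight_functions h K.
Local Notation E := (prob_op P).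
Local Notation Y := (Y P X).
Local Notation rate := (rate P m xi gtr X).

Definition window_weight N (i : 'I_((h N).*2.+1)) : R := K N (i%:Z - (h N)%:Z).

Definition window_freq N (om : R) (i : 'I_((h N).*2.+1)) : R :=
  om + fourier_freq R N (i%:Z - (h N)%:Z).

Lemma window_weight_ge0 N i : (0 < N)%N -> 0 <= @window_weight N i.
Proof. by move=> N0; exact: (weight_ge0 hK). Qed.

Lemma window_weight_sum N : (0 < N)%N -> \sum_i @window_weight N i = 1.
Proof. by move=> N0; exact: (weight_sum hK). Qed.

Lemma window_sq_cvg : (fun N => \sum_i @window_weight N i ^+ 2) @ \oo --> (0 : R).
Proof. exact: (weight_sq hK). Qed.

Lemma window_narrow : \forall N \near \oo, ((h N).*2.+1 <= N)%N.
Proof.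
have /cvgrPdist_le/(_ (1/3)) := weight_h_small hK.
have h3 : 0 < 1/3 :> R by lra.
move=> /(_ h3) H; near=> N.
have N0 : (0 < N)%N by near: N; exists 1%N.
have hN := weight_h_gt0 hK N0.
have : `|0 - (h N)%:R / Num.sqrt N%:R| <= 1 / 3 :> R by near: N.
have sN : 0 < Num.sqrt N%:R :> R by rewrite sqrtr_gt0 ltr0n.
rewrite sub0r normrN ger0_norm; last by rewrite divr_ge0// ltW.
rewrite ler_pdivrMr// => hs.
have s1 : Num.sqrt N%:R <= N%:R :> R.
  rewrite -[leRHS]sqr_sqrtr ?ler0n// expr2 ler_peMl ?sqrtr_ge0//.
  by rewrite -[leLHS]sqrtr1; apply: ler_wsqrtr; rewrite ler1n.
suff : (3 * h N <= N)%N by lia.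
by rewrite -(ler_nat R) natrM; lra.
Unshelve. all: by end_near. Qed.

Lemma window_width_cvg : (fun N => (h N)%:R / N%:R) @ \oo --> (0 : R).
Proof.
apply: (squeeze_cvgr _ (cvg_cst 0) (weight_h_small hK)).
near=> N; have N0 : (0 < N)%N by near: N; exists 1%N.
rewrite divr_ge0//= ler_wpM2l// lef_pV2 ?posrE ?ltr0n ?sqrtr_gt0 ?ltr0n//.
rewrite -[leRHS]sqr_sqrtr ?ler0n// expr2 ler_peMl ?sqrtr_ge0//.
by rewrite -[leLHS]sqrtr1; apply: ler_wsqrtr; rewrite ler1n.
Unshelve. all: by end_near. Qed.

Lemma window_freqB N om i j : (0 < N)%N -> @window_freq N om i - @window_freq N om j =
  2 * pi * (i%:R - j%:R) / N%:R.
Proof.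
move=> N0; rewrite /window_freq /fourier_freq !intrB.
by field; rewrite pnatr_eq0; lia.
Qed.

Lemma window_freq_dist N om i : (0 < N)%N ->
  `|@window_freq N om i - om| <= 2 * pi * ((h N)%:R / N%:R).
Proof.
move=> N0; rewrite /window_freq /fourier_freq addrAC subrr add0r.
have N0' : 0 < N%:R :> R by rewrite ltr0n.
have p0 : 0 < 2 * pi :> R by rewrite mulr_gt0 ?pi_gt0.
rewrite -mulrA normrM (gtr0_norm p0) ler_pM2l//.
rewrite normrM normfV (gtr0_norm N0') ler_pM2r ?invr_gt0//.
rewrite -intr_norm -[(h N)%:R]/((h N)%:Z%:~R) ler_int.
by have := ltn_ord i; lia.
Qed.

Variables (a b : 'I_d) (om th : R) (om0 : nat -> R).
Hypothesis om0_cvg : om0 @ \oo --> om.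

(** The phase [th] is [0] for real parts and [pi / 2] for imaginary parts. *)
Definition window_kern N : R -> R :=
  kern (@window_weight N) (@window_freq N (om0 N)) th.

Lemma window_kern_cvg u : (fun N => window_kern N u) @ \oo --> cos (u * om + th).
Proof.
apply: (@kern_cvg _ _ _ _ _ _ _ (fun N => `|om0 N - om| + (h N)%:R / N%:R * (2 * pi))).
- by move=> N i N0; exact: window_weight_ge0.
- by move=> N N0; exact: window_weight_sum.
- move=> N i N0; have -> : window_freq (om0 N) i - om =
    (window_freq (om0 N) i - om0 N) + (om0 N - om) by ring.
  apply: le_trans (ler_normD _ _) _; rewrite addrC lerD2l mulrC.
  exact: window_freq_dist.
by apply: cvgD0; [exact: cvg_dist0|apply: cvgMr0; exact: window_width_cvg].
Qed.

(** Cross-covariance of the transformed entries [a] and [b] at lag [u]. *)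
Definition acv (psi psi' : R -> R) (a b : 'I_d) (u : int) : R :=
  ex E (fun w => Y psi a u w * Y psi' b 0 w).

Let sY psi e t : lip1 psi -> sq E (Y psi e t).
Proof. exact: (sq_Y shift). Qed.

Lemma acv_le psi psi' e e' u : lip1 psi -> lip1 psi' ->
  `|acv psi psi' e e' u| <= rate (absz u) * rate 0.
Proof.
move=> lp lp'; rewrite /acv; have [u0|u0] := leP 0 u.
  have h1 : 0 <= u - (absz u)%:Z by lia.
  apply: le_trans (cov_Y shift e e' lp lp' h1) _.
  by apply: ler_wpM2l; [exact: rate_ge0|exact: (nrm_Y_rate shift)].
under ex_ext do rewrite mulrC.
have h1 : u <= 0 - (absz u)%:Z by lia.
apply: le_trans (cov_Y shift e' e lp' lp h1) _.
by apply: ler_wpM2l; [exact: rate_ge0|exact: (nrm_Y_rate shift)].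
Qed.

Lemma acv_nrm psi psi' e e' u : lip1 psi -> lip1 psi' ->
  `|acv psi psi' e e' u| <= nrm E (Y psi e 0) * nrm E (Y psi' e' 0).
Proof.
move=> lp lp'; rewrite -(nrm_Y shift e u lp).
by apply: cauchy_schwarz; exact: sY.
Qed.

(** Law of large numbers for the sample autocovariances at a fixed lag. *)
Lemma acv_lln (psi : R -> R) (c : R) (u : int) :
  lip1 psi -> (forall x, `|psi x| <= c) ->
  (fun N => ex E (fun w => `|N%:R^-1 * \sum_(s < N) (Y psi a (1 + s%:Z) w *
      Y psi b (1 + (s%:Z - u)) w - acv psi psi a b u)|)) @ \oo --> (0 : R).
Proof.
move=> lp pc; pose phi e x := psi x - ex E (fun w => psi (X 0 w e 0)).
have mphi e : measurable_fun setT (phi e) by apply: measurable_funB => //; case: lp.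
have [c2 phic] : exists c2, forall e x, `|phi e x| <= c2.
  exists (c + \sum_e `|ex E (fun w => psi (X 0 w e 0))|) => e x.
  apply: le_trans (ler_normB _ _) _; apply: lerD => //.
  by rewrite (bigD1 e)//= lerDl sumr_ge0.
apply/cvgrPdist_le => e e0; have [u0|u0] := leP 0 u.
  have [N0 HN] := lln shift a b (absz u) (mphi a) (mphi b) (phic a) (phic b) e0.
  exists N0 => // N N0N; rewrite sub0r normrN ger0_norm; last first.
    apply: ex_ge0 => //; apply: lf_norm; apply: lfZ; apply: lf_sum => s _.
    by apply: lfB; [apply: lfM_sq; exact: sY|exact: lf_cst].
  apply: le_trans (HN N N0N 1); rewrite le_eqVlt; apply/orP; left; apply/eqP.
  apply: ex_ext => w; congr (`|_ * _|); apply: eq_bigr => s _.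
  rewrite -(ex_lagprod shift a b (absz u) (mphi a) (mphi b) u) /lagprod /phi.
  have -> : 1 + s%:Z - (absz u)%:Z = 1 + (s%:Z - u) by lia.
  by have -> : u - (absz u)%:Z = 0 by lia.
have [N0 HN] := lln shift b a (absz u) (mphi b) (mphi a) (phic b) (phic a) e0.
exists N0 => // N N0N; rewrite sub0r normrN ger0_norm; last first.
  apply: ex_ge0 => //; apply: lf_norm; apply: lfZ; apply: lf_sum => s _.
  by apply: lfB; [apply: lfM_sq; exact: sY|exact: lf_cst].
apply: le_trans (HN N N0N (1 - u)); rewrite le_eqVlt; apply/orP; left; apply/eqP.
apply: ex_ext => w; congr (`|_ * _|); apply: eq_bigr => s _.
rewrite /lagprod /phi /acv; congr (_ - _).
  rewrite mulrC; have -> : 1 - u + s%:Z - (absz u)%:Z = 1 + s%:Z by lia.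
  by have -> : 1 - u + s%:Z = 1 + (s%:Z - u) by lia.
apply: ex_ext => w'; rewrite mulrC.
by have -> : 0 - (absz u)%:Z = u by lia.
Qed.

Lemma Y_clip (c : R) e t w : 0 <= c ->
  Y id e t w = Y (clip c) e t w + Y (unclip c) e t w.
Proof.
move=> c0; rewrite /Y.
have l1 : lf E (fun w => clip c (X 0 w e 0)).
  apply: sq_lf; apply: (sq_lip (f := fun w => X 0 w e 0)); first exact: lip1_clip.
  exact: (sq_X shift).
have l2 : lf E (fun w => unclip c (X 0 w e 0)).
  apply: sq_lf; apply: (sq_lip (f := fun w => X 0 w e 0)); first exact: lip1_unclip.
  exact: (sq_X shift).
have -> : (fun w => X 0 w e 0) = (fun w => clip c (X 0 w e 0) + unclip c (X 0 w e 0)).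
  by apply/funext => w'; rewrite /unclip; ring.
by rewrite exD// /unclip; ring.
Qed.

Lemma Y_unclip_cvg e : (fun n => nrm E (Y (unclip n%:R) e 0)) @ \oo --> (0 : R).
Proof.
apply: (squeeze_cvgr _ (cvg_cst 0) (unclip_cvg (sq_X shift 0 e))).
near=> n; rewrite nrm_ge0/=; apply: nrm_center.
by apply: (sq_lip (f := fun w => X 0 w e 0)); [exact: lip1_unclip|exact: (sq_X shift)].
Unshelve. all: by end_near. Qed.

(** The second argument keeps its full form in the first increment, so that two
  terms suffice. *)
Lemma qformDD N ka (x dx y dy : nat -> T -> R) w :
  qform N ka (fun s w => x s w + dx s w) (fun s w => y s w + dy s w) w =
  qform N ka x y w + (qform N ka dx (fun s w => y s w + dy s w) w + qform N ka x dy w).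
Proof.
rewrite /qform -!mulrDr; congr (_ * _).
rewrite -!big_split/=; apply: eq_bigr => s _.
by rewrite -!big_split/=; apply: eq_bigr => t _; ring.
Qed.

Local Notation x psi e := (fun s : nat => Y psi e s.+1%:Z).

Lemma qform_Y_le N psi psi' e e' S (v v' : R) : lip1 psi -> lip1 psi' -> (0 < N)%N ->
  (forall M, \sum_(n < M) rate n <= S) ->
  nrm E (Y psi e 0) <= v -> nrm E (Y psi' e' 0) <= v' ->
  ex E (fun w => `|qform N (window_kern N) (x psi e) (x psi' e') w|) <=
    2 * (Num.sqrt (2 * v * S) * Num.sqrt (2 * v' * S)).
Proof.
move=> lp lp' N0 bS nv nv'.
have S0 : 0 <= S by have := bS 0%N; rewrite big_ord0.
have [q1 q2] := (nrm_ge0 E (Y psi e 0), nrm_ge0 E (Y psi' e' 0)).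
have [_ H] := @qform_le R T E N _ (@window_weight N) (@window_freq N (om0 N)) th
  (x psi e) (x psi' e') (2 * nrm E (Y psi e 0) * S) (2 * nrm E (Y psi' e' 0) * S) N0
  (fun i => window_weight_ge0 i N0) (window_weight_sum N0)
  (fun s => sY e _ lp) (fun s => sY e' _ lp')
  (mulr_ge0 (mulr_ge0 (ler0n R 2) q1) S0) (mulr_ge0 (mulr_ge0 (ler0n R 2) q2) S0)
  (Y_energy shift e lp (bS N)) (Y_energy shift e' lp' (bS N)).
apply: le_trans H _; rewrite ler_pM2l//.
by apply: ler_pM; rewrite ?sqrtr_ge0//; apply: ler_wsqrtr;
  apply: ler_wpM2r => //; rewrite ler_pM2l.
Qed.

(** Summed over [u], this is [2 * pi] times the real ([th = 0]) or imaginary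
  ([th = pi / 2]) part of the entry [a, b] of the spectral density. *)
Definition limit_term (u : int) : R := acv id id a b u * cos (u%:~R * om + th).

Lemma limit_term_cvg :
  (fun n : nat => \sum_(i < n.*2.+1) limit_term (i%:Z - n%:Z)) @ \oo --> sumZ limit_term.
Proof.
have [S bS] := rate_summable shift.
apply: (@sumZ_cvg _ _ (fun n => rate n * rate 0) (S * rate 0)) => [u|M].
  rewrite /limit_term normrM -[leRHS]mulr1; apply: ler_pM => //; last exact: cos_max.
  by apply: acv_le; exact: lip1_id.
by rewrite -mulr_suml ler_wpM2r ?rate_ge0.
Qed.

Lemma near_clip_cvg (c : R) (n : nat) : 0 <= c ->
  (fun N => ex E (fun w => `|qform N (mask (fun z => `|z| < n.+1%:R) (window_kern N))
      (x (clip c) a) (x (clip c) b) w -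
      \sum_(i < n.*2.+1) cos ((i%:Z - n%:Z)%:~R * om + th) *
         acv (clip c) (clip c) a b (i%:Z - n%:Z)|)) @ \oo --> (0 : R).
Proof.
move=> c0; have lc := lip1_clip c0; have cc z : `|clip c z| <= c by exact: clip_le.
apply: (@near_cvg _ _ _ (fun t => Y (clip c) a (1 + t)) (fun t => Y (clip c) b (1 + t)) (2 * c)
  (acv (clip c) (clip c) a b) (fun u => cos (u%:~R * om + th)) window_kern n).
- by move=> t; exact: sY.
- by move=> t; exact: sY.
- by move=> t w; exact: (Y_bounded shift lc cc).
- by move=> t w; exact: (Y_bounded shift lc cc).
- move=> N z N0; apply: kern_le1; last exact: window_weight_sum.
  by move=> i; exact: window_weight_ge0.
- by move=> u; exact: window_kern_cvg.
- by move=> u; exact: acv_lln lc cc.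
Qed.

Lemma acv_clip (c tau : R) (u : int) : 0 <= c ->
  nrm E (Y (unclip c) a 0) + nrm E (Y (unclip c) b 0) <= tau ->
  `|acv (clip c) (clip c) a b u - acv id id a b u| <= tau * rate 0.
Proof.
move=> c0 ht; have lc := lip1_clip c0; have lu := lip1_unclip c0; have li := @lip1_id R.
have -> : acv id id a b u = acv (clip c) (clip c) a b u +
    (acv (unclip c) id a b u + acv (clip c) (unclip c) a b u).
  have lM p q e e' t : lip1 p -> lip1 q -> lf E (fun w => Y p e u w * Y q e' t w).
    by move=> lp lq; apply: lfM_sq; exact: sY.
  rewrite /acv -!exD//; try exact: lM; last by apply: lfD; exact: lM.
  apply: ex_ext => w; rewrite !(Y_clip _ _ _ c0); ring.
rewrite opprD addrA subrr add0r normrN; apply: le_trans (ler_normD _ _) _.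
apply: le_trans (lerD (acv_nrm a b u lu li) (acv_nrm a b u lc lu)) _.
have n1 := nrm_Y_rate shift b 0 li; have n2 := nrm_Y_rate shift a 0 lc.
have q1 := nrm_ge0 E (Y (unclip c) a 0); have q2 := nrm_ge0 E (Y (unclip c) b 0).
apply: (@le_trans _ _ (nrm E (Y (unclip c) a 0) * rate 0 + rate 0 * nrm E (Y (unclip c) b 0))).
  by apply: lerD; [exact: ler_wpM2l|exact: ler_wpM2r].
by rewrite [rate 0 * _]mulrC -mulrDl; apply: ler_wpM2r => //; exact: rate_ge0.
Qed.

(** The parameters are chosen in this order: the lag [r] beyond which rates
  are negligible, the truncation level [c], and only then the sample size. *)
Lemma qform_cvg :
  (fun N => ex E (fun w => `|qform N (window_kern N) (x id a) (x id b) w -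
    sumZ limit_term|)) @ \oo --> (0 : R).
Proof.
have [S bS] := rate_summable shift.
have S0 : 0 <= S by have := bS 0%N; rewrite big_ord0.
have r0 : 0 < rate 0 by exact: rate0_gt0.
have li := @lip1_id R.
have lq N psi psi' e e' ka : lip1 psi -> lip1 psi' ->
    lf E (qform N ka (x psi e) (x psi' e')).
  by move=> lp lp'; apply: qform_lf => s; exact: sY.
apply: cvg0_approx => [N|e e0].
  by apply: ex_ge0 => //; apply: lf_norm; apply: lfB; [exact: lq|exact: lf_cst].
have e4 : 0 < e / 4 by rewrite divr_gt0.
pose Cf := 3 * (4 * (S + 1) + 2).
have Cf0 : 0 < Cf by rewrite /Cf; lra.
(* [t] is a common bound for the square root and the linear term of [farl];
   [del] is the size of [r * rate r] that achieves it. *)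
pose t := Num.min 1 (e / 4 / Cf).
have t0 : 0 < t by rewrite lt_min ltr01 divr_gt0.
have t1 : t <= 1 by rewrite ge_min lexx.
have tC : Cf * t <= e / 4.
  by rewrite mulrC -ler_pdivlMr// ge_min lexx orbT.
pose del := Num.min (t ^+ 2 / rate 0) (rate 0).
have del0 : 0 < del by rewrite lt_min r0 andbT divr_gt0// exprn_gt0.
have /cvgrPdist_le/(_ _ e4)[n1 _ Hn1] := limit_term_cvg.
have [n n1n Hn] := summable_small n1 (rate_ge0 P m xi gtr X) bS del0.
pose r := n.+1.
have rr : rate r <= r%:R * rate r by rewrite ler_peMl ?rate_ge0// ler1n.
have rdel : rate r <= del by exact: le_trans rr Hn.
have rr0 : rate r <= rate 0 by apply: le_trans rdel _; rewrite ge_min lexx orbT.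
have rt : r%:R * (rate 0 * rate r) <= t ^+ 2.
  rewrite mulrCA mulrC -ler_pdivlMr//; apply: le_trans Hn _.
  by rewrite ge_min lexx.
have farl : 3 * (4 * (S + 1) * Num.sqrt (rate 0 * rate r) +
    2 * r%:R * (rate 0 * rate r)) <= e / 4.
  apply: le_trans tC; rewrite /Cf -[leRHS]mulrA ler_pM2l// [leRHS]mulrDl; apply: lerD.
    apply: ler_wpM2l; first by rewrite mulr_ge0// addr_ge0.
    rewrite -[leRHS]ger0_norm ?(ltW t0)// -sqrtr_sqr; apply: ler_wsqrtr.
    apply: le_trans rt; rewrite ler_peMl ?ler1n// mulr_ge0 ?rate_ge0//.
  rewrite -mulrA ler_pM2l//; apply: le_trans rt _.
  by rewrite expr2 ler_piMr// ltW.
pose tau c := nrm E (Y (unclip c%:R) a 0) + nrm E (Y (unclip c%:R) b 0).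
(* The cost of truncation: in the form, and in the limits at the [2 n + 1]
   lags. *)
pose TB c := 4 * (Num.sqrt (2 * tau c * S) * Num.sqrt (2 * rate 0 * S)) +
  n.*2.+1%:R * (tau c * rate 0).
have tau_cvg : tau @ \oo --> (0 : R) by apply: cvgD0; exact: Y_unclip_cvg.
have TB_cvg : TB @ \oo --> (0 : R).
  have -> : TB = (fun c => Num.sqrt (tau c * (2 * S)) * (4 * Num.sqrt (2 * rate 0 * S)) +
      tau c * (n.*2.+1%:R * rate 0)).
    apply/funext => c; rewrite /TB (_ : 2 * tau c * S = tau c * (2 * S)); last by ring.
    by ring.
  apply: cvgD0; apply: cvgMr0 => //.
  by rewrite -(@sqrtr0 R); apply: cvg_sqrt; exact: cvgMr0.
have /cvgrPdist_le/(_ _ e4)[c _ /(_ c (leqnn c))] := TB_cvg.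
rewrite sub0r normrN => TBc0; have {}TBc : TB c <= e / 4 := le_trans (ler_norm _) TBc0.
have c0 : 0 <= c%:R :> R by exact: ler0n.
have lc := lip1_clip c0; have lu := lip1_unclip c0.
have cc z : `|clip c%:R z| <= c%:R :> R by exact: clip_le.
pose B : R := 2 * c%:R.
pose K2 N := \sum_i @window_weight N i ^+ 2.
pose bb N := (rate 0 + N%:R^-1) * (rate r + N%:R^-1).
pose farb N := 2 * (r%:R * (2 * (B + 1) * Num.sqrt (K2 N * (2 * (r%:R * (4 * (B + 1) ^+ 2))))))
  + 3 * (4 * (S + 1) * Num.sqrt (bb N) + 2 * r%:R * bb N)
  + 2 * ((2 * B + 1) / N%:R).
pose Lc := \sum_(i < n.*2.+1) cos ((i%:Z - n%:Z)%:~R * om + th) *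
         acv (clip c%:R) (clip c%:R) a b (i%:Z - n%:Z).
pose near N w := qform N (mask (fun z => `|z| < n.+1%:R) (window_kern N))
      (x (clip c%:R) a) (x (clip c%:R) b) w.
pose nearb N := ex E (fun w => `|near N w - Lc|).
exists (fun N => TB c + (farb N + (nearb N + e / 4))).
exists (TB c + (3 * (4 * (S + 1) * Num.sqrt (rate 0 * rate r) +
    2 * r%:R * (rate 0 * rate r)) + (0 + e / 4))); split.
- by move: farl TBc; lra.
- apply: cvgD; first exact: cvg_cst.
  apply: cvgD; last first.
    by apply: cvgD; [exact: near_clip_cvg|exact: cvg_cst].
  have Vc : (fun N => N%:R^-1) @ \oo --> (0 : R) by exact: cvg_natV.
  have Vq (q : R) : (fun N => q + N%:R^-1) @ \oo --> q.
    have : (fun N => q + N%:R^-1) @ \oo --> q + 0 by apply: cvgD => //; exact: cvg_cst.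
    by rewrite addr0.
  have bbc : bb @ \oo --> rate 0 * rate r by apply: cvgM; exact: Vq.
  pose mid := 3 * (4 * (S + 1) * Num.sqrt (rate 0 * rate r) + 2 * r%:R * (rate 0 * rate r)).
  rewrite -/mid (_ : mid = 0 + mid + 0); last by rewrite add0r addr0.
  apply: cvgD; first apply: cvgD.
  + have -> : (fun N => 2 * (r%:R * (2 * (B + 1) *
          Num.sqrt (K2 N * (2 * (r%:R * (4 * (B + 1) ^+ 2))))))) =
        (fun N => Num.sqrt (K2 N * (2 * (r%:R * (4 * (B + 1) ^+ 2)))) *
          (2 * r%:R * (2 * (B + 1)))).
      by apply/funext => N; ring.
    apply: cvgMr0; rewrite -(@sqrtr0 R); apply: cvg_sqrt; apply: cvgMr0.
    exact: window_sq_cvg.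
  + apply: cvgM; first exact: cvg_cst.
    apply: cvgD; (apply: cvgM; first exact: cvg_cst); last exact: bbc.
    exact: cvg_sqrt.
  have -> : (fun N => 2 * ((2 * B + 1) / N%:R)) = (fun N => N%:R^-1 * (2 * (2 * B + 1))).
    by apply/funext => N; ring.
  exact: cvgMr0.
- near=> N.
  have N0 : (0 < N)%N by near: N; exists 1%N.
  have nN : ((h N).*2.+1 <= N)%N by near: N; exact: window_narrow.
  have E1 : ex E (fun w => `|qform N (window_kern N) (x id a) (x id b) w -
      qform N (window_kern N) (x (clip c%:R) a) (x (clip c%:R) b) w|) <=
      4 * (Num.sqrt (2 * tau c * S) * Num.sqrt (2 * rate 0 * S)).
    have nx e' : x id e' = (fun s w => Y (clip c%:R) e' s.+1%:Z w + Y (unclip c%:R) e' s.+1%:Z w).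
      by apply/funext => s; apply/funext => w; exact: Y_clip.
    apply: (@le_trans _ _ (ex E (fun w =>
       `|qform N (window_kern N) (x (unclip c%:R) a) (x id b) w| +
       `|qform N (window_kern N) (x (clip c%:R) a) (x (unclip c%:R) b) w|))).
      apply: ex_le => [||w].
      + by apply: lf_norm; apply: lfB; exact: lq.
      + by apply: lfD; apply: lf_norm; exact: lq.
      rewrite (nx a) (nx b) qformDD addrAC subrr add0r; exact: ler_normD.
    rewrite exD; [|by apply: lf_norm; exact: lq..].
    have -> : 4 * (Num.sqrt (2 * tau c * S) * Num.sqrt (2 * rate 0 * S)) =
      2 * (Num.sqrt (2 * tau c * S) * Num.sqrt (2 * rate 0 * S)) +
      2 * (Num.sqrt (2 * rate 0 * S) * Num.sqrt (2 * tau c * S)) by ring.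
    apply: lerD; apply: qform_Y_le => //; rewrite ?(nrm_Y_rate shift)//.
      by rewrite /tau lerDl nrm_ge0.
    by rewrite /tau lerDr nrm_ge0.
  have E2 : ex E (fun w => `|qform N (window_kern N) (x (clip c%:R) a) (x (clip c%:R) b) w -
      near N w|) <= farb N.
    exact: (far_prob shift a b lc cc N0 th (ltn0Sn n) nN (fun i j => window_freqB _ i j N0)
      (fun i => window_weight_ge0 i N0) (window_weight_sum N0) bS rr0 erefl erefl).
  have E3 : `|Lc - sumZ limit_term| <= n.*2.+1%:R * (tau c * rate 0) + e / 4.
    rewrite -(subrK (\sum_(i < n.*2.+1) limit_term (i%:Z - n%:Z)) Lc) -addrA.
    apply: le_trans (ler_normD _ _) _; apply: lerD; last by rewrite distrC; exact: Hn1.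
    rewrite /Lc -sumrB; apply: le_trans (ler_norm_sum _ _ _) _.
    rewrite -sum_ord_cst; apply: ler_sum => i _.
    rewrite /limit_term [acv id id _ _ _ * _]mulrC -mulrBr normrM -[leRHS]mul1r.
    by apply: ler_pM => //; [exact: cos_max|exact: acv_clip].
  apply: (@le_trans _ _ (ex E (fun w =>
     `|qform N (window_kern N) (x id a) (x id b) w -
      qform N (window_kern N) (x (clip c%:R) a) (x (clip c%:R) b) w| +
     (`|qform N (window_kern N) (x (clip c%:R) a) (x (clip c%:R) b) w - near N w| +
     (`|near N w - Lc| + `|Lc - sumZ limit_term|))))).
    apply: ex_le => [||w].
    + by apply: lf_norm; apply: lfB; [exact: lq|exact: lf_cst].
    + apply: lfD; first by apply: lf_norm; apply: lfB; exact: lq.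
      apply: lfD; first by apply: lf_norm; apply: lfB; exact: lq.
      by apply: lfD; [apply: lf_norm; apply: lfB; [exact: lq|exact: lf_cst]|exact: lf_cst].
    rewrite -(subrK (qform N (window_kern N) (x (clip c%:R) a) (x (clip c%:R) b) w)
      (qform N (window_kern N) (x id a) (x id b) w)) -[X in `|X|]addrA subrK.
    apply: le_trans (ler_normD _ _) _; rewrite lerD2l.
    rewrite -[X in X - sumZ _](subrK (near N w)) -[X in `|X|]addrA.
    apply: le_trans (ler_normD _ _) _; rewrite lerD2l.
    rewrite -[X in X - sumZ _](subrK Lc) -[X in `|X|]addrA.
    exact: ler_normD.
  have l1 : lf E (fun w => `|near N w - Lc|).
    by apply: lf_norm; apply: lfB; [exact: lq|exact: lf_cst].
  have l2 : lf E (fun w => `|qform N (window_kern N) (x (clip c%:R) a) (x (clip c%:R) b) w - near N w|).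
    by apply: lf_norm; apply: lfB; exact: lq.
  have l3 : lf E (fun w => `|qform N (window_kern N) (x id a) (x id b) w -
      qform N (window_kern N) (x (clip c%:R) a) (x (clip c%:R) b) w|).
    by apply: lf_norm; apply: lfB; exact: lq.
  have l4 := lf_cst E `|Lc - sumZ limit_term|.
  rewrite exD//; last by do !apply: lfD.
  rewrite exD//; last by apply: lfD.
  rewrite exD// ex_cst -/(nearb N).
  move: E1 E2 E3; rewrite /TB -/(nearb N); lra.
Unshelve. all: by end_near. Qed.

End main.

(** * Entries of the periodogram *)

Section complex_entries.
Context {R : realType}.
Implicit Types z w : R[i].

Lemma ReM z w : complex.Re (z * w) =
  complex.Re z * complex.Re w - complex.Im z * complex.Im w.
Proof. by case: z w => [a b] [c e]. Qed.

Lemma ImM z w : complex.Im (z * w) =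
  complex.Re z * complex.Im w + complex.Im z * complex.Re w.
Proof. by case: z w => [a b] [c e]. Qed.

Lemma ReZ (c : R) z : complex.Re (c%:C%C * z) = c * complex.Re z.
Proof. by rewrite ReM/= mul0r subr0. Qed.

Lemma ImZ (c : R) z : complex.Im (c%:C%C * z) = c * complex.Im z.
Proof. by rewrite ImM/= mul0r addr0. Qed.

Lemma Re_sum (I : Type) (r : seq I) (F : I -> R[i]) :
  complex.Re (\sum_(i <- r) F i) = \sum_(i <- r) complex.Re (F i).
Proof.
elim: r => [|i r IH]; first by rewrite !big_nil.
by rewrite !big_cons -IH; case: (F i) => a b; case: (\sum_(j <- r) F j).
Qed.

Lemma Im_sum (I : Type) (r : seq I) (F : I -> R[i]) :
  complex.Im (\sum_(i <- r) F i) = \sum_(i <- r) complex.Im (F i).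
Proof.
elim: r => [|i r IH]; first by rewrite !big_nil.
by rewrite !big_cons -IH; case: (F i) => a b; case: (\sum_(j <- r) F j).
Qed.

Lemma Re_conj z : complex.Re (Num.conj z) = complex.Re z.
Proof. by case: z. Qed.

Lemma Im_conj z : complex.Im (Num.conj z) = - complex.Im z.
Proof. by case: z. Qed.

Variables (d N : nat) (x : 'I_N -> 'cV[R]_d).

Lemma dft_entry lam a :
  (complex.Re (dft x lam a 0) =
    (Num.sqrt N%:R)^-1 * \sum_(s < N) cos (s.+1%:R * lam) * x s a 0) /\
  (complex.Im (dft x lam a 0) =
    - ((Num.sqrt N%:R)^-1 * \sum_(s < N) sin (s.+1%:R * lam) * x s a 0)).
Proof.
rewrite /dft mxE summxE; split; rewrite ?ReZ ?ImZ ?Re_sum ?Im_sum.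
  congr (_ * _); apply: eq_bigr => s _.
  by rewrite !mxE ReM/= mulr0 subr0 cosN.
rewrite -mulrN -sumrN; congr (_ * _); apply: eq_bigr => s _.
by rewrite !mxE ImM/= mulr0 add0r sinN mulNr.
Qed.

(** The addition formulas for [cos (s - t)] and [sin (s - t)]; as
  [cos (x + pi / 2) = - sin x], a phase covers both parts. *)
Lemma periodogram_entry lam a b :
  let q th := N%:R^-1 * \sum_(s < N) \sum_(t < N)
    cos ((s%:R - t%:R) * lam + th) * (x s a 0 * x t b 0) in
  complex.Re (periodogram x lam a b) = q 0 /\
  complex.Im (periodogram x lam a b) = q (pi / 2).
Proof.
have [ra ia] := dft_entry lam a; have [rb ib] := dft_entry lam b.
rewrite /periodogram mxE big_ord1 [_^T 0 b]mxE [map_mx _ _ b 0]mxE.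
have NV : (Num.sqrt N%:R)^-1 * (Num.sqrt N%:R)^-1 = N%:R^-1 :> R.
  by rewrite -invfM -expr2 sqr_sqrtr ?ler0n.
set q := (Num.sqrt N%:R)^-1 in ra ia rb ib NV.
have prod (f g : nat -> R) :
    (q * \sum_(s < N) f s * x s a 0) * (q * \sum_(t < N) g t * x t b 0) =
    N%:R^-1 * \sum_(s < N) \sum_(t < N) f s * g t * (x s a 0 * x t b 0).
  rewrite mulrACA NV mulr_suml; congr (_ * _); apply: eq_bigr => s _.
  by rewrite mulr_sumr; apply: eq_bigr => t _; ring.
split.
  rewrite ReM Re_conj Im_conj ra ia rb ib opprK !mulNr opprK.
  rewrite !(prod (fun s => cos (s.+1%:R * lam)) (fun s => cos (s.+1%:R * lam))).
  rewrite !(prod (fun s => sin (s.+1%:R * lam)) (fun s => sin (s.+1%:R * lam))).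
  rewrite -mulrDr -big_split/=; congr (_ * _); apply: eq_bigr => s _.
  rewrite -big_split/=; apply: eq_bigr => t _; rewrite -mulrDl -cosB.
  by congr (cos _ * _); rewrite -!natr1; ring.
rewrite ImM Re_conj Im_conj ra ia rb ib opprK mulNr.
rewrite !(prod (fun s => cos (s.+1%:R * lam)) (fun s => sin (s.+1%:R * lam))).
rewrite !(prod (fun s => sin (s.+1%:R * lam)) (fun s => cos (s.+1%:R * lam))).
rewrite -mulrBr -sumrB; congr (_ * _); apply: eq_bigr => s _.
rewrite -sumrB; apply: eq_bigr => t _; rewrite -mulrBl cosDpihalf.
have -> : (s%:R - t%:R) * lam = s.+1%:R * lam - t.+1%:R * lam.
  by rewrite -!natr1; ring.
by rewrite sinB; congr (_ * _); ring.
Qed.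

Lemma spec_est_entry (h : nat) (K : int -> R) (om0 : R) a b :
  let q th := (2 * pi)^-1 * (N%:R^-1 * \sum_(s < N) \sum_(t < N)
    kern (fun i : 'I_(h.*2.+1) => K (i%:Z - h%:Z))
      (fun i : 'I_(h.*2.+1) => om0 + fourier_freq R N (i%:Z - h%:Z)) th
      (s%:R - t%:R) * (x s a 0 * x t b 0)) in
  complex.Re (spec_est h K x om0 a b) = q 0 /\
  complex.Im (spec_est h K x om0 a b) = q (pi / 2).
Proof.
have sumE th : \sum_(i < h.*2.+1) K (i%:Z - h%:Z) * (N%:R^-1 * \sum_(s < N) \sum_(t < N)
    cos ((s%:R - t%:R) * (om0 + fourier_freq R N (i%:Z - h%:Z)) + th) *
      (x s a 0 * x t b 0)) =
    N%:R^-1 * \sum_(s < N) \sum_(t < N)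
    kern (fun i : 'I_(h.*2.+1) => K (i%:Z - h%:Z))
      (fun i : 'I_(h.*2.+1) => om0 + fourier_freq R N (i%:Z - h%:Z)) th
      (s%:R - t%:R) * (x s a 0 * x t b 0).
  under [in RHS]eq_bigr => s _.
    under eq_bigr => t _ do rewrite /kern mulr_suml.
    rewrite exchange_big/=.
    over.
  rewrite exchange_big/= mulr_sumr; apply: eq_bigr => i _.
  rewrite mulrCA; congr (_ * _); rewrite mulr_sumr; apply: eq_bigr => s _.
  rewrite mulr_sumr; apply: eq_bigr => t _.
  ring.
rewrite /spec_est mxE /sum_window summxE ReZ ImZ Re_sum Im_sum.
split; congr (_ * _); rewrite -sumE; apply: eq_bigr => i _.
  have [re _] := periodogram_entry (om0 + fourier_freq R N (i%:Z - h%:Z)) a b.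
  by rewrite [in LHS]mxE ReZ re.
have [_ im] := periodogram_entry (om0 + fourier_freq R N (i%:Z - h%:Z)) a b.
by rewrite [in LHS]mxE ImZ im.
Qed.

End complex_entries.

(** When the frequencies that carry weight are orthogonal to constants, the
  rows and the columns of the kernel sum to [0]. *)
Lemma qform_center (R : realType) (T : Type) (N n : nat) (k lam : 'I_n -> R) (th p q : R)
    (x y : nat -> T -> R) (w : T) :
  (forall i, k i != 0 -> forall ph, \sum_(s < N) cos (s%:R * lam i + ph) = 0) ->
  qform N (kern k lam th) (fun s w => x s w + p) (fun s w => y s w + q) w =
  qform N (kern k lam th) x y w.
Proof.
move=> H.
have kl (t : R) : \sum_(s < N) kern k lam th (s%:R - t) = 0.
  rewrite exchange_big/=; apply: big1 => i _; rewrite -mulr_sumr.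
  have [->|ki] := eqVneq (k i) 0; first by rewrite mul0r.
  under eq_bigr do rewrite mulrBl -addrA.
  by rewrite H// mulr0.
have kr (s : R) : \sum_(t < N) kern k lam th (s - t%:R) = 0.
  rewrite exchange_big/=; apply: big1 => i _; rewrite -mulr_sumr.
  have [->|ki] := eqVneq (k i) 0; first by rewrite mul0r.
  under eq_bigr do rewrite -cosN opprD mulrBl opprB -addrA.
  by rewrite H// mulr0.
rewrite /qform; congr (_ * _).
transitivity (\sum_(s < N) \sum_(t < N) kern k lam th (s%:R - t%:R) * ((x s w + p) * y t w)).
  apply: eq_bigr => s _.
  transitivity (\sum_(t < N) (kern k lam th (s%:R - t%:R) * ((x s w + p) * y t w) +
      kern k lam th (s%:R - t%:R) * ((x s w + p) * q))).
    by apply: eq_bigr => t _; ring.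
  by rewrite big_split/= -mulr_suml kr mul0r addr0.
rewrite exchange_big/= [RHS]exchange_big/=; apply: eq_bigr => t _.
transitivity (\sum_(s < N) (kern k lam th (s%:R - t%:R) * (x s w * y t w) +
    kern k lam th (s%:R - t%:R) * (p * y t w))).
  by apply: eq_bigr => s _; ring.
by rewrite big_split/= -mulr_suml kl mul0r addr0.
Qed.

Lemma sumZN (R : realType) (f : int -> R) : sumZ (fun u => f (- u)) = sumZ f.
Proof.
rewrite /sumZ; congr (limn _); apply/funext => n.
rewrite (reindex_inj rev_ord_inj)/=; apply: eq_bigr => i _.
by congr f; have := ltn_ord i; rewrite ltnS subSS; lia.
Qed.

(** Markov's inequality applied to a majorant [Z] of the error. *)
Lemma consistent_ex (disp : measure_display) (T : measurableType disp) (R : realType)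
    (P : probability T R) (V : zmodType) (nrm : V -> R) (Y : nat -> T -> V) (y : V)
    (Z : nat -> T -> R) :
  (\forall N \near \oo, [/\ measurable_fun setT (fun w => nrm (Y N w - y)),
     lf (prob_op P) (Z N) & forall w, 0 <= Z N w /\ nrm (Y N w - y) <= Z N w]) ->
  (fun N => ex (prob_op P) (Z N)) @ \oo --> (0 : R) ->
  consistent P nrm Y y.
Proof.
move=> H Z0 e e0.
have c0 : (fun N => (ex (prob_op P) (Z N) / e)%:E) @ \oo --> (0 : \bar R).
  by apply: cvg_EFin; [exact: nearW|exact: cvgMr0].
apply: (@squeeze_cvge _ _ _ _ (fun=> 0%E) (fun N => P [set w | e < nrm (Y N w - y)])
  (fun N => (ex (prob_op P) (Z N) / e)%:E) _ 0%E) => //; last exact: cvg_cst.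
near=> N; have [mY lZ hZ] : [/\ measurable_fun setT (fun w => nrm (Y N w - y)),
  lf (prob_op P) (Z N) & forall w, 0 <= Z N w /\ nrm (Y N w - y) <= Z N w] by near: N.
rewrite measure_ge0/=; apply: le_trans (markov_ex e0 lZ (fun w => (hZ w).1)).
apply: le_measure; rewrite ?inE; [exact: measurable_gt|apply: measurable_gt; exact: lf_mf lZ|].
by move=> w /= h; apply: lt_le_trans h (hZ w).2.
Unshelve. all: by end_near. Qed.

(** * Convergence in probability of matrices *)

Lemma sqrt_sum_le (R : realType) (I : finType) (u : I -> R) :
  Num.sqrt (\sum_i u i ^+ 2) <= \sum_i `|u i|.
Proof.
have S0 : 0 <= \sum_i `|u i| by exact: sumr_ge0.
rewrite -[leRHS]ger0_norm// -sqrtr_sqr; apply: ler_wsqrtr.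
rewrite expr2 mulr_suml; apply: ler_sum => i _.
rewrite -[u i ^+ 2]real_normK ?num_real// expr2; apply: ler_wpM2l => //.
by rewrite (bigD1 i)//= lerDl sumr_ge0.
Qed.

(** Both norms in use are square roots of a sum of squares of real entries,
  indexed by [I]. *)
Lemma consistent_entries (disp : measure_display) (T : measurableType disp) (R : realType)
    (P : probability T R) (V : zmodType) (nrm : V -> R) (Y : nat -> T -> V) (y : V)
    (I : finType) (u : I -> nat -> T -> R) :
  (forall N w, nrm (Y N w - y) = Num.sqrt (\sum_i u i N w ^+ 2)) ->
  (forall i N, lf (prob_op P) (u i N)) ->
  (forall i, (fun N => ex (prob_op P) (fun w => `|u i N w|)) @ \oo --> (0 : R)) ->
  consistent P nrm Y y.
Proof.
move=> nE lu u0; apply: (@consistent_ex _ _ _ _ _ _ _ _ (fun N w => \sum_i `|u i N w|)).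
  near=> N; split.
  - under eq_fun do rewrite nE.
    apply: (measurableT_comp (continuous_measurable_fun (@sqrt_continuous R))).
    by apply: measurable_sum => i; apply: measurable_funX; exact: lf_mf (lu i N).
  - by apply: lf_sum => i _; exact: lf_norm.
  - move=> w; split; first exact: sumr_ge0.
    rewrite nE; exact: (sqrt_sum_le (fun i => u i N w)).
under eq_fun => N.
  rewrite ex_sum => [|i _]; last exact: lf_norm.
  rewrite (reindex (@enum_val I (mem predT)))/=; last by apply: onW_bij; exact: enum_val_bij.
  over.
by apply: (@cvg_sum0 _ _ (fun i N => ex (prob_op P) (fun w => `|u (enum_val i) N w|))).
Unshelve. all: by end_near. Qed.

Lemma consistent_mx (disp : measure_display) (T : measurableType disp) (R : realType)
    (P : probability T R) (d : nat) (Y : nat -> T -> 'M[R]_d) (y : 'M[R]_d) :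
  (forall a b N, lf (prob_op P) (fun w => Y N w a b - y a b)) ->
  (forall a b, (fun N => ex (prob_op P) (fun w => `|Y N w a b - y a b|)) @ \oo --> (0 : R)) ->
  consistent P (@enorm R d d) Y y.
Proof.
move=> lY Y0; apply: (@consistent_entries _ _ _ _ _ _ _ _ _
  (fun (i : 'I_d * 'I_d) N w => Y N w i.1 i.2 - y i.1 i.2)) => // N w.
rewrite /enorm pair_big/=; congr Num.sqrt; apply: eq_bigr => i _.
by rewrite !mxE.
Qed.

Lemma consistent_mxC (disp : measure_display) (T : measurableType disp) (R : realType)
    (P : probability T R) (d : nat) (Y : nat -> T -> 'M[R[i]]_d) (y : 'M[R[i]]_d) :
  (forall p : R[i] -> R, p = @complex.Re R \/ p = @complex.Im R -> forall a b,
    (forall N, lf (prob_op P) (fun w => p (Y N w a b) - p (y a b))) /\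
    (fun N => ex (prob_op P) (fun w => `|p (Y N w a b) - p (y a b)|)) @ \oo --> (0 : R)) ->
  consistent P (@enormC R d d) Y y.
Proof.
move=> H; pose p (c : bool) : R[i] -> R := if c then @complex.Re R else @complex.Im R.
have {}H c := H (p c) (if c as c return (p c = @complex.Re R \/ p c = @complex.Im R)
  then or_introl erefl else or_intror erefl).
apply: (@consistent_entries _ _ _ _ _ _ _ _ _
  (fun (i : 'I_d * 'I_d * bool) N w => p i.2 (Y N w i.1.1 i.1.2) - p i.2 (y i.1.1 i.1.2))).
- move=> N w; rewrite /enormC /enorm pair_big/=.
  rewrite -(pair_bigA _ (fun i c => (p c (Y N w i.1 i.2) - p c (y i.1 i.2)) ^+ 2))/=.
  congr Num.sqrt; apply: eq_bigr => i _; rewrite big_bool/= !mxE.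
  case: (Y N w i.1 i.2) (y i.1 i.2) => [a b] [a' b'] /=.
  by rewrite sqr_sqrtr// addr_ge0 ?sqr_ge0.
- by move=> i N; exact: (H i.2 i.1.1 i.1.2).1.
- by move=> i; exact: (H i.2 i.1.1 i.1.2).2.
Qed.

(** * Second moments and Fourier frequencies *)

Section moments.
Context {disp : measure_display} {T : measurableType disp} {R : realType}.
Variables (P : probability T R) (d m : nat).
Variable xi : int -> T -> 'cV[R]_d.
Variable g : (nat -> 'cV[R]_d) -> 'cV[R]_d.
Variable gtr : forall l : nat, ('I_l.+1 -> 'cV[R]_d) -> 'cV[R]_d.
Variable X : int -> T -> 'cV[R]_d.
Hypothesis shift : mdep_shift P m xi g gtr X.
Local Notation E := (prob_op P).
Local Notation Y := (Y P X).
Local Notation acv := (acv P X id id).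

Lemma ex_X a t : ex E (fun w => X t w a 0) = ex E (fun w => X 0 w a 0).
Proof.
have := stationary_ex (measurable_X shift) (shift_stationary shift) (fun _ : 'I_1 => 0) t
  (@measurable_coord R d _ (ord0 : 'I_1) a 0).
by rewrite add0r => ->.
Qed.

Lemma ex_YY a b s t u :
  ex E (fun w => Y id a (s + u) w * Y id b (t + u) w) =
  ex E (fun w => Y id a s w * Y id b t w).
Proof.
pose h (x : bfam R d 'I_2) : R := (x ord0 a 0 - ex E (fun w => X 0 w a 0)) *
  (x ord_max b 0 - ex E (fun w => X 0 w b 0)).
have mh : measurable_fun setT h.
  by apply: measurable_funM; apply: measurable_funB => //; exact: measurable_coord.
exact: esym (stationary_ex (measurable_X shift) (shift_stationary shift)
  (fun i : 'I_2 => if i == ord0 then s else t) u mh).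
Qed.

Lemma lf_X a t : lf E (fun w => X t w a 0).
Proof. by apply: sq_lf; exact: (sq_X shift). Qed.

Lemma acovE a b t : acov P X t a b = acv a b t.
Proof.
pose mu a := ex E (fun w => X 0 w a 0).
have lXX : lf E (fun w => X t w a 0 * X 0 w b 0).
  by apply: lfM_sq; exact: (sq_X shift).
rewrite /acov !mxE big_ord1 !mxE -!prob_exE -/(mu a) -/(mu b) /acv /Y -/(mu a) -/(mu b).
have -> : (fun w => (X t w a 0 - mu a) * (X 0 w b 0 - mu b)) =
  (fun w => X t w a 0 * X 0 w b 0 - (mu b * X t w a 0 + (mu a * X 0 w b 0 - mu a * mu b))).
  by apply/funext => w; ring.
have [la lb] := (lf_X a t, lf_X b 0).
have lb' : lf E (fun w => mu a * X 0 w b 0 - mu a * mu b).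
  by apply: lfB; [exact: lfZ|exact: lf_cst].
rewrite exB//; last by apply: lfD => //; exact: lfZ.
rewrite exD//; last exact: lfZ.
rewrite exB//; [|exact: lfZ|exact: lf_cst].
rewrite ex_cst !exZ// ex_X -/(mu a) -/(mu b); ring.
Qed.

Lemma covarianceE a b t :
  fine (covariance P (fun w => X 0 w a 0) (fun w => X t w b 0)) = acv a b (- t).
Proof.
rewrite unlock -prob_exE -!prob_exE ex_X /acv -(ex_YY a b (- t) 0 t) addNr add0r.
by [].
Qed.

(** The multiple of [2 * pi / N] just below [om] is already that close. *)
Lemma nearest_freq_dist (N : nat) (om x : R) : (0 < N)%N -> nearest_freq N om x ->
  `|x - om| <= 2 * pi / N%:R.
Proof.
move=> N0 [_ /(_ (Num.floor (om * N%:R / (2 * pi))))]; rewrite distrC => h.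
apply: le_trans h _; rewrite /fourier_freq.
have p0 : 0 < 2 * pi :> R by rewrite mulr_gt0 ?pi_gt0.
have N0' : 0 < N%:R :> R by rewrite ltr0n.
have /andP[f1 f2] := floor_itv (om * N%:R / (2 * pi)).
set z := Num.floor _ in f1 f2 *.
have fE (q n c : R) : 0 < q -> 0 < n -> om - q * c / n = (om * n / q - c) * (q / n).
  by move=> q0 n0; field; rewrite !gt_eqF.
rewrite fE//.
have q0 : 0 < 2 * pi / N%:R :> R by rewrite divr_gt0.
rewrite normrM (gtr0_norm q0) ler_piMl ?(ltW q0)// ger0_norm ?subr_ge0//.
by rewrite lerBlDl; move: f2; rewrite intrD1 => /ltW.
Qed.

End moments.

(** * Consistency *)

Section consistency.
Context {disp : measure_display} {T : measurableType disp} {R : realType}.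
Variables (P : probability T R) (d m : nat).
Variable xi : int -> T -> 'cV[R]_d.
Variable g : (nat -> 'cV[R]_d) -> 'cV[R]_d.
Variable gtr : forall l : nat, ('I_l.+1 -> 'cV[R]_d) -> 'cV[R]_d.
Variable X : int -> T -> 'cV[R]_d.
Hypothesis shift : mdep_shift P m xi g gtr X.
Variables (h : nat -> nat) (K : nat -> int -> R).
Hypothesis hK : weight_functions h K.
Local Notation E := (prob_op P).
Local Notation Y := (Y P X).
Local Notation x a := (fun (s : nat) w => X s.+1%:Z w a 0).
Local Notation y a := (fun s : nat => Y id a s.+1%:Z).
Local Notation limit := (limit_term P X).

Lemma XE a : (x a : nat -> T -> R) = (fun s w => y a s w + ex E (fun w => X 0 w a 0)).
Proof. by apply/funext => s; apply/funext => w; rewrite /Y subrK. Qed.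

Lemma lf_qform ka a b N : lf E (qform N ka (x a) (x b)).
Proof. by apply: qform_lf => s; exact: (sq_X shift). Qed.

Lemma window_center N (om : R) i : (0 < N)%N -> (exists j, om = fourier_freq R N j) ->
  0 < `|@window_freq R h N om i| < 2 * pi ->
  forall ph, \sum_(s < N) cos (s%:R * window_freq om i + ph) = 0.
Proof.
move=> N0 [j ->] H ph.
apply: (sum_cos_eq0 (z := j + (i%:Z - (h N)%:Z)) ph H).
rewrite /window_freq /fourier_freq intrD; field.
by rewrite pnatr_eq0; lia.
Qed.

Section frequency.
Variables (om : R) (om0 : nat -> R).
Hypothesis om_pi : - pi <= om <= pi.
Hypothesis om_mean : om = 0 -> mean P (X 0) = 0.
Hypothesis om0_nearest : forall N, (0 < N)%N -> nearest_freq N om (om0 N).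

Lemma om0_cvg : om0 @ \oo --> om.
Proof.
have H : (fun N => N%:R^-1 * (2 * pi)) @ \oo --> (0 : R) by apply: cvgMr0; exact: cvg_natV.
apply/cvgrPdist_le => e e0; have /cvgrPdist_le/(_ _ e0) H' := H.
near=> N; have N0 : (0 < N)%N by near: N; exists 1%N.
have h1 : `|0 - N%:R^-1 * (2 * pi)| <= e by near: N.
rewrite distrC; apply: le_trans (nearest_freq_dist N0 (om0_nearest N0)) _.
apply: le_trans h1; rewrite sub0r normrN mulrC; exact: ler_norm.
Unshelve. all: by end_near. Qed.

(** Away from frequency [0] the window eventually avoids [0], and centering is
  free; at frequency [0] the mean vanishes. *)
Lemma qform_centered th : \forall N \near \oo, forall a b w,
  qform N (window_kern h K th om0 N) (x a) (x b) w =
  qform N (window_kern h K th om0 N) (y a) (y b) w.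
Proof.
have [om_0|om_neq0] := eqVneq om 0.
  have mu0 a : ex E (fun w => X 0 w a 0) = 0.
    by have := om_mean om_0; move/colP/(_ a); rewrite !mxE -prob_exE.
  near=> N => a b w; rewrite !XE !mu0; congr (qform _ _ _ _ _).
    by apply/funext => s; apply/funext => w'; rewrite addr0.
  by apply/funext => s; apply/funext => w'; rewrite addr0.
have c0 : (fun N => `|om0 N - om| + (h N)%:R / N%:R * (2 * pi)) @ \oo --> (0 : R).
  by apply: cvgD0; [apply: cvg_dist0; exact: om0_cvg|apply: cvgMr0; exact: (window_width_cvg hK)].
have o0 : 0 < `|om| / 2 by rewrite divr_gt0// normr_gt0.
have /cvgrPdist_le/(_ _ o0) H := c0.
near=> N => a b w; rewrite !XE; apply: qform_center => i _.
have N0 : (0 < N)%N by near: N; exists 1%N.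
apply: window_center => //; first by have [] := om0_nearest N0.
have h1 : `|0 - (`|om0 N - om| + (h N)%:R / N%:R * (2 * pi))| <= `|om| / 2 by near: N.
have h2 := window_freq_dist (om0 N) i N0.
have h3 : `|window_freq (om0 N) i - om| <= `|om| / 2.
  apply: le_trans h1; rewrite sub0r normrN; apply: le_trans (ler_norm _).
  rewrite -(subrK (om0 N) (window_freq (om0 N) i)) -addrA.
  apply: le_trans (ler_normD _ _) _; rewrite [leLHS]addrC lerD2l.
  by rewrite [leRHS]mulrC.
have h4 : `|om| <= pi by rewrite ler_norml.
have h5 := ler_distD om (window_freq (om0 N) i) 0.
rewrite !subr0 in h5.
have pp := pi_gt0 R; have on : 0 < `|om| by rewrite normr_gt0.
apply/andP; split.
  rewrite ltNge; apply/negP => f0; have f00 : window_freq (om0 N) i = 0.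
    by apply/eqP; rewrite -normr_le0.
  by move: h3; rewrite f00 sub0r normrN; lra.
lra.
Unshelve. all: by end_near. Qed.

Lemma qform_X_cvg a b th :
  (fun N => ex E (fun w => `|qform N (window_kern h K th om0 N) (x a) (x b) w -
    sumZ (limit a b om th)|)) @ \oo --> (0 : R).
Proof.
apply: cvg_trans (qform_cvg shift hK a b th om0_cvg).
apply: near_eq_cvg; near=> N; apply: ex_ext => w; congr (`|_ - _|).
have H : forall a b w,
  qform N (window_kern h K th om0 N) (x a) (x b) w =
  qform N (window_kern h K th om0 N) (y a) (y b) w by near: N; exact: qform_centered.
exact/esym/H.
Unshelve. all: by end_near. Qed.

Lemma spectral_density_entry a b :
  complex.Re (spectral_density P X om a b) = (2 * pi)^-1 * sumZ (limit a b om 0) /\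
  complex.Im (spectral_density P X om a b) = (2 * pi)^-1 * sumZ (limit a b om (pi / 2)).
Proof.
rewrite /spectral_density mxE ReZ ImZ /sumZC; split; congr (_ * sumZ _); apply/funext => u.
  by rewrite /limit_term -(acovE shift) ?ReM/= mul0r subr0 addr0 cosN.
by rewrite /limit_term -(acovE shift) ?ImM/= mul0r addr0 cosDpihalf sinN.
Qed.

Lemma spec_est_consistent :
  consistent P (@enormC R d d)
    (fun N w => spec_est (h N) (K N) (sample X N w) (om0 N))
    (spectral_density P X om).
Proof.
apply: consistent_mxC => p pE a b.
have [th pq] : exists th, forall N w,
    p (spec_est (h N) (K N) (sample X N w) (om0 N) a b) - p (spectral_density P X om a b) =
    (2 * pi)^-1 * (qform N (window_kern h K th om0 N) (x a) (x b) w - sumZ (limit a b om th)).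
  have [f1 f2] := spectral_density_entry a b.
  case: pE => ->; [exists 0|exists (pi / 2)] => N w;
    have [e1 e2] := spec_est_entry (sample X N w) (h N) (K N) (om0 N) a b.
    by rewrite e1 f1 -mulrBr.
  by rewrite e2 f2 -mulrBr.
split=> [N|].
  by under eq_fun do rewrite pq; apply: lfZ; apply: lfB; [exact: lf_qform|exact: lf_cst].
have H := cvgMr0 `|(2 * pi)^-1| (qform_X_cvg a b th).
under eq_fun => N.
  under ex_ext => w do rewrite pq normrM.
  rewrite exZ; last by apply: lf_norm; apply: lfB; [exact: lf_qform|exact: lf_cst].
  rewrite mulrC; over.
exact: H.
Qed.

End frequency.

(** At frequency [0] the periodogram depends on the unknown mean. Without the
  zero frequency the estimator is insensitive to it; this costs a single
  weight, which is negligible because the squared weights tend to [0]. *)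
Definition punctured N (k : int) : R := if k == 0 then 0 else K N k.

(** The long-run covariance is [2 * pi] times the spectral density at [0]. *)
Definition lrc_est N (s : 'I_N -> 'cV[R]_d) : 'M[R]_d :=
  \matrix_(a, b) (2 * pi * complex.Re (spec_est (h N) (punctured N) s 0 a b)).

Lemma measurable_lrc_est N : mx_measurable (@borel_fam R d 'I_N) (@lrc_est N).
Proof.
move=> a b B mB.
pose F (s : bfam R d 'I_N) : R := lrc_est s a b.
suff mF : measurable_fun setT F by rewrite -bfamE -[X in measurable X]setTI; exact: mF.
have FE (s : bfam R d 'I_N) := etrans (mxE _ _ a b)
  (congr1 (fun c => 2 * pi * c) (spec_est_entry s (h N) (punctured N) 0 a b).1) : F s = _.
rewrite (funext FE); do 3 (apply: measurable_funM => //).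
apply: measurable_sum => s; apply: measurable_sum => t; apply: measurable_funM => //.
by apply: measurable_funM; exact: measurable_coord.
Qed.

Definition punctured_kern N : R -> R :=
  kern (fun i : 'I_((h N).*2.+1) => punctured N (i%:Z - (h N)%:Z))
    (@window_freq R h N 0) 0.

Lemma lrc_est_entry N a b w :
  lrc_est (sample X N w) a b = qform N (punctured_kern N) (x a) (x b) w.
Proof.
rewrite mxE (spec_est_entry (sample X N w) (h N) (punctured N) 0 a b).1.
by apply: mulVKf; rewrite mulf_neq0// gt_eqF// pi_gt0.
Qed.

Lemma window_kern_punctured N z :
  window_kern h K 0 (fun=> 0) N z = punctured_kern N z + K N 0.
Proof.
have hh : (h N < (h N).*2.+1)%N by rewrite ltnS -addnn leq_addr.
rewrite /window_kern /punctured_kern /kern (bigD1 (Ordinal hh))//= [in RHS](bigD1 (Ordinal hh))//=.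
rewrite /window_weight /window_freq /punctured /= subrr eqxx mul0r add0r.
rewrite /fourier_freq mulr0 mul0r !addr0 mulr0 cos0 mulr1 addrC; congr (_ + _).
rewrite add0r; apply: eq_bigr => i ih; case: eqP => // ih0; case/eqP: ih; apply: val_inj => /=; lia.
Qed.

Lemma weight0_cvg : (fun N => `|K N 0|) @ \oo --> (0 : R).
Proof.
apply: (squeeze_cvgr _ (cvg_cst 0)); last first.
  by rewrite -(@sqrtr0 R); apply: cvg_sqrt; exact: (window_sq_cvg hK).
near=> N; rewrite normr_ge0/= -sqrtr_sqr; apply: ler_wsqrtr.
have hh : (h N < (h N).*2.+1)%N by rewrite ltnS -addnn leq_addr.
rewrite (bigD1 (Ordinal hh))//= {1}/window_weight/= subrr lerDl.
by apply: sumr_ge0 => i _; exact: sqr_ge0.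
Unshelve. all: by end_near. Qed.

Lemma punctured_centered : \forall N \near \oo, forall a b w,
  qform N (punctured_kern N) (x a) (x b) w = qform N (punctured_kern N) (y a) (y b) w.
Proof.
near=> N => a b w; rewrite !XE; apply: qform_center => i ki.
have hN : ((h N).*2.+1 <= N)%N by near: N; exact: (window_narrow hK).
have N0 : (0 < N)%N by apply: leq_trans hN.
have Nr : 0 < N%:R :> R by rewrite ltr0n.
have p0 : 0 < 2 * pi :> R by rewrite mulr_gt0 ?pi_gt0.
apply: window_center => //; first by exists 0; rewrite /fourier_freq mulr0 mul0r.
apply/andP; split.
  have z0 : (i%:Z - (h N)%:Z)%:~R != 0 :> R.
    rewrite intr_eq0; apply: contra_neq ki => ki0.
    by rewrite /punctured ki0 eqxx.
  rewrite normr_gt0 /window_freq add0r /fourier_freq.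
  by apply: mulf_neq0; [apply: mulf_neq0 => //|apply: invr_neq0]; rewrite gt_eqF.
have := window_freq_dist (0 : R) i N0; rewrite subr0 => hf; apply: le_lt_trans hf _.
by rewrite -[ltRHS]mulr1 ltr_pM2l// ltr_pdivrMr// mul1r ltr_nat; lia.
Unshelve. all: by end_near. Qed.

(** The form with constant kernel is the product of two sums divided by
  [sqrt N]; it is a window with a single frequency, equal to [0]. *)
Lemma sample_mean_le a b : exists C, forall N, (0 < N)%N ->
  ex E (fun w => `|qform N (fun=> 1) (y a) (y b) w|) <= C.
Proof.
have [S bS] := rate_summable shift.
have S0 : 0 <= S by have := bS 0%N; rewrite big_ord0.
have li := @lip1_id R; have sY e t : sq E (Y id e t) by exact: (sq_Y shift).
exists (2 * (Num.sqrt (2 * nrm E (Y id a 0) * S) * Num.sqrt (2 * nrm E (Y id b 0) * S))) => N N0.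
have k1 : \sum_(i < 1) 1 = 1 :> R by rewrite big_ord1.
have v0 e : 0 <= 2 * nrm E (Y id e 0) * S by rewrite !mulr_ge0// nrm_ge0.
have [_] := @qform_le R T E N 1 (fun=> 1) (fun=> 0) 0 (y a) (y b) _ _ N0
  (fun=> ler01) k1 (fun s => sY a _) (fun s => sY b _) (v0 a) (v0 b)
  (Y_energy shift a li (bS N)) (Y_energy shift b li (bS N)).
suff -> : kern (fun=> 1) (fun _ : 'I_1 => 0) 0 = (fun=> 1 : R) by [].
by apply/funext => z; rewrite /kern big_ord1 mulr0 addr0 cos0 mulr1.
Qed.

Lemma lrc_est_consistent :
  consistent P (@enorm R d d) (fun N w => lrc_est (sample X N w)) (long_run_cov P X).
Proof.
have lY ka a b N : lf E (qform N ka (y a) (y b)).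
  by apply: qform_lf => s; apply: (sq_Y shift); exact: lip1_id.
have limE a b : long_run_cov P X a b = sumZ (limit a b 0 0).
  rewrite mxE -sumZN; congr sumZ; apply/funext => u.
  by rewrite (covarianceE shift) opprK /limit_term mulr0 addr0 cos0 mulr1.
apply: consistent_mx => a b => [N|].
  under eq_fun do rewrite lrc_est_entry.
  by apply: lfB; [exact: lf_qform|exact: lf_cst].
have [C HC] := sample_mean_le a b.
have cw : (fun N => ex E (fun w => `|qform N (window_kern h K 0 (fun=> 0) N) (y a) (y b) w -
    sumZ (limit a b 0 0)|)) @ \oo --> (0 : R).
  by apply: (qform_cvg shift hK a b 0); exact: cvg_cst.
have cb := cvgD0 cw (cvgMr0 C weight0_cvg).
apply: (squeeze_cvgr _ (cvg_cst 0) cb); near=> N.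
have N0 : (0 < N)%N by near: N; exists 1%N.
have cen : forall a b w,
  qform N (punctured_kern N) (x a) (x b) w = qform N (punctured_kern N) (y a) (y b) w.
  by near: N; exact: punctured_centered.
under ex_ext => w do rewrite lrc_est_entry limE cen.
have lp : lf E (fun w => qform N (punctured_kern N) (y a) (y b) w - sumZ (limit a b 0 0)).
  by apply: lfB; [exact: lY|exact: lf_cst].
have lw : lf E (fun w => qform N (window_kern h K 0 (fun=> 0) N) (y a) (y b) w -
    sumZ (limit a b 0 0)) by apply: lfB; [exact: lY|exact: lf_cst].
apply/andP; split; first by apply: ex_ge0 => //; exact: lf_norm.
have qE w : qform N (punctured_kern N) (y a) (y b) w =
    qform N (window_kern h K 0 (fun=> 0) N) (y a) (y b) w -
    K N 0 * qform N (fun=> 1) (y a) (y b) w.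
  rewrite /qform [K N 0 * _]mulrCA -mulrBr; congr (_ * _).
  rewrite mulr_sumr -sumrB; apply: eq_bigr => s _.
  rewrite mulr_sumr -sumrB; apply: eq_bigr => t _.
  by rewrite window_kern_punctured; ring.
have l1 : lf E (fun w => `|qform N (fun=> 1) (y a) (y b) w|) by apply: lf_norm; exact: lY.
apply: (@le_trans _ _ (ex E (fun w =>
   `|qform N (window_kern h K 0 (fun=> 0) N) (y a) (y b) w - sumZ (limit a b 0 0)| +
   `|K N 0| * `|qform N (fun=> 1) (y a) (y b) w|))).
  apply: ex_le => [||w].
  - exact: lf_norm.
  - by apply: lfD; [exact: lf_norm|exact: lfZ].
  by rewrite qE addrAC -normrM; exact: ler_normB.
rewrite exD; [|exact: lf_norm|exact: lfZ].
by rewrite exZ// lerD2l ler_wpM2l//; exact: HC.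
Unshelve. all: by end_near. Qed.

End consistency.

Theorem theorem3p3 (R : realType) (d : nat) (h : nat -> nat)
    (K : nat -> int -> R) (hK : weight_functions h K) :
  (forall (disp : measure_display) (T : measurableType disp)
      (P : probability T R) (m : nat) (xi : int -> T -> 'cV[R]_d)
      (g : (nat -> 'cV[R]_d) -> 'cV[R]_d)
      (gtr : forall l : nat, ('I_l.+1 -> 'cV[R]_d) -> 'cV[R]_d)
      (X : int -> T -> 'cV[R]_d),
    mdep_shift P m xi g gtr X ->
    forall (gN : nat -> R -> R),
      (forall N om, (0 < N)%N -> nearest_freq N om (gN N om)) ->
    forall om : R, - pi <= om <= pi ->
      (om = 0 -> mean P (X 0) = 0) ->
      consistent P (@enormC R d d)
        (fun N w => spec_est (h N) (K N) (sample X N w) (gN N om))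
        (spectral_density P X om))
  /\
  (exists Sig : forall N : nat, ('I_N -> 'cV[R]_d) -> 'M[R]_d,
    (forall N, mx_measurable (@borel_fam R d 'I_N) (Sig N)) /\
    forall (disp : measure_display) (T : measurableType disp)
      (P : probability T R) (m : nat) (xi : int -> T -> 'cV[R]_d)
      (g : (nat -> 'cV[R]_d) -> 'cV[R]_d)
      (gtr : forall l : nat, ('I_l.+1 -> 'cV[R]_d) -> 'cV[R]_d)
      (X : int -> T -> 'cV[R]_d),
    mdep_shift P m xi g gtr X ->
    consistent P (@enorm R d d)
      (fun N w => Sig N (sample X N w)) (long_run_cov P X)).
Proof.
split=> [disp T P m xi g gtr X shift gN gN_near om om_pi om_mean|].
  exact: (spec_est_consistent shift hK om_pi om_mean (fun N N0 => gN_near N om N0)).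
exists (@lrc_est R d h K); split=> [N|disp T P m xi g gtr X shift].
  exact: measurable_lrc_est.
exact: (lrc_est_consistent shift hK).
Qed.
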